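(* Let $\pi_2$ be a generator of $\mathrm{LT}[\pi^2]$ and let $g=\begin{pmatrix}a&b\\c&d\end{pmatrix}\in\mathrm{SL}_2(\mathcal{O}_F/\pi^2\mathcal{O}_F)$. For $a\in\mathcal{O}_F/\pi^2\mathcal{O}_F$ denote by $\bar a$ its image under the canonical map $\mathcal{O}_F/\pi^2\mathcal{O}_F\to\mathcal{O}_F/\pi\mathcal{O}_F$. Then $g$ acts on the reduction of $\mathbf{Y}^{\pi_2}_{2,2}$, given by $x^qy-xy^q=1$, $Z^q=x^{q^3}y-xy^{q^3}$, as $$g:\overline{\mathbf{Y}}^{\pi_2}_{2,2}\longrightarrow\overline{\mathbf{Y}}^{\pi_2}_{2,2};\quad (x,y,Z)\mapsto(\bar a x+\bar c y,\ \bar b x+\bar d y,\ Z).$$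
   Context: $F$ is a non-archimedean local field of equal characteristic $p>0$ with ring of integers $\mathcal{O}_F$, residue field $\mathbb{F}_q$ and uniformizer $\pi$; $\mathbf{C}$ is the completion of an algebraic closure of $F$, $v$ the valuation on $\mathbf{C}$ with $v(\pi)=1$. All spaces are rigid analytic curves considered over $\mathbf{C}$. For $u\in\mathbf{C}$ with $v(u)>0$ put $[\pi]_u(X)=X^{q^2}+uX^q+\pi X$, $[\pi^2]_u=[\pi]_u\circ[\pi]_u$, and for $a=a_0+a_1\pi\in\mathcal{O}_F/\pi^2\mathcal{O}_F$ with $a_0,a_1\in\mathbb{F}_q$ and $[\pi^2]_u(X)=0$ put $[a]_u(X)=a_0X+a_1[\pi]_u(X)$ (the formal module has additive addition law $X+Y$). Put $[\pi]_{\mathrm{LT}}(X)=\pi X-X^q$; a generator of $\mathrm{LT}[\pi^2]$ is an element $\pi_2\in\mathbf{C}$ with $[\pi]_{\mathrm{LT}}([\pi]_{\mathrm{LT}}(\pi_2))=0$ and $[\pi]_{\mathrm{LT}}(\pi_2)\neq 0$; then $v(\pi_2)=\frac{1}{q(q-1)}$. For $X_2,Y_2$ with $[\pi^2]_u(X_2)=[\pi^2]_u(Y_2)=0$ write $X_1=[\pi]_u(X_2)$, $Y_1=[\pi]_u(Y_2)$ and $$\mu_2(X_2,Y_2)=X_1Y_2^q-X_1^qY_2-X_2^qY_1+X_2Y_1^q .$$ $\mathcal{X}^{\pi_2}(\pi^2)$ is the rigid analytic curve with $\mathbf{C}$-points $\{(u,X_2,Y_2): v(u)>0,\ [\pi^2]_u(X_2)=[\pi^2]_u(Y_2)=0,\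 \mu_2(X_2,Y_2)=\pi_2\}$, and $\mathbf{Y}^{\pi_2}_{2,2}$ is its subspace defined by $v(u)\ge\frac{q}{q+1}$. The group $\mathrm{SL}_2(\mathcal{O}_F/\pi^2\mathcal{O}_F)$ acts on the right by $(u,X_2,Y_2)\mapsto(u,[a]_u(X_2)+[c]_u(Y_2),[b]_u(X_2)+[d]_u(Y_2))$. The reduction of a reduced affinoid over $\mathbf{C}$ is $\mathrm{Spec}$ of the ring of power-bounded functions modulo the topologically nilpotent functions. Coordinates on $\overline{\mathbf{Y}}^{\pi_2}_{2,2}$: choose $\alpha$ with $\alpha^{q(q+1)}=\pi_2$; then $x=X_2/\alpha$, $y=Y_2/\alpha$, and $Z$ is defined by $x^qy-xy^q=1+\gamma_1Z$, where $\gamma_1^q=\alpha^{(q-1)(q^2-1)}$. *)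

(* Defs.v *)
From HB Require Import structures.
From mathcomp Require Import all_boot all_order all_algebra.
From mathcomp Require Import generic_quotient.
(* mpoly has to be loaded before the classical and reals libraries: their
   notations can only be combined in this order. *)
From mathcomp Require Import mpoly.
From mathcomp Require Import boolp classical_sets functions.
From mathcomp Require Import reals constructive_ereal.

Set Implicit Arguments.
Unset Strict Implicit.
Unset Printing Implicit Defensive.

Import Order.TTheory GRing.Theory Num.Theory.
Local Open Scope ring_scope.

(* Quotients of commutative rings by arbitrary ideals.  The quotients of
   ring_quotient.v are restricted to proper decidable ideals of nonzero rings,
   a side condition that would have to be discharged before the rings below
   could even be formed. *)

Record ideal (R : comPzRingType) := Ideal {
  ideal_mem :> R -> Prop;
  ideal0 : ideal_mem 0;
  idealD : forall x y, ideal_mem x -> ideal_mem y -> ideal_mem (x + y);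
  idealMl : forall a x, ideal_mem x -> ideal_mem (a * x) }.

Section IdealQuotient.
Variables (R : comPzRingType) (I : ideal R).
Local Open Scope quotient_scope.

Definition ideal_equiv (x y : R) : bool := `[< I (x - y) >].

Lemma idealN x : I x -> I (- x).
Proof. by move=> Ix; rewrite -mulN1r; apply: idealMl. Qed.

Lemma ideal_equiv_is_equiv : equiv_class_of ideal_equiv.
Proof.
split=> [x|x y|y x z].
- by apply/asboolP; rewrite subrr; apply: ideal0.
- by apply/asboolP/asboolP => /idealN; rewrite opprB.
- move=> /asboolP h1 /asboolP h2; apply/asboolP.
  by rewrite -[x](subrK y) -addrA; apply: idealD.
Qed.

Canonical ideal_equiv_equiv := EquivRelPack ideal_equiv_is_equiv.
Canonical ideal_equiv_encModRel := defaultEncModRel ideal_equiv.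

Definition quot := {eq_quot ideal_equiv}.
HB.instance Definition _ : EqQuotient R ideal_equiv quot := EqQuotient.on quot.
HB.instance Definition _ := Choice.on quot.

Definition qpi (x : R) : quot := \pi x.

Lemma qpi_eq x y : qpi x = qpi y <-> I (x - y).
Proof.
split; first by move=> /eqP; rewrite /qpi piE => /asboolP.
by move=> h; apply/eqP; rewrite /qpi piE; apply/asboolP.
Qed.

Lemma qreprK (a : quot) : qpi (repr a) = a.
Proof. by rewrite /qpi reprK. Qed.

Lemma qpiP (a : quot) : exists x, a = qpi x.
Proof. by exists (repr a); rewrite qreprK. Qed.

Definition qadd (a b : quot) : quot := qpi (repr a + repr b).
Definition qopp (a : quot) : quot := qpi (- repr a).
Definition qmul (a b : quot) : quot := qpi (repr a * repr b).

Lemma qpi_add x y : qadd (qpi x) (qpi y) = qpi (x + y).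
Proof.
apply/qpi_eq; rewrite opprD addrACA.
by apply: idealD; apply/qpi_eq; rewrite qreprK.
Qed.

Lemma qpi_opp x : qopp (qpi x) = qpi (- x).
Proof.
by apply/qpi_eq; rewrite -opprD; apply: idealN; apply/qpi_eq; rewrite qreprK.
Qed.

Lemma qpi_mul x y : qmul (qpi x) (qpi y) = qpi (x * y).
Proof.
apply/qpi_eq; rewrite -(subrK (repr (qpi x) * y) (repr (qpi x) * _)) -addrA.
apply: idealD; first by rewrite -mulrBr; apply: idealMl; apply/qpi_eq/qreprK.
by rewrite -mulrBl mulrC; apply: idealMl; apply/qpi_eq/qreprK.
Qed.

Lemma qaddA : associative qadd.
Proof.
move=> a b c; case: (qpiP a) (qpiP b) (qpiP c) => [x ->] [y ->] [z ->].
by rewrite !qpi_add addrA.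
Qed.
Lemma qaddC : commutative qadd.
Proof.
by move=> a b; case: (qpiP a) (qpiP b) => [x ->] [y ->]; rewrite !qpi_add addrC.
Qed.
Lemma qadd0 : left_id (qpi 0) qadd.
Proof. by move=> a; case: (qpiP a) => [x ->]; rewrite qpi_add add0r. Qed.
Lemma qaddN : left_inverse (qpi 0) qopp qadd.
Proof. by move=> a; case: (qpiP a) => [x ->]; rewrite qpi_opp qpi_add addNr. Qed.

HB.instance Definition _ := GRing.isZmodule.Build quot qaddA qaddC qadd0 qaddN.

Lemma qmulA : associative qmul.
Proof.
move=> a b c; case: (qpiP a) (qpiP b) (qpiP c) => [x ->] [y ->] [z ->].
by rewrite !qpi_mul mulrA.
Qed.
Lemma qmulC : commutative qmul.
Proof.
by move=> a b; case: (qpiP a) (qpiP b) => [x ->] [y ->]; rewrite !qpi_mul mulrC.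
Qed.
Lemma qmul1 : left_id (qpi 1) qmul.
Proof. by move=> a; case: (qpiP a) => [x ->]; rewrite qpi_mul mul1r. Qed.
Lemma qmulDl : left_distributive qmul +%R.
Proof.
move=> a b c; case: (qpiP a) (qpiP b) (qpiP c) => [x ->] [y ->] [z ->].
by rewrite /GRing.add /= qpi_add !qpi_mul qpi_add mulrDl.
Qed.

HB.instance Definition _ :=
  GRing.Zmodule_isComPzRing.Build quot qmulA qmulC qmul1 qmulDl.

Lemma qpi_is_zmod_morphism : zmod_morphism qpi.
Proof. by move=> x y; rewrite /GRing.opp /= /GRing.add /= qpi_opp qpi_add. Qed.
HB.instance Definition _ := GRing.isZmodMorphism.Build R quot qpi
  qpi_is_zmod_morphism.

Lemma qpi_is_monoid_morphism : monoid_morphism qpi.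
Proof. by split=> // x y; rewrite /GRing.mul /= qpi_mul. Qed.
HB.instance Definition _ := GRing.isMonoidMorphism.Build R quot qpi
  qpi_is_monoid_morphism.

End IdealQuotient.

Section GeneratedIdeal.
Variables (R : comPzRingType) (s : seq R).

Definition ideal_gen_mem (x : R) : Prop :=
  exists c : 'I_(size s) -> R, x = \sum_(i < size s) c i * s`_i.

Lemma ideal_gen_mem0 : ideal_gen_mem 0.
Proof. by exists (fun=> 0); rewrite big1 // => i _; rewrite mul0r. Qed.
Lemma ideal_gen_memD x y :
  ideal_gen_mem x -> ideal_gen_mem y -> ideal_gen_mem (x + y).
Proof.
move=> [c ->] [d ->]; exists (fun i => c i + d i).
by rewrite -big_split; apply: eq_bigr => i _; rewrite mulrDl.
Qed.
Lemma ideal_gen_memMl a x : ideal_gen_mem x -> ideal_gen_mem (a * x).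
Proof.
move=> [c ->]; exists (fun i => a * c i).
by rewrite mulr_sumr; apply: eq_bigr => i _; rewrite mulrA.
Qed.

Definition ideal_gen : ideal R :=
  Ideal ideal_gen_mem0 ideal_gen_memD ideal_gen_memMl.

End GeneratedIdeal.

(* Meant for I contained in J. *)
Definition quot_map (R : comPzRingType) (I J : ideal R) (a : quot I) : quot J :=
  qpi J (repr a).

Record valuation (R : realType) (K : fieldType) := Valuation {
  vfun :> K -> \bar R;
  v_eqy : forall x, vfun x = +oo%E <-> x = 0;
  v_neqNy : forall x, vfun x <> -oo%E;
  vM : forall x y, vfun (x * y) = (vfun x + vfun y)%E;
  vD : forall x y, (Order.min (vfun x) (vfun y) <= vfun (x + y)%R)%E }.

Section ValuationTheory.
Variables (R : realType) (K : fieldType) (v : valuation R K).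

Lemma v0 : v 0 = +oo%E. Proof. by apply/v_eqy. Qed.

Lemma v_fin x : x != 0 -> exists r : R, v x = r%:E.
Proof.
move=> x0; case E : (v x) => [r||]; first by exists r.
- by move/v_eqy: E => E; rewrite E eqxx in x0.
- by have := v_neqNy E.
Qed.

Lemma v1 : v 1 = 0%E.
Proof.
have [r Er] := v_fin (oner_neq0 K).
have := vM v 1 1; rewrite mulr1 Er -EFinD => -[E].
by congr (_%:E); apply: (addIr r); rewrite -E add0r.
Qed.

Lemma vN1 : v (-1) = 0%E.
Proof.
have n0 : (-1 : K) != 0 by rewrite oppr_eq0 oner_neq0.
have [r Er] := v_fin n0.
have := vM v (-1) (-1); rewrite mulrNN mulr1 v1 Er -EFinD => -[/esym /eqP].
by rewrite -mulr2n mulrn_eq0 /= => /eqP ->.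
Qed.

Lemma vN x : v (- x) = v x.
Proof. by rewrite -mulN1r vM vN1 add0e. Qed.

Lemma v_ge_add (M : \bar R) x y :
  (M <= v x)%E -> (M <= v y)%E -> (M <= v (x + y)%R)%E.
Proof. by move=> h1 h2; apply: le_trans (vD v x y); rewrite le_min h1 h2. Qed.

Lemma v_ge_sub (M : \bar R) x y :
  (M <= v x)%E -> (M <= v y)%E -> (M <= v (x - y)%R)%E.
Proof. by move=> h1 h2; apply: v_ge_add => //; rewrite vN. Qed.

Lemma v_ge_sum (M : \bar R) (I : Type) (s : seq I) (Q : pred I) (f : I -> K) :
  (forall i, Q i -> (M <= v (f i))%E) -> (M <= v (\sum_(i <- s | Q i) f i)%R)%E.
Proof.
move=> h; elim/big_ind: _ => //; first by rewrite v0 leey.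
by move=> x y; apply: v_ge_add.
Qed.

Definition v_cvg (u : nat -> K) (l : K) : Prop :=
  forall M : R, exists N : nat, forall n, (N <= n)%N -> (M%:E <= v (u n - l)%R)%E.

Definition v_cauchy (u : nat -> K) : Prop :=
  forall M : R, exists N : nat, forall m n, (N <= m)%N -> (N <= n)%N ->
    (M%:E <= v (u m - u n)%R)%E.

Definition v_complete : Prop :=
  forall u : nat -> K, v_cauchy u -> exists l, v_cvg u l.

Definition vring_pred : {pred K} := [pred x : K | (0 <= v x)%E].

Record vring := VRing { vring_val : K; _ : vring_val \in vring_pred }.
HB.instance Definition _ := [isSub for vring_val].
HB.instance Definition _ := [Choice of vring by <:].

Lemma vring_closed : subring_closed vring_pred.
Proof.
split=> [|x y|x y]; rewrite !inE.
- by rewrite v1.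
- exact: v_ge_sub.
- by move=> h1 h2; rewrite vM adde_ge0.
Qed.
HB.instance Definition _ := GRing.isSubringClosed.Build K vring_pred vring_closed.
HB.instance Definition _ := [SubChoice_isSubComNzRing of vring by <:].

Lemma vring_valP (x : vring) : (0 <= v (val x))%E.
Proof. exact: valP x. Qed.

Lemma maxideal0 : (0 < v (val (0 : vring)%R))%E.
Proof. by rewrite rmorph0 v0 ltry. Qed.
Lemma maxidealD (x y : vring) :
  (0 < v (val x))%E -> (0 < v (val y))%E -> (0 < v (val (x + y)%R))%E.
Proof.
by move=> h1 h2; rewrite rmorphD /=; apply: lt_le_trans (vD v _ _); rewrite lt_min h1.
Qed.
Lemma maxidealMl (a x : vring) : (0 < v (val x))%E -> (0 < v (val (a * x)%R))%E.
Proof.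
move=> h; rewrite rmorphM /= vM; apply: lt_le_trans h _.
by rewrite leeDr // vring_valP.
Qed.
Definition maxideal : ideal vring :=
  @Ideal vring (fun x => (0 < v (val x))%E) maxideal0 maxidealD maxidealMl.

Definition residue := quot maxideal.
HB.instance Definition _ := GRing.ComPzRing.on residue.

Lemma residue1_neq0 : (1 : residue) != 0.
Proof.
apply/eqP => /qpi_eq; rewrite subr0 => h.
have {h} : (0 < v (val (1 : vring)%R))%E by [].
by rewrite rmorph1 v1 ltxx.
Qed.
HB.instance Definition _ := GRing.PzSemiRing_isNonZero.Build residue residue1_neq0.

End ValuationTheory.

Record vembedding (R : realType) (F K : fieldType)
    (vF : valuation R F) (v : valuation R K) := VEmbedding {
  vemb :> {rmorphism F -> K};
  vembP : forall x, v (vemb x) = vF x }.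

Section VEmbeddingTheory.
Variables (R : realType) (F K : fieldType).
Variables (vF : valuation R F) (v : valuation R K) (iota : vembedding vF v).

Lemma vemb_int (x : vring vF) : (0 <= v (iota (val x)))%E.
Proof. by rewrite vembP; apply: vring_valP. Qed.
Definition vemb_ring (x : vring vF) : vring v := VRing (vemb_int x).

End VEmbeddingTheory.

(* F is a local field of characteristic p, pi a uniformizer, q the order of the
   residue field, and vF is normalized by vF pi = 1. *)
Definition local_field (R : realType) (F : fieldType) (vF : valuation R F)
    (p q : nat) (pi : vring vF) : Prop :=
  [/\ p \in [pchar F],
      v_complete vF,
      forall x, x != 0 -> exists n : int, vF x = (n%:~R)%:E,
      vF (val pi) = 1%E
    & exists f : 'I_q -> residue vF, bijective f].

(* C is the completion of an algebraic closure of F: in the algebraically closed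
   field C the elements algebraic over F form an algebraic closure of F. *)
Definition completed_closure (R : realType) (F : fieldType) (C : closedFieldType)
    (vF : valuation R F) (v : valuation R C) (iota : vembedding vF v) : Prop :=
  v_complete v /\
  forall (x : C) (M : R), exists y : C,
    algebraicOver iota y /\ (M%:E <= v (x - y)%R)%E.

(* Reduced affinoids over C.  Here X is an analytic subset of the closed polydisc
   of points P with v(P_i) >= r_i, with its reduced structure.  As C is
   algebraically closed, the functions on it are functions on its C-points: the
   ring of analytic functions is the image of the Tate algebra of the polydisc,
   and its topology is that of the supremum norm. *)
Section Affinoid.
Variables (R : realType) (C : fieldType) (v : valuation R C) (n : nat).
Variables (r : 'I_n -> R) (X : set (n.-tuple C)).

Definition polydisc : set (n.-tuple C) :=
  [set P | forall i, ((r i)%:E <= v (tnth P i))%E].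

Definition affinoid : Type := set_type (polydisc `&` X)%classic.

Definition monomial (m : 'X_{1..n}) (P : n.-tuple C) : C :=
  \prod_(i < n) tnth P i ^+ m i.

(* Valuation of the term with coefficient c m in the Gauss norm of the polydisc. *)
Definition gauss_val (c : 'X_{1..n} -> C) (m : 'X_{1..n}) : \bar R :=
  (v (c m) + (\sum_(i < n) r i *+ m i)%R%:E)%E.

Definition restricted (c : 'X_{1..n} -> C) : Prop :=
  forall M : R, exists N : nat, forall m : 'X_{1..n}, (N <= mdeg m)%N ->
    (M%:E <= gauss_val c m)%E.

Definition partial_sum (c : 'X_{1..n} -> C) (N : nat) (P : n.-tuple C) : C :=
  \sum_(m : 'X_{1..n < N}) c m * monomial m P.

Definition analytic (f : affinoid -> C) : Prop :=
  exists c : 'X_{1..n} -> C, restricted c /\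
    forall P : affinoid, v_cvg v (fun N => partial_sum c N (val P)) (f P).

Definition power_bounded (f : affinoid -> C) : Prop :=
  exists M : R, forall (k : nat) P, (M%:E <= v ((f ^+ k)%R P))%E.

Definition topologically_nilpotent (f : affinoid -> C) : Prop :=
  forall M : R, exists N : nat, forall k P, (N <= k)%N ->
    (M%:E <= v ((f ^+ k)%R P))%E.

Lemma fctX (f : affinoid -> C) k P : (f ^+ k) P = f P ^+ k.
Proof. by elim: k => [|k IH]; rewrite ?expr0 // !exprS -IH. Qed.

Lemma v_exprn x k t : v x = t%:E -> v (x ^+ k) = (t *+ k)%:E.
Proof.
move=> h; elim: k => [|k IH]; first by rewrite expr0 v1 mulr0n.
by rewrite exprS vM IH h mulrS.
Qed.

Lemma power_boundedP (f : affinoid -> C) :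
  power_bounded f <-> forall P, (0 <= v (f P))%E.
Proof.
split=> [[M hM] P|h].
  have [->|fP0] := eqVneq (f P) 0; first by rewrite v0 leey.
  have [t Et] := v_fin v fP0; rewrite Et lee_fin leNgt; apply/negP => t0.
  have [k hk] : exists k : nat, `|M| < (- t) *+ k.
    have t0' : 0 < - t by rewrite oppr_gt0.
    exists (Num.bound (`|M| / - t)).
    rewrite -mulr_natr mulrC -ltr_pdivrMr //.
    by apply: archi_boundP; rewrite divr_ge0 // ltW.
  have := hM k P; rewrite fctX (v_exprn k Et) lee_fin leNgt => /negP; apply.
  rewrite -ltrN2 -mulNrn; apply: le_lt_trans hk.
  by rewrite -normrN ler_norm.
exists 0 => k P; rewrite fctX; elim: k => [|k IH]; first by rewrite expr0 v1.
by rewrite exprS vM adde_ge0.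
Qed.

Lemma topologically_nilpotentP (f : affinoid -> C) :
  topologically_nilpotent f <->
  exists2 e : R, 0 < e & forall P, (e%:E <= v (f P))%E.
Proof.
split=> [/(_ 1) [N hN]|[e e0 h] M].
  exists (N.+1%:R^-1); first by rewrite invr_gt0 ltr0Sn.
  move=> P; have [->|fP0] := eqVneq (f P) 0; first by rewrite v0 leey.
  have [t Et] := v_fin v fP0; rewrite Et lee_fin.
  have := hN N.+1 P (leqnSn _); rewrite fctX (v_exprn _ Et) lee_fin.
  by rewrite -[t *+ _]mulr_natr -ler_pdivrMr ?ltr0Sn // div1r.
exists (Num.bound (`|M| / e)).+1 => k P hk; rewrite fctX.
have [->|fP0] := eqVneq (f P) 0.
  by case: k hk => [//|k] _; rewrite expr0n v0 leey.
have [t Et] := v_fin v fP0; rewrite (v_exprn k Et) lee_fin.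
have et : e <= t by rewrite -lee_fin -Et.
apply: le_trans (ler_norm M) _; apply: (@le_trans _ _ (e *+ k)).
  rewrite -mulr_natr mulrC -ler_pdivrMr //.
  apply: ltW; apply: (@lt_le_trans _ _ (Num.bound (`|M| / e))%:R).
    by apply: archi_boundP; rewrite divr_ge0 // ltW.
  by rewrite ler_nat; apply: ltnW.
by rewrite lerMn2r et orbT.
Qed.

Lemma v_monomial (m : 'X_{1..n}) (P : affinoid) :
  ((\sum_(i < n) r i *+ m i)%R%:E <= v (monomial m (val P)))%E.
Proof.
have hP i : ((r i)%:E <= v (tnth (val P) i))%E.
  by have := valP P; rewrite inE => -[+ _]; apply.
rewrite /monomial; elim/big_rec2: _ => [|i y x _ IH]; first by rewrite v1.
rewrite vM EFinD; apply: leeD => //.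
elim: (m i) => [|k IHk]; first by rewrite expr0 v1.
by rewrite exprS mulrS vM EFinD leeD.
Qed.

Lemma v_term c (m : 'X_{1..n}) (P : affinoid) :
  (gauss_val c m <= v (c m * monomial m (val P))%R)%E.
Proof. by rewrite vM leeD2l // v_monomial. Qed.

Lemma gauss_val_neqNy c m : gauss_val c m != -oo%E.
Proof. by rewrite /gauss_val; case: (v (c m)) (@v_neqNy _ _ v (c m)). Qed.

Lemma restricted_lb c : restricted c ->
  exists B : R, forall m : 'X_{1..n}, (B%:E <= gauss_val c m)%E.
Proof.
move=> /(_ 0) [N hN].
have [B hB] : exists B : R, forall m : 'X_{1..n < N},
    m \in enum {: 'X_{1..n < N}} -> (B%:E <= gauss_val c m)%E.
  elim: (enum _) => [|a s [B hB]]; first by exists 0.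
  have [B' hB'] : exists B' : R, (B'%:E <= gauss_val c a)%E.
    have := gauss_val_neqNy c a; case: (gauss_val c a) => [t||] // _.
      by exists t.
    by exists 0; rewrite leey.
  exists (Num.min B B') => m; rewrite inE => /orP [/eqP ->|/hB h].
    by apply: le_trans hB'; rewrite lee_fin ge_min lexx orbT.
  by apply: le_trans h; rewrite lee_fin ge_min lexx.
exists (Num.min B 0) => m; have [lt_mN|le_Nm] := ltnP (mdeg m) N.
  have := hB (BMultinom lt_mN) (mem_enum _ _) => h.
  by apply: le_trans h; rewrite lee_fin ge_min lexx.
by apply: le_trans (hN m le_Nm); rewrite lee_fin ge_min lexx orbT.
Qed.

Definition trunc (c : 'X_{1..n} -> C) (N : nat) : {mpoly C[n]} :=
  \sum_(m : 'X_{1..n < N}) c m *: 'X_[m].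

Lemma trunc_coef c N m : (trunc c N)@_m = if (mdeg m < N)%N then c m else 0.
Proof.
case: ifP => h; first by rewrite mcoeff_mpoly.
rewrite /trunc raddf_sum big1 //= => i _; rewrite mcoeffZ mcoeffX.
case: eqP => [E|_]; last by rewrite mulr0.
by move: h; rewrite -E bmdeg.
Qed.

Lemma truncE c N P : (trunc c N).@[tnth P] = partial_sum c N P.
Proof.
rewrite /trunc raddf_sum; apply: eq_bigr => m _ /=.
by rewrite mevalZ mevalX.
Qed.

Definition conv (a b : 'X_{1..n} -> C) (m : 'X_{1..n}) : C :=
  \sum_(k : 'X_{1..n < (mdeg m).+1, (mdeg m).+1} | m == (k.1 + k.2)%MM)
    a k.1 * b k.2.

Lemma gauss_val_mul a b m k1 k2 : m = (k1 + k2)%MM ->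
  (v (a k1 * b k2)%R + (\sum_(i < n) r i *+ m i)%R%:E)%E =
  (gauss_val a k1 + gauss_val b k2)%E.
Proof.
move=> ->; have -> : \sum_(i < n) r i *+ (k1 + k2)%MM i =
    \sum_(i < n) r i *+ k1 i + \sum_(i < n) r i *+ k2 i.
  by rewrite -big_split; apply: eq_bigr => i _; rewrite mnmDE mulrnDr.
by rewrite vM EFinD /gauss_val addeACA.
Qed.

Lemma shift_le (x y : \bar R) (t : R) :
  (x <= y + t%:E)%E = (x - t%:E <= y)%E.
Proof. by rewrite leeBlDr. Qed.

(* Uniform bound for the coefficients of products of total degree >= N. *)
Lemma restricted_mul_lb a b : restricted a -> restricted b ->
  forall M : R, exists N : nat, forall m k1 k2 : 'X_{1..n}, (N <= mdeg m)%N ->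
    m = (k1 + k2)%MM -> (M%:E <= gauss_val a k1 + gauss_val b k2)%E.
Proof.
move=> ra rb M; have [A hA] := restricted_lb ra; have [B hB] := restricted_lb rb.
have [N1 h1] := ra (M - B); have [N2 h2] := rb (M - A).
exists (N1 + N2)%N => m k1 k2 hm E.
have [le1|lt1] := leqP N1 (mdeg k1).
  have -> : M = (M - B) + B by rewrite subrK.
  by rewrite EFinD leeD // h1.
have le2 : (N2 <= mdeg k2)%N.
  move: hm; rewrite E mdegD => hm; rewrite leqNgt; apply/negP => lt2.
  by have := leq_ltn_trans hm (leq_add lt1 (ltnW lt2)); rewrite ltnn.
have -> : M = A + (M - A) by rewrite addrC subrK.
by rewrite EFinD leeD // h2.
Qed.

Lemma restricted_conv a b : restricted a -> restricted b -> restricted (conv a b).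
Proof.
move=> ra rb M; have [N hN] := restricted_mul_lb ra rb M.
exists N => m hm; rewrite /gauss_val shift_le; apply: v_ge_sum => k /eqP E.
by rewrite -shift_le (gauss_val_mul _ _ E); apply: hN E.
Qed.

Lemma v_cvg_const (l : C) : v_cvg v (fun=> l) l.
Proof. by move=> M; exists 0%N => k _; rewrite subrr v0 leey. Qed.

Lemma v_cvgB u u' (l l' : C) :
  v_cvg v u l -> v_cvg v u' l' -> v_cvg v (fun k => u k - u' k) (l - l').
Proof.
move=> h h' M; have [N1 h1] := h M; have [N2 h2] := h' M.
exists (maxn N1 N2) => k; rewrite geq_max => /andP [/h1 g1 /h2 g2].
have -> : u k - u' k - (l - l') = (u k - l) - (u' k - l').
  by rewrite !opprD !opprK addrACA.
exact: v_ge_sub.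
Qed.

Lemma v_cvgM u u' (l l' : C) :
  v_cvg v u l -> v_cvg v u' l' -> v_cvg v (fun k => u k * u' k) (l * l').
Proof.
move=> h h' M.
have lb (x : C) : exists A : R, (A%:E <= v x)%E.
  have [->|/(v_fin v) [t ->]] := eqVneq x 0; first by exists 0; rewrite v0 leey.
  by exists t.
have [A hA] := lb l; have [A' hA'] := lb l'.
have [N0 h0] := h 0; have [N1 h1] := h (M - A'); have [N2 h2] := h' (M - A).
have [N3 h3] := h' M.
exists (maxn N0 (maxn N1 (maxn N2 N3))) => k.
rewrite !geq_max => /and4P [/h0 g0 /h1 g1 /h2 g2 /h3 g3].
have -> : u k * u' k - l * l' =
    (u k - l) * (u' k - l') + ((u k - l) * l' + l * (u' k - l')).
  by rewrite addrA -mulrDr subrK mulrBl mulrBr addrA subrK.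
apply: v_ge_add; last apply: v_ge_add; rewrite vM.
- by rewrite -[M]add0r EFinD leeD.
- by rewrite -[M](subrK A') EFinD leeD.
- by rewrite -[M](subrK A) [_ + A]addrC EFinD leeD.
Qed.

Lemma v_cvg_near u u' (l : C) : v_cvg v u l -> v_cvg v (fun k => u' k - u k) 0 ->
  v_cvg v u' l.
Proof.
move=> h h' M; have [N1 h1] := h M; have [N2 h2] := h' M.
exists (maxn N1 N2) => k; rewrite geq_max => /andP [/h1 g1 /h2 g2].
rewrite subr0 in g2; rewrite -[u' k](subrK (u k)) -addrA; exact: v_ge_add.
Qed.

Lemma v_cvg_conv a b (P : affinoid) : restricted a -> restricted b ->
  v_cvg v (fun N => partial_sum (conv a b) N (val P)
    - partial_sum a N (val P) * partial_sum b N (val P)) 0.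
Proof.
move=> ra rb M; have [N0 hN0] := restricted_mul_lb ra rb M.
exists N0 => N hN; rewrite subr0 -!truncE -rmorphM -raddfB /= mevalE.
apply: v_ge_sum => m _.
have -> : \prod_i tnth (val P) i ^+ m i = monomial m (val P) by [].
have [lt_mN|le_Nm] := ltnP (mdeg m) N.
  rewrite mcoeffB trunc_coef lt_mN mcoeffM /conv -sumrB big1 ?mul0r ?v0 ?leey //.
  move=> k _.
  have lt1 : (mdeg k.1 < N)%N by apply: leq_ltn_trans lt_mN; rewrite -ltnS bmdeg.
  have lt2 : (mdeg k.2 < N)%N by apply: leq_ltn_trans lt_mN; rewrite -ltnS bmdeg.
  by rewrite !trunc_coef lt1 lt2 subrr.
rewrite vM; apply: le_trans (leeD2l _ (v_monomial m P)).
rewrite mcoeffB trunc_coef ltnNge le_Nm /= sub0r vN mcoeffM shift_le.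
apply: v_ge_sum => k /eqP E; rewrite -shift_le !trunc_coef.
case: ifP => _; last by rewrite mul0r v0 addye // leey.
case: ifP => _; last by rewrite mulr0 v0 addye // leey.
by rewrite (gauss_val_mul _ _ E); apply: hN0 E; apply: leq_trans le_Nm.
Qed.

Lemma analyticB f g : analytic f -> analytic g -> analytic (f - g).
Proof.
move=> [a [ra ha]] [b [rb hb]]; exists (fun m => a m - b m); split.
  move=> M; have [N1 h1] := ra M; have [N2 h2] := rb M.
  exists (maxn N1 N2) => m; rewrite geq_max => /andP [/h1 g1 /h2 g2].
  by rewrite /gauss_val shift_le; apply: v_ge_sub; rewrite -shift_le.
move=> P; have := v_cvgB (ha P) (hb P); congr (v_cvg v _ _).
apply/funext => N; rewrite /partial_sum -sumrB; apply: eq_bigr => m _.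
by rewrite mulrBl.
Qed.

Lemma analyticM f g : analytic f -> analytic g -> analytic (f * g).
Proof.
move=> [a [ra ha]] [b [rb hb]]; exists (conv a b); split.
  exact: restricted_conv.
by move=> P; apply: v_cvg_near (v_cvgM (ha P) (hb P)) _; apply: v_cvg_conv.
Qed.

Lemma analytic_cst (l : C) : analytic (fun=> l).
Proof.
exists (fun m => if m == 0%MM then l else 0); split.
  move=> M; exists 1%N => m hm; rewrite /gauss_val.
  case: eqP => [E|_]; last by rewrite v0 addye // leey.
  by move: hm; rewrite E mdeg0.
move=> P M; exists 1%N => N hN; rewrite /partial_sum.
have h0 : (mdeg (0%MM : 'X_{1..n}) < N)%N by rewrite mdeg0.
rewrite (bigD1 (BMultinom h0)) //= eqxx big1 ?addr0 => [|m hm].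
  rewrite /monomial big1 => [|i _]; last by rewrite mnm0E expr0.
  by rewrite mulr1 subrr v0 leey.
case: eqP => [E|_]; last by rewrite mul0r.
by case/eqP: hm; apply: val_inj.
Qed.

Definition bounded_pred : {pred affinoid -> C} :=
  [pred f | `[< analytic f /\ power_bounded f >]].

Record bounded_fun := BoundedFun {
  bounded_val :> affinoid -> C; _ : bounded_val \in bounded_pred }.
HB.instance Definition _ := [isSub for bounded_val].
HB.instance Definition _ := [Choice of bounded_fun by <:].

Lemma bounded_closed : subring_closed bounded_pred.
Proof.
split=> [|f g|f g]; rewrite !inE.
- split; first exact: (analytic_cst 1).
  by apply/power_boundedP => P; rewrite v1.
- move=> [af /power_boundedP pf] [ag /power_boundedP pg].
  split; first exact: analyticB.
  by apply/power_boundedP => P; apply: v_ge_sub.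
- move=> [af /power_boundedP pf] [ag /power_boundedP pg].
  split; first exact: analyticM.
  by apply/power_boundedP => P; rewrite vM adde_ge0.
Qed.
HB.instance Definition _ := GRing.SubChoice_isSubComPzRing.Build
  (affinoid -> C) bounded_pred bounded_fun bounded_closed.

Lemma bounded_ge0 (f : bounded_fun) P : (0 <= v (f P))%E.
Proof. by have := valP f; rewrite inE => -[_ /power_boundedP]; apply. Qed.

Lemma topnil0 : topologically_nilpotent (val (0 : bounded_fun)).
Proof.
rewrite rmorph0; apply/topologically_nilpotentP; exists 1 => // P.
by rewrite v0 leey.
Qed.
Lemma topnilD (f g : bounded_fun) :
  topologically_nilpotent (val f) -> topologically_nilpotent (val g) ->
  topologically_nilpotent (val (f + g)).
Proof.
rewrite rmorphD => /topologically_nilpotentP [e e0 he].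
move=> /topologically_nilpotentP [e' e0' he'].
apply/topologically_nilpotentP; exists (Num.min e e') => [|P].
  by rewrite lt_min e0.
by apply: v_ge_add; [apply: le_trans (he P)|apply: le_trans (he' P)];
  rewrite lee_fin ge_min lexx ?orbT.
Qed.
Lemma topnilMl (f g : bounded_fun) :
  topologically_nilpotent (val g) -> topologically_nilpotent (val (f * g)).
Proof.
rewrite rmorphM => /topologically_nilpotentP [e e0 he].
apply/topologically_nilpotentP; exists e => // P.
rewrite vM; apply: le_trans (he P) _.
by rewrite leeDr // bounded_ge0.
Qed.
Definition topnil : ideal bounded_fun :=
  @Ideal bounded_fun (fun f => topologically_nilpotent (val f))
    topnil0 topnilD topnilMl.

(* The coordinate ring of the reduction, an algebra over the residue field of C
   through reduction_cst. *)
Definition reduction := quot topnil.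
HB.instance Definition _ := GRing.ComPzRing.on reduction.

Lemma bounded_cst_proof (x : vring v) : (fun=> val x) \in bounded_pred.
Proof.
rewrite inE; split; first exact: analytic_cst.
by apply/power_boundedP => P; apply: vring_valP.
Qed.
Definition bounded_cst (x : vring v) : bounded_fun := BoundedFun (bounded_cst_proof x).

Definition reduction_cst (a : residue v) : reduction :=
  qpi topnil (bounded_cst (repr a)).

Lemma reduction_cst_qpi x :
  reduction_cst (qpi (maxideal v) x) = qpi topnil (bounded_cst x).
Proof.
apply/qpi_eq; set y := repr _.
have /qpi_eq : qpi (maxideal v) y = qpi (maxideal v) x by rewrite qreprK.
move=> h; have {h} : (0 < v (val (y - x)%R))%E by [].
rewrite rmorphB => h; apply/topologically_nilpotentP.
have [e e0 he] : exists2 e : R, 0 < e & (e%:E <= v (val y - val x)%R)%E.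
  by move: h; case: (v _) => [t||] // h; [exists t|exists 1; rewrite ?leey].
by exists e => // P; rewrite rmorphB.
Qed.

Lemma reduction_cst_zmod : zmod_morphism reduction_cst.
Proof.
move=> a b; case: (qpiP a) (qpiP b) => [x ->] [y ->].
rewrite -rmorphB !reduction_cst_qpi -rmorphB; congr (qpi _ _).
by apply: val_inj; rewrite !rmorphB; apply/funext.
Qed.
HB.instance Definition _ := GRing.isZmodMorphism.Build (residue v) reduction
  reduction_cst reduction_cst_zmod.

Lemma reduction_cst_monoid : monoid_morphism reduction_cst.
Proof.
split=> [|a b].
  rewrite -(rmorph1 (qpi (maxideal v))) reduction_cst_qpi -(rmorph1 (qpi topnil)).
  by congr (qpi _ _); apply: val_inj; rewrite !rmorph1; apply/funext.
case: (qpiP a) (qpiP b) => [x ->] [y ->].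
rewrite -rmorphM !reduction_cst_qpi -rmorphM; congr (qpi _ _).
by apply: val_inj; rewrite !rmorphM; apply/funext.
Qed.
HB.instance Definition _ := GRing.isMonoidMorphism.Build (residue v) reduction
  reduction_cst reduction_cst_monoid.

End Affinoid.

Section Curve.
Variables (R : realType) (F C : fieldType).
Variables (vF : valuation R F) (v : valuation R C) (iota : vembedding vF v).
Variables (q : nat) (pi : vring vF).

Definition OF_mod (n : nat) := quot (ideal_gen [:: pi ^+ n]).
HB.instance Definition _ n := GRing.ComPzRing.on (OF_mod n).

Definition pi_LT (X : C) : C := iota (val pi) * X - X ^+ q.

Definition LT2_generator (t : C) : Prop :=
  pi_LT (pi_LT t) = 0 /\ pi_LT t <> 0.

Definition pi_mul (u X : C) : C := X ^+ (q ^ 2) + u * X ^+ q + iota (val pi) * X.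

(* The digits of a = a_0 + a_1 pi in F_q, which is identified with the set of
   roots of X^q - X in O_F. *)
Definition is_digits (a : OF_mod 2) (d : vring vF * vring vF) : Prop :=
  [/\ d.1 ^+ q = d.1, d.2 ^+ q = d.2
    & a = qpi (ideal_gen [:: pi ^+ 2]) (d.1 + d.2 * pi)].

Definition digits (a : OF_mod 2) : vring vF * vring vF :=
  xget (0, 0) [set d | is_digits a d]%classic.

Definition formal_mul (u : C) (a : OF_mod 2) (X : C) : C :=
  iota (val (digits a).1) * X + iota (val (digits a).2) * pi_mul u X.

Definition mu2 (u X2 Y2 : C) : C :=
  let X1 := pi_mul u X2 in let Y1 := pi_mul u Y2 in
  X1 * Y2 ^+ q - X1 ^+ q * Y2 - X2 ^+ q * Y1 + X2 * Y1 ^+ q.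

Definition curve (pi2 : C) : set (3.-tuple C) :=
  [set P | let u := tnth P 0 in let X2 := tnth P 1 in let Y2 := tnth P 2 in
    [/\ (0 < v u)%E, pi_mul u (pi_mul u X2) = 0, pi_mul u (pi_mul u Y2) = 0
      & mu2 u X2 Y2 = pi2]]%classic.

Definition Y22_radius : R := q%:R / q.+1%:R.

Definition Y22_set (pi2 : C) : set (3.-tuple C) :=
  [set P | curve pi2 P /\ (Y22_radius%:E <= v (tnth P 0%R))%E]%classic.

(* Y22_set is realized in the polydisc v(u) >= q/(q+1), v(X_2), v(Y_2) >= 0.
   It lies in it, since [pi^2]_u is monic with integral coefficients. *)
Definition Y22_radii (i : 'I_3) : R := tnth [tuple Y22_radius; 0; 0] i.

Definition Y22 (pi2 : C) : Type := affinoid v Y22_radii (Y22_set pi2).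

Definition Y22_bounded (pi2 : C) := bounded_fun v Y22_radii (Y22_set pi2).
HB.instance Definition _ pi2 := GRing.ComPzRing.on (Y22_bounded pi2).

Definition Y22_topnil (pi2 : C) : ideal (Y22_bounded pi2) :=
  topnil v Y22_radii (Y22_set pi2).

Definition Y22_reduction (pi2 : C) := quot (Y22_topnil pi2).
HB.instance Definition _ pi2 := GRing.ComPzRing.on (Y22_reduction pi2).

Definition right_act (g : 'M[OF_mod 2]_2) (P : 3.-tuple C) : 3.-tuple C :=
  let u := tnth P 0 in let X2 := tnth P 1 in let Y2 := tnth P 2 in
  [tuple u; formal_mul u (g 0 0) X2 + formal_mul u (g 1 0) Y2;
            formal_mul u (g 0 1) X2 + formal_mul u (g 1 1) Y2].

Definition bar (a : OF_mod 2) : OF_mod 1 :=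
  quot_map (ideal_gen [:: pi ^+ 1]) a.

(* The canonical map from O_F / pi to the residue field of C. *)
Definition to_residue (a : OF_mod 1) : residue v :=
  qpi (maxideal v) (vemb_ring iota (repr a)).

Definition Y22_scalar (pi2 : C) (a : OF_mod 1) : Y22_reduction pi2 :=
  reduction_cst Y22_radii (Y22_set pi2) (to_residue a).

(* x^q y - x y^q = 1 and Z^q = x^(q^3) y - x y^(q^3), in the variables
   x = 'X_0, y = 'X_1, Z = 'X_2. *)
Definition reduction_eqns : seq {mpoly (residue v)[3]} :=
  [:: 'X_0 ^+ q * 'X_1 - 'X_0 * 'X_1 ^+ q - 1;
      'X_2 ^+ q - ('X_0 ^+ (q ^ 3) * 'X_1 - 'X_0 * 'X_1 ^+ (q ^ 3))].

(* The ring of functions on Y22 modulo topologically nilpotent ones is generated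
   by x, y, Z over the residue field of C, with reduction_eqns as relations. *)
Definition presents_reduction (pi2 : C) (x y Z : Y22_reduction pi2) : Prop :=
  let J := ideal_gen reduction_eqns in
  exists Phi : {rmorphism quot J -> Y22_reduction pi2},
    [/\ bijective Phi,
        forall c : residue v, Phi (qpi J c%:MP) =
          reduction_cst Y22_radii (Y22_set pi2) c
      & [/\ Phi (qpi J 'X_0) = x, Phi (qpi J 'X_1) = y & Phi (qpi J 'X_2) = Z]].

End Curve.

(* Main.v *)
Require Import Defs.
From HB Require Import structures.
From mathcomp Require Import all_boot all_order all_algebra all_solvable all_field.
From mathcomp Require Import generic_quotient.
From mathcomp Require Import mpoly.
From mathcomp Require Import boolp classical_sets functions.
From mathcomp Require Import reals constructive_ereal.
From mathcomp Require Import ring lra zify.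

(** Write D_n(x, y) = x^n y - x y^n, and let A = v(alpha) = 1 / (q^2 (q^2 - 1)).

    Shape of the affinoid.  The pairing mu_2 satisfies
    mu_2^q = D_q(X_1, Y_1) + pi mu_2, so D_q(X_1, Y_1) = -[pi]_LT(pi_2) is a
    constant and u = - D_(q^2)(X_1, Y_1) / D_q(X_1, Y_1) is a function of the level
    one points.  A Newton polygon argument (root_bound) gives v(X_1) >= q^2 A and
    v(X_2) >= A, hence x, y and om = u / alpha^(q^3 (q - 1)) are integral.
    Rewritten in these coordinates, mu_2 = pi_2 becomes (Z_rel)
    Z^q = D_(q^3)(x, y) + alpha * (integral), so Z is integral as well, while
    D_q(x, y) = 1 + gamma1 Z.  Both equations of the reduction hold
    modulo alpha; moreover om is modulo alpha a polynomial in x and y (nf_om).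

    No further relations.  Put z = Z - x^(q^2 - 1).  The two equations rewrite
    every polynomial in x, y, z into a combination of the normal monomials
    x^i y^j z^l with l < q and (i < q or j = 0).  Each integral solution (a, b) of
    D_q(a, b) = 1 lifts to a point of the affinoid with (x, y, z) close to
    (a^q, b^q, D_(q^3)(a, b) - a^(q^3 - q)) (point_lift).  Letting (a, b) approach
    the cusp b / a = 0, where a has a simple pole, the normal monomials have
    pairwise distinct orders: subtracting x^(q^2 - 1) has made the pole order
    of z prime to q.  So there is no cancellation, and a normal
    combination that is small on the affinoid has small coefficients
    (normal_small).  The cusp does not consist of integral points; smallness is
    transported there by writing a combination, up to a power of a, as a
    polynomial of degree less than q in b, whose coefficients are bounded by
    interpolation at points with unit differences (curve_small).

    Generation.  A bounded analytic function is close to a polynomial in the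
    coordinates with possibly large coefficients.  In normal form, up to a
    high power of alpha (normal_approx), independence forces its coefficients
    to be integral (bounded_approx).  With independence this proves that x, y and
    Z present the reduction (presentation).

    Action.  The digits of the entries of g are fixed by the q-power map, hence
    g acts linearly on (X_1, Y_1), and on (X_2, Y_2) up to level one points, which
    become small after division by alpha.  So x and y are transformed linearly by
    the first digits.  Since D_(q^3) is multiplied by the determinant 1, Z^q is
    preserved up to a small error, and so is Z because the q-power map is additive. *)

Set Implicit Arguments.
Unset Strict Implicit.
Unset Printing Implicit Defensive.
Import Order.TTheory GRing.Theory Num.Theory.
Local Open Scope ring_scope.

(** * Valuations and roots of polynomials *)

(** The relation v(x) >= M for a real bound M; congruences modulo small elements
    are written vge v e (x - y). *)
Notation vge v M x := ((M%R)%:E <= vfun v x%R)%E.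

Section Val.
Variables (R : realType) (K : fieldType) (v : valuation R K).
Implicit Types (x y : K) (M N r s : R).

Lemma vge_trans M N x : M <= N -> vge v N x -> vge v M x.
Proof. by move=> h; apply: le_trans; rewrite lee_fin. Qed.

Lemma vge_mul M N x y :
  vge v M x -> vge v N y -> vge v (M + N) (x * y).
Proof. by move=> h1 h2; rewrite vM EFinD leeD. Qed.

Lemma vge_mull N x y :
  vge v 0 x -> vge v N y -> vge v N (x * y).
Proof. by move=> h1 h2; rewrite -[N]add0r; apply: vge_mul. Qed.

Lemma vge_mulr N x y :
  vge v N x -> vge v 0 y -> vge v N (x * y).
Proof. by move=> h1 h2; rewrite mulrC; apply: vge_mull. Qed.

Lemma vge_exp M x n : vge v M x -> vge v (M *+ n) (x ^+ n).
Proof.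
move=> h; elim: n => [|n IH]; first by rewrite expr0 v1.
by rewrite exprS mulrS; apply: vge_mul.
Qed.

Lemma vge0_exp x n : vge v 0 x -> vge v 0 (x ^+ n).
Proof. by move=> h; have := vge_exp n (h : vge v 0 x); rewrite mul0rn. Qed.

Lemma vge0_mul x y : vge v 0 x -> vge v 0 y -> vge v 0 (x * y).
Proof. by move=> h1 h2; apply: (@vge_mull 0). Qed.

Lemma v_neq0 x r : v x = r%:E -> x != 0.
Proof. by move=> h; apply/eqP => x0; rewrite x0 v0 in h. Qed.

Lemma v_exp x n r : v x = r%:E -> v (x ^+ n) = (r *+ n)%:E.
Proof. exact: v_exprn. Qed.

Lemma v_inv x r : v x = r%:E -> v x^-1 = (- r)%:E.
Proof.
move=> h; have x0 := v_neq0 h.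
have [s hs] : exists s : R, v x^-1 = s%:E by apply: v_fin; rewrite invr_eq0.
have := vM v x x^-1; rewrite divff // v1 h hs -EFinD => -[e].
by congr (_%:E); lra.
Qed.

Lemma v_mul x y r s : v x = r%:E -> v y = s%:E -> v (x * y) = (r + s)%:E.
Proof. by move=> h1 h2; rewrite vM h1 h2. Qed.

Lemma v_div x y r s : v x = r%:E -> v y = s%:E -> v (x / y) = (r - s)%:E.
Proof. by move=> h1 h2; apply: v_mul => //; apply: v_inv. Qed.

Lemma vge_div M x y s :
  v y = s%:E -> vge v (M + s) x -> vge v M (x / y).
Proof.
move=> h1 h2; have -> : M = (M + s) + (- s) by lra.
by apply: vge_mul => //; rewrite (v_inv h1).
Qed.

Lemma vge_exp_inv M x n :
  (0 < n)%N -> vge v (M *+ n) (x ^+ n) -> vge v M x.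
Proof.
move=> n0; have [->|/(v_fin v) [r hr]] := eqVneq x 0; first by rewrite v0 leey.
by rewrite (v_exp _ hr) hr !lee_fin lerMn2r eqn0Ngt n0.
Qed.

Lemma v_exp_inv x n r :
  (0 < n)%N -> v (x ^+ n) = (r *+ n)%:E -> v x = r%:E.
Proof.
move=> n0 h; have : x != 0.
  by apply/eqP => x0; move: h; rewrite x0 expr0n eqn0Ngt n0 v0.
move=> /(v_fin v) [s hs]; move: h; rewrite (v_exp _ hs) hs => -[/eqP].
by rewrite eqrMn2r eqn0Ngt n0 /= => /eqP ->.
Qed.

(** Otherwise x = (x + y) - y would be a difference of elements of larger valuation. *)
Lemma v_dom x y r s :
  v x = r%:E -> r < s -> vge v s y -> v (x + y) = r%:E.
Proof.
move=> hx rs hy; apply/eqP; rewrite eq_le; apply/andP; split.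
  rewrite leNgt; apply/negP => lt.
  have : (r%:E < v x)%E.
    rewrite -[x](addrK y); apply: lt_le_trans (vD v _ _).
    by rewrite lt_min lt vN; apply: lt_le_trans hy; rewrite lte_fin.
  by rewrite hx ltxx.
apply: v_ge_add; first by rewrite hx.
by apply: vge_trans hy; apply: ltW.
Qed.

Lemma v_unit_near x M : 0 < M -> vge v M (x - 1) -> v x = 0%:E.
Proof. by move=> M0 h; rewrite -[x](subrK 1) addrC; apply: v_dom M0 h; apply: v1. Qed.

End Val.

Section RootNear.
Variables (R : realType) (K : closedFieldType) (v : valuation R K).

(** A monic polynomial is the product of the differences with its roots, so a
    small value at z forces one of the roots to be close to z. *)
Lemma root_near (P : {poly K}) (n : nat) (z : K) (e : R) :
  P \is monic -> size P = n.+1 -> vge v (e *+ n) P.[z] ->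
  (0 < n)%N -> exists2 x, P.[x] = 0 & vge v e (z - x).
Proof.
move=> Pm sP hz n0; have [rs Ers] := closed_field_poly_normal P.
rewrite (monicP Pm) scale1r in Ers.
have srs : size rs = n.
  by apply: succn_inj; rewrite -sP Ers size_prod_XsubC.
have [/hasP [x xrs hx]|/hasPn no] := boolP (has (fun x => vge v e (z - x)) rs).
  by exists x => //; apply/rootP; rewrite Ers root_prod_XsubC.
(* Otherwise every factor, hence the product, has too small a valuation. *)
exfalso; move: hz; rewrite leNgt => /negP; apply.
rewrite Ers horner_prod -srs.
move: no; have : rs != [::] by rewrite -size_eq0 srs -lt0n.
elim: {Ers srs} rs => [//|x [|y rs] IH] _ no.
  rewrite big_seq1 /= mulr1n hornerXsubC ltNge.
  by apply: no; rewrite inE.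
rewrite big_cons hornerXsubC vM [size _]/= mulrS EFinD; apply: lteD.
  by rewrite ltNge; apply: no; rewrite inE eqxx.
by apply: IH => // t ht; apply: no; rewrite inE ht orbT.
Qed.

(** Newton interpolation: dividing by differences that are units does not
    change valuations, so smallness at as many such nodes as there are
    coefficients passes to the coefficients. *)
Lemma small_coef (rs : seq K) (P : {poly K}) (M : R) :
  (forall x, x \in rs -> vge v 0 x) ->
  uniq rs -> {in rs &, forall x y, x != y -> v (x - y) = 0%:E} ->
  (size P <= size rs)%N ->
  (forall x, x \in rs -> vge v M P.[x]) ->
  forall i, vge v M P`_i.
Proof.
elim: rs P => [|a rs IH] P int.
  by move=> _ _; rewrite leqn0 size_poly_eq0 => /eqP -> _ i; rewrite coef0 v0 leey.
move=> /= /andP [ars urs] diff sP hP i.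
have /factor_theorem [Q EQ] : root (P - (P.[a])%:P) a.
  by rewrite /root !hornerE subrr.
have EP : P = Q * ('X - a%:P) + (P.[a])%:P by rewrite -EQ subrK.
have ha := hP a (mem_head _ _).
have sQ : (size Q <= size rs)%N.
  have [->|Q0] := eqVneq Q 0; first by rewrite size_poly0.
  have : size (Q * ('X - a%:P)) = (size Q).+1.
    by rewrite size_Mmonic ?monicXsubC // size_XsubC addn2.
  have : (size (Q * ('X - a%:P))%R <= (size rs).+1)%N.
    rewrite -EQ; apply: leq_trans (size_polyD _ _) _.
    rewrite geq_max sP size_polyN; apply: leq_trans (size_polyC_leq1 _) _.
    by [].
  by move=> h1 h2; move: h1; rewrite h2.
have hQ j : vge v M Q`_j.
  apply: IH => //.
  - by move=> x xrs; apply: int; rewrite inE xrs orbT.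
  - by move=> x y hx hy; apply: diff; rewrite inE ?hx ?hy orbT.
  move=> x xrs; have xa : x != a by apply: contraNneq ars => <-.
  have d0 : v (x - a) = 0%:E.
    by apply: diff => //; rewrite inE ?eqxx ?xrs ?orbT.
  have hx : P.[x] - P.[a] = Q.[x] * (x - a).
    by rewrite {1}EP !hornerE addrK.
  rewrite (_ : Q.[x] = (P.[x] - P.[a]) / (x - a)); last first.
    by rewrite hx mulfK // subr_eq0.
  apply: (vge_div d0); rewrite addr0; apply: v_ge_sub => //.
  by apply: hP; rewrite inE xrs orbT.
rewrite EP mulrBr !coefE; apply: v_ge_add; last first.
  by case: (i == 0%N) => //; rewrite v0 leey.
apply: v_ge_sub; first by case: (i == 0%N) => //; rewrite v0 leey.
by apply: vge_mulr => //; apply: int; rewrite mem_head.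
Qed.

(** A nonzero constant derivative is coprime to the polynomial; this provides
    enough interpolation nodes in characteristic p. *)
Lemma simple_roots (P : {poly K}) (c : K) :
  P != 0 -> c != 0 -> P^`() = c%:P ->
  exists rs : seq K, [/\ uniq rs, size rs = (size P).-1
    & forall x, (x \in rs) = (P.[x] == 0)].
Proof.
move=> P0 c0 dP; have [rs E] := closed_field_poly_normal P.
have l0 : lead_coef P != 0 by rewrite lead_coef_eq0.
exists rs; split.
- rewrite -separable_prod_XsubC.
  have : separable_poly P.
    by rewrite unlock dP -[c%:P]mulr1 mul_polyC coprimepZr // coprimep1.
  move/(dvdp_separable _); apply.
  by rewrite [X in _ %| X]E dvdpZr.
- by rewrite E size_scale // size_prod_XsubC.
- by move=> x; rewrite -rootE E rootZ // root_prod_XsubC.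
Qed.

End RootNear.

(** * The alternating form and the pairing mu_2 *)

Section Moore.
Variables (K : comNzRingType) (q : nat).
Hypothesis frobD : forall x y : K, (x + y) ^+ q = x ^+ q + y ^+ q.

Definition alt (n : nat) (x y : K) : K := x ^+ n * y - x * y ^+ n.

(** mu_2 with the level one points as independent variables; it can then be
    expanded without unfolding [pi]_u. *)
Definition mu_form (x x1 y y1 : K) : K :=
  x1 * y ^+ q - x1 ^+ q * y - x ^+ q * y1 + x * y1 ^+ q.

Lemma frob0 : (0 : K) ^+ q = 0.
Proof. by apply: (addrI (0 ^+ q : K)); rewrite -frobD !addr0. Qed.

Lemma frobN x : (- x : K) ^+ q = - x ^+ q.
Proof. by apply: (addrI (x ^+ q)); rewrite -frobD !subrr frob0. Qed.

Lemma frobB (x y : K) : (x - y) ^+ q = x ^+ q - y ^+ q.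
Proof. by rewrite frobD frobN. Qed.

Lemma expq2 (x : K) : x ^+ (q ^ 2) = (x ^+ q) ^+ q.
Proof. by rewrite -exprM expnS expn1. Qed.

Lemma expq3 (x : K) : x ^+ (q ^ 3) = ((x ^+ q) ^+ q) ^+ q.
Proof. by rewrite -!exprM !expnS expn0 muln1 mulnA. Qed.

Lemma frob_alt n x y : (alt n x y) ^+ q = alt n (x ^+ q) (y ^+ q).
Proof. by rewrite /alt frobB !exprMn -!exprM ![(n * q)%N]mulnC. Qed.

Lemma frobD2 (x y : K) : (x + y) ^+ (q ^ 2) = x ^+ (q ^ 2) + y ^+ (q ^ 2).
Proof. by rewrite !expq2 !frobD. Qed.
Lemma frobD3 (x y : K) : (x + y) ^+ (q ^ 3) = x ^+ (q ^ 3) + y ^+ (q ^ 3).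
Proof. by rewrite !expq3 !frobD. Qed.

(** The determinant of the matrix with rows (x, y), (x^q, y^q) and
   (x^(q^2), y^(q^2)) bordered by one of its own columns vanishes. *)
Lemma moore_relation (x y : K) :
  x ^+ (q ^ 2) * alt q x y - x ^+ q * alt (q ^ 2) x y + x * alt q x y ^+ q = 0.
Proof. rewrite frob_alt /alt !expq2; ring. Qed.
Lemma moore_relation' (x y : K) :
  y ^+ (q ^ 2) * alt q x y - y ^+ q * alt (q ^ 2) x y + y * alt q x y ^+ q = 0.
Proof. rewrite frob_alt /alt !expq2; ring. Qed.

Section Torsion.
Variables (u w X Y X1 Y1 : K).
Hypothesis hX1 : X ^+ (q ^ 2) + u * X ^+ q + w * X = X1.
Hypothesis hY1 : Y ^+ (q ^ 2) + u * Y ^+ q + w * Y = Y1.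

(** Eliminates the level one points; D_q^q - D_(q^3) is what survives when
    u and pi tend to 0. *)
Lemma mu_formE :
  mu_form X X1 Y Y1 =
    alt q X Y ^+ q - alt (q ^ 3) X Y
    - (w * alt q X Y + u ^+ q * alt (q ^ 2) X Y + w ^+ q * alt q X Y).
Proof.
rewrite /mu_form -hX1 -hY1 frob_alt /alt !frobD !exprMn !expq3 !expq2.
ring.
Qed.

Hypothesis hX : X1 ^+ (q ^ 2) + u * X1 ^+ q + w * X1 = 0.
Hypothesis hY : Y1 ^+ (q ^ 2) + u * Y1 ^+ q + w * Y1 = 0.

(** The pairing mu_2 intertwines the formal module with the Lubin-Tate module:
    the determinant of the level one points is -[pi]_LT of mu_2. *)
Lemma mu_form_frob :
  mu_form X X1 Y Y1 ^+ q = alt q X1 Y1 + w * mu_form X X1 Y Y1.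
Proof.
have eX : X1 ^+ (q ^ 2) = - (u * X1 ^+ q + w * X1).
  by apply/eqP; rewrite -subr_eq0 opprK addrA; apply/eqP.
have eY : Y1 ^+ (q ^ 2) = - (u * Y1 ^+ q + w * Y1).
  by apply/eqP; rewrite -subr_eq0 opprK addrA; apply/eqP.
have e2X : X ^+ (q ^ 2) = X1 - u * X ^+ q - w * X by rewrite -hX1; ring.
have e2Y : Y ^+ (q ^ 2) = Y1 - u * Y ^+ q - w * Y by rewrite -hY1; ring.
rewrite /mu_form frobD !frobB !exprMn -!expq2 eX eY e2X e2Y /alt.
ring.
Qed.

(** Eliminating w between the two level one equations. *)
Lemma alt_u : u * alt q X1 Y1 = - alt (q ^ 2) X1 Y1.
Proof.
have -> : u * alt q X1 Y1 = (X1 ^+ (q ^ 2) + u * X1 ^+ q + w * X1) * Y1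
   - (Y1 ^+ (q ^ 2) + u * Y1 ^+ q + w * Y1) * X1 - alt (q ^ 2) X1 Y1.
  by rewrite /alt; ring.
by rewrite hX hY; ring.
Qed.

End Torsion.

Section Act.
Variables (X Y X1 Y1 a0 a1 b0 b1 c0 c1 d0 d1 : K).
Hypotheses (ha0 : a0 ^+ q = a0) (ha1 : a1 ^+ q = a1) (hb0 : b0 ^+ q = b0)
  (hb1 : b1 ^+ q = b1) (hc0 : c0 ^+ q = c0) (hc1 : c1 ^+ q = c1)
  (hd0 : d0 ^+ q = d0) (hd1 : d1 ^+ q = d1).

(** A matrix over O_F / pi^2 with digits a0 + a1 pi and so on acts on level two
    points by the pairs of digits, and on level one points by the first digits
    alone.  Both digits of its determinant appear. *)
Lemma mu_form_act :
  mu_form (a0 * X + a1 * X1 + (c0 * Y + c1 * Y1)) (a0 * X1 + c0 * Y1)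
          (b0 * X + b1 * X1 + (d0 * Y + d1 * Y1)) (b0 * X1 + d0 * Y1) =
  (a0 * d0 - b0 * c0) * mu_form X X1 Y Y1
  - (a0 * d1 + a1 * d0 - b0 * c1 - b1 * c0) * alt q X1 Y1.
Proof.
rewrite /mu_form /alt !frobD !exprMn ha0 ha1 hb0 hb1 hc0 hc1 hd0 hd1; ring.
Qed.

Lemma alt_lin x y n : a0 ^+ n = a0 -> b0 ^+ n = b0 -> c0 ^+ n = c0 ->
  d0 ^+ n = d0 -> (forall x y : K, (x + y) ^+ n = x ^+ n + y ^+ n) ->
  alt n (a0 * x + c0 * y) (b0 * x + d0 * y) = (a0 * d0 - b0 * c0) * alt n x y.
Proof.
by move=> ea eb ec ed fn; rewrite /alt !fn !exprMn ea eb ec ed; ring.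
Qed.

End Act.
End Moore.

(** * Digits in the local field *)

(** The bijection and the inverses turn T into a finite field, with q elements.
    Its additive group is elementary abelian, so q is a prime power. *)
Lemma finite_field_facts (T : comNzRingType) (q : nat) (f : 'I_q -> T) :
  bijective f -> (forall x : T, x != 0 -> exists y, y * x = 1) ->
  (forall x : T, x ^+ q = x) /\
  exists p n, [/\ prime p, (p%:R : T) = 0 & q = (p ^ n)%N].
Proof.
move=> [g fK gK] hinv.
(* A total inverse with inv 0 = 0, as the field structure requires. *)
have /choice [inv hinv'] : forall x : T, exists y, (x != 0 -> y * x = 1) /\ (x = 0 -> y = 0).
  move=> x; have [->|x0] := eqVneq x 0; first by exists 0.
  by have [y hy] := hinv x x0; exists y; split=> // /eqP; rewrite (negPf x0).
pose mF := GRing.ComNzRing_isField.Build T (fun x => proj1 (hinv' x)) (proj2 (hinv' 0) erefl).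
pose mC := CanIsCountable gK.
have enumP : Finite.axiom [seq f i | i <- enum 'I_q].
  move=> x; rewrite count_uniq_mem ?(map_inj_uniq (can_inj fK)) ?enum_uniq //.
  by rewrite -[x]gK map_f ?mem_enum.
pose mN := isFinite.Build T enumP.
pose L : finFieldType := HB.pack T mF mC mN.
have cL : #|L| = q.
  by rewrite -[RHS]card_ord; apply: (bij_eq_card (f := (g : L -> 'I_q))); exists f.
split=> [x|]; first by have := @expf_card L x; rewrite cL.
have [p pp pc] := finPcharP L.
exists p; have ab : (p.-abelem [set: L])%g by apply: fin_ring_pchar_abelem.
have [n hn] := p_natP (abelem_pgroup ab).
exists n; split=> //; first by have := pcharf0 pc.
by rewrite -hn cardsT.
Qed.

Lemma det_mx2 (S : comPzRingType) (A : 'M[S]_2) :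
  \det A = A 0 0 * A 1 1 - A 0 1 * A 1 0.
Proof.
rewrite (expand_det_row A 0) !big_ord_recl big_ord0 addr0 /cofactor !det_mx11.
rewrite !mxE /= expr0 expr1 mul1r mulN1r mulrN.
by congr (_ * A _ _ - A _ _ * A _ _); apply: val_inj.
Qed.

Section LocalField.
Variables (R : realType) (F : fieldType) (vF : valuation R F).
Variables (p q : nat) (pi : vring vF).
Hypothesis hF : local_field p q pi.

Lemma pcharF : p \in [pchar F]. Proof. by case: hF. Qed.

Lemma residue_inv (x : residue vF) : x != 0 -> exists y, y * x = 1.
Proof.
case: (qpiP x) => a -> a0.
have va : ~ (0 < vF (val a))%E.
  by move=> h; case/eqP: a0; apply/qpi_eq; rewrite subr0.
have va0 : vF (val a) = 0%:E.
  apply/eqP; rewrite eq_le; apply/andP; split; last exact: vring_valP.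
  by rewrite leNgt; apply/negP.
have h : (val a)^-1 \in vring_pred vF by rewrite inE (v_inv va0) oppr0.
exists (qpi _ (VRing h)); rewrite -rmorphM -[1](rmorph1 (qpi (maxideal vF))).
congr (qpi _ _); apply: val_inj => /=; rewrite mulVf //.
exact: v_neq0 va0.
Qed.

(** The value group is Z, so positive valuation means valuation at least 1. *)
Lemma residue_facts :
  (forall x : vring vF, vge vF 1 (val x ^+ q - val x)) /\ exists n, q = (p ^ n)%N.
Proof.
have [_ _ vZ _ [f bf]] := hF.
have [h1 [p' [n [pp' p0 qE]]]] := finite_field_facts bf residue_inv.
split=> [x|].
  have := h1 (qpi _ x); rewrite -rmorphXn => /qpi_eq h.
  have {h} : (0 < vF (val (x ^+ q - x)%R))%E by [].
  rewrite rmorphB rmorphXn /=; set y := _ - _.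
  have [->|/vZ [k ->]] := eqVneq y 0; first by rewrite v0 leey.
  by rewrite lte_fin lee_fin ltr0z ler1z.
exists n; rewrite qE; congr (_ ^ _)%N.
have pchar' : p' \in [pchar (residue vF)] by rewrite inE pp' p0 /=.
have pcharp : p \in [pchar (residue vF)].
  rewrite inE (pcharf_prime pcharF) /= -(rmorph_nat (qpi (maxideal vF))).
  have -> : (p%:R : vring vF) = 0.
    by apply: val_inj; rewrite rmorph_nat /=; apply: pcharf0 pcharF.
  by rewrite rmorph0.
by have := pcharf_eq pchar' p; rewrite pcharp => /esym /eqP ->.
Qed.

Lemma q_gt1 : (1 < q)%N.
Proof.
have [_ _ _ _ [f [g fK gK]]] := hF.
have h01 : (g 0 != g 1)%R.
  by rewrite (can_eq gK) eq_sym; apply: residue1_neq0.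
case: (q) g h01 {f fK gK} => [|[|k]] g //; first by case: (g 0).
by rewrite !ord1 eqxx.
Qed.

Lemma pcharF_frob (K : comNzRingType) (x y : K) : p \in [pchar K] ->
  (x + y) ^+ q = x ^+ q + y ^+ q.
Proof.
move=> hp; have [_ [n qE]] := residue_facts.
by apply: exprDn_pchar; rewrite qE pnatX pnatE ?(pcharf_prime hp) // hp.
Qed.

(** Teichmuller representatives: x^(q^n) converges, as raising a difference to
    the power q multiplies its valuation by q.  The limit is fixed by the q-power
    map. *)
Lemma teichmuller (x : vring vF) :
  exists d : vring vF, d ^+ q = d /\ vge vF 1 (val x - val d).
Proof.
have [hx _] := residue_facts; have q1 := q_gt1.
pose u n := val x ^+ (q ^ n).
have uS n : u n.+1 = u n ^+ q by rewrite /u expnSr exprM.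
have frob (y z : F) : (y - z) ^+ q = y ^+ q - z ^+ q.
  by apply: frobB => s t; apply: pcharF_frob pcharF.
have step n : vge vF n.+1%:R (u n.+1 - u n).
  elim: n => [|n IH]; first by rewrite uS /u expr1; apply: hx.
  rewrite uS [u n.+1 in X in _ - X]uS -frob.
  apply: vge_trans (vge_exp q IH).
  by rewrite -natr1 -[_ *+ q]mulr_natr -natrM natr1 ler_nat; nia.
have dist n k : vge vF n.+1%:R (u (n + k)%N - u n).
  elim: k => [|k IH]; first by rewrite addn0 subrr v0 leey.
  rewrite addnS -[u (n + k).+1](subrK (u (n + k)%N)) -addrA.
  apply: v_ge_add => //; apply: vge_trans (step _).
  by rewrite ler_nat ltnS leq_addr.
have [_ cF _ _ _] := hF.
have /cF [d hd] : v_cauchy vF u.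
  move=> M; pose N := Num.bound `|M|; exists N.
  have hN k : (N <= k)%N -> M <= k.+1%:R.
    move=> Nk; apply: le_trans (ler_norm _) _.
    apply: le_trans (ltW (archi_boundP (normr_ge0 M))) _.
    by rewrite ler_nat; apply: leq_trans Nk _.
  have tri m : (N <= m)%N -> vge vF M (u m - u N).
    move=> Nm; rewrite -(subnKC Nm); apply: vge_trans (dist _ _).
    by apply: hN.
  move=> m n hm hn; rewrite -[u m](subrK (u N)) -addrA -[_ - u n]opprB.
  by apply: v_ge_sub; apply: tri.
have vd : vge vF 1 (val x - d).
  have [N hN] := hd 1; rewrite -[val x](subrK (u N)) -addrA.
  apply: v_ge_add; last exact: hN.
  rewrite -[val x]/(val x ^+ (q ^ 0)) -opprB vN.
  by have := dist 0%N N; rewrite add0n.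
have vd0 : d \in vring_pred vF.
  rewrite inE -[d](subKr (val x)); apply: v_ge_sub; first exact: vring_valP.
  by apply: vge_trans vd; rewrite ler01.
exists (VRing vd0); split=> //; apply: val_inj; rewrite rmorphXn /=.
apply/eqP; rewrite -subr_eq0; apply/eqP/(v_eqy vF)/eqyP => M M0.
have [N hN] := hd M.
rewrite -[d ^+ q](subrK (u N.+1)) -addrA; apply: v_ge_add; last exact: hN.
rewrite uS -frob -opprB frobN; last by move=> s t; apply: pcharF_frob pcharF.
rewrite vN; apply: vge_trans (vge_exp q (hN N (leqnn N))).
by rewrite -mulr_natr ler_pMr // ler1n ltnW.
Qed.

Lemma v_pi : vF (val pi) = 1%:E. Proof. by case: hF. Qed.

Lemma pi_idealP k (x : vring vF) :
  ideal_gen [:: pi ^+ k] x <-> vge vF k%:R (val x).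
Proof.
have vpk : vF (val pi ^+ k) = (k%:R)%:E by rewrite (v_exp _ v_pi).
split.
  move=> [c ->]; rewrite big_ord_recl big_ord0 addr0 rmorphM.
  by apply: vge_mull; [apply: vring_valP|rewrite rmorphXn /= vpk].
move=> hx; have h : val x / val pi ^+ k \in vring_pred vF.
  by rewrite inE; apply: (vge_div vpk); rewrite add0r.
exists (fun=> VRing h); rewrite big_ord_recl big_ord0 addr0.
by apply: val_inj; rewrite rmorphM [X in _ * X]rmorphXn /= divfK // (v_neq0 vpk).
Qed.

(** The second digit represents the quotient by pi of the error made by the
    first. *)
Lemma digitsP (a : OF_mod pi 2) : is_digits q a (digits q a).
Proof.
apply: (@xgetPex _ (0, 0) [set d | is_digits q a d]%classic).
case: (qpiP a) => x ->; have [d1 [hd1 h1]] := teichmuller x.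
have hy : (val x - val d1) / val pi \in vring_pred vF.
  by rewrite inE; apply: (vge_div v_pi); rewrite add0r.
have [d2 [hd2 h2]] := teichmuller (VRing hy); exists (d1, d2); split=> //=.
apply/qpi_eq/pi_idealP; rewrite rmorphB rmorphD rmorphM opprD addrA.
rewrite -[val x - val d1](divfK (v_neq0 v_pi)) -mulrBl.
by apply: (vge_mul h2); rewrite v_pi.
Qed.

(** d^q = d forces v(d) = q v(d): a digit is 0 or a unit. *)
Lemma digits_small (d : vring vF) : d ^+ q = d -> (0 < vF (val d))%E -> d = 0.
Proof.
move=> hd; have [->//|d0] := eqVneq d 0.
have vd0 : val d != 0 by [].
have [r hr] := v_fin vF vd0; rewrite hr lte_fin => r0.
have : vF (val d ^+ q) = (r *+ q)%:E by apply: v_exp.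
rewrite -rmorphXn hd hr => -[/eqP].
have := q_gt1; case: (q) => [|[|k]] // _.
by rewrite eq_sym -subr_eq0 mulrSr addrK mulrn_eq0 /= gt_eqF.
Qed.

(** Sums and products of digits are digits because the q-power map is additive.
    So the expansion of the determinant in powers of pi can be compared digit
    by digit. *)
Lemma digits_det (g : 'M[OF_mod pi 2]_2) :
  let d i j := digits q (g i j) in
  \det g = 1 ->
  (d 0 0).1 * (d 1 1).1 - (d 0 1).1 * (d 1 0).1 = 1 /\
  (d 0 0).1 * (d 1 1).2 + (d 0 0).2 * (d 1 1).1
    - (d 0 1).1 * (d 1 0).2 - (d 0 1).2 * (d 1 0).1 = 0.
Proof.
move=> d; rewrite det_mx2.
have [a0 a1 ea] := digitsP (g 0 0); have [b0 b1 eb] := digitsP (g 0 1).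
have [c0 c1 ec] := digitsP (g 1 0); have [e0 e1 ee] := digitsP (g 1 1).
rewrite -/(d 0 0) -/(d 0 1) -/(d 1 0) -/(d 1 1) in a0 a1 b0 b1 c0 c1 e0 e1 ea eb ec ee *.
set I := ideal_gen [:: pi ^+ 2] in ea eb ec ee.
move=> hg; have {hg ea eb ec ee} : qpi I (((d 0 0).1 + (d 0 0).2 * pi) *
    ((d 1 1).1 + (d 1 1).2 * pi) - ((d 0 1).1 + (d 0 1).2 * pi) *
    ((d 1 0).1 + (d 1 0).2 * pi)) = qpi I 1.
  by move: hg; rewrite ea eb ec ee rmorphB !rmorphM rmorph1; apply.
move: (d 0 0) (d 0 1) (d 1 0) (d 1 1) a0 a1 b0 b1 c0 c1 e0 e1.
move=> [a0 a1] [b0 b1] [c0 c1] [e0 e1] /= ha0 ha1 hb0 hb1 hc0 hc1 he0 he1.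
move=> /qpi_eq/pi_idealP.
have frob (y z : vring vF) : (y + z) ^+ q = y ^+ q + z ^+ q.
  by apply: val_inj; rewrite !(rmorphD, rmorphXn) /=; apply: pcharF_frob pcharF.
set x := a0 * e0 - b0 * c0 - 1.
set y := a0 * e1 + a1 * e0 - b0 * c1 - b1 * c0.
rewrite (_ : _ - 1 = x + y * pi + (a1 * e1 - b1 * c1) * pi ^+ 2); last first.
  by rewrite /x /y; ring.
move=> h; have {h} h2 : vge vF 2 (val (x + y * pi)).
  rewrite -[x + y * pi](addrK ((a1 * e1 - b1 * c1) * pi ^+ 2)) rmorphB.
  apply: v_ge_sub => //; rewrite rmorphM rmorphXn.
  by apply: vge_mull; [apply: vring_valP|rewrite /= (v_exp _ v_pi)].
have x0 : x = 0.
  apply: digits_small.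
    by rewrite /x !frobB // !exprMn ha0 he0 hb0 hc0 expr1n.
  apply: (@lt_le_trans _ _ 1%:E) => //.
  rewrite -[x](addrK (y * pi)) rmorphB; apply: v_ge_sub.
    by apply: vge_trans h2; rewrite ler1n.
  by rewrite rmorphM; apply: vge_mull; [apply: vring_valP|rewrite v_pi].
split; first by apply/eqP; rewrite -subr_eq0; apply/eqP.
apply: digits_small.
  by rewrite !frobB // frob !exprMn ha0 ha1 he0 he1 hb0 hb1 hc0 hc1.
apply: (@lt_le_trans _ _ 1%:E) => //.
rewrite -/y -[val y](mulfK (v_neq0 v_pi)); apply: (vge_div v_pi).
by move: h2; rewrite x0 add0r rmorphM.
Qed.

End LocalField.

(** * Analytic functions, polynomials and substitution *)

Section Analytic.
Variables (R : realType) (C : fieldType) (v : valuation R C) (n : nat).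
Variables (r : 'I_n -> R) (X : set (n.-tuple C)).
Local Notation affd := (affinoid v r X).
Local Notation gv := (gauss_val v r).

Lemma v_cvg_bound (u : nat -> C) (l : C) (M : R) (N : nat) :
  v_cvg v u l -> (forall k, (N <= k)%N -> vge v M (u k)) -> vge v M l.
Proof.
move=> hu hM; have [N' hN'] := hu M; pose k := maxn N N'.
rewrite -[l](subKr (u k)); apply: v_ge_sub; first by apply: hM; rewrite leq_maxl.
by apply: hN'; rewrite leq_maxr.
Qed.

Lemma analytic_poly (p : {mpoly C[n]}) :
  analytic (fun P : affd => p.@[tnth (val P)]).
Proof.
exists (fun m => p@_m); split=> [M|P M]; exists (msize p).
  move=> m hm; rewrite /gauss_val (memN_msupp_eq0 (msize_mdeg_ge hm)).
  by rewrite v0 addye // leey.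
move=> N hN; rewrite -truncE (_ : trunc _ N = p) ?subrr ?v0 ?leey //.
apply/mpolyP => m; rewrite trunc_coef; case: ltnP => // hm.
by rewrite memN_msupp_eq0 // msize_mdeg_ge // (leq_trans hN).
Qed.

(** The terms of large degree are uniformly small on the affinoid. *)
Lemma analytic_approx (f : affd -> C) (M : R) : analytic f ->
  exists p : {mpoly C[n]}, forall P, vge v M (f P - p.@[tnth (val P)]).
Proof.
move=> [c [rc hc]]; have [N hN] := rc M; exists (trunc c N) => P.
rewrite truncE.
apply: (@v_cvg_bound (fun k => partial_sum c k (val P) - partial_sum c N (val P)) _ _ N).
  by apply: v_cvgB; [apply: hc | apply: v_cvg_const].
move=> k Nk; rewrite -!truncE -raddfB /= mevalE; apply: v_ge_sum => m _.
have -> : \prod_i tnth (val P) i ^+ m i = monomial m (val P) by [].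
rewrite vM; apply: le_trans (leeD2l _ (v_monomial m P)).
rewrite mcoeffB !trunc_coef; case: (ltnP (mdeg m) N) => [h|h].
  by rewrite (leq_trans h Nk) subrr v0 addye // leey.
by rewrite subr0; case: ifP => _; [apply: hN|rewrite v0 addye // leey].
Qed.

Section Comp.

(** The lower bound on degrees keeps the substitution of p into power series finite
    in each degree; the upper one shows that high degrees of the result only
    come from high degrees of the series. *)
Definition gauss_box (a b : nat) (M : R) (p : {mpoly C[n]}) : Prop :=
  forall m, p@_m != 0 ->
    [/\ (a <= mdeg m)%N, (mdeg m <= b)%N & (M%:E <= gv (fun m => p@_m) m)%E].

Lemma gauss_box1 : gauss_box 0 0 0 1.
Proof.
move=> m hm; have -> : m = 0%MM.
  by apply/eqP; move: hm; rewrite mcoeff1; case: (m == 0%MM); rewrite ?eqxx.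
rewrite mdeg0 leqnn; split=> //; rewrite /gauss_val mcoeff1 eqxx v1 add0e.
by rewrite big1 // => i _; rewrite mnm0E.
Qed.

Lemma gauss_boxM a b M a' b' M' p p' : gauss_box a b M p -> gauss_box a' b' M' p' ->
  gauss_box (a + a') (b + b') (M + M') (p * p').
Proof.
move=> h h' m hm; split.
- rewrite leqNgt; apply: contra hm => lt; apply/eqP; rewrite mcoeffM big1 //.
  move=> [k1 k2] /= /eqP E; rewrite E mdegD in lt.
  have [->|/h [g1 _ _]] := eqVneq p@_k1 0; first by rewrite mul0r.
  have [->|/h' [g2 _ _]] := eqVneq p'@_k2 0; first by rewrite mulr0.
  by move: lt; rewrite ltnNge leq_add.
- rewrite leqNgt; apply: contra hm => lt; apply/eqP; rewrite mcoeffM big1 //.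
  move=> [k1 k2] /= /eqP E; rewrite E mdegD in lt.
  have [->|/h [_ g1 _]] := eqVneq p@_k1 0; first by rewrite mul0r.
  have [->|/h' [_ g2 _]] := eqVneq p'@_k2 0; first by rewrite mulr0.
  by move: lt; rewrite ltnNge leq_add.
rewrite /gauss_val shift_le mcoeffM; apply: v_ge_sum => -[k1 k2] /= /eqP E.
have [->|/h [_ _ g1]] := eqVneq p@_k1 0; first by rewrite mul0r v0 leey.
have [->|/h' [_ _ g2]] := eqVneq p'@_k2 0; first by rewrite mulr0 v0 leey.
rewrite -shift_le (gauss_val_mul v r (fun m => p@_m) (fun m => p'@_m) E).
by rewrite EFinD; apply: leeD.
Qed.

Lemma gauss_boxX a b M p k : gauss_box a b M p ->
  gauss_box (a * k) (b * k) (M *+ k) (p ^+ k).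
Proof.
move=> h; elim: k => [|k IH]; first by rewrite !muln0; apply: gauss_box1.
by rewrite exprS !mulnS mulrS; apply: gauss_boxM.
Qed.

Lemma gauss_box_ge a b M p (m : 'X_{1..n}) : gauss_box a b M p ->
  (M%:E - (\sum_(i < n) r i *+ m i)%R%:E <= v p@_m)%E.
Proof.
move=> h; have [->|/h [_ _ g]] := eqVneq p@_m 0; first by rewrite v0 leey.
by rewrite -shift_le.
Qed.

Lemma gauss_boxD a b M p p' : gauss_box a b M p -> gauss_box a b M p' ->
  gauss_box a b M (p + p').
Proof.
move=> h h' m hm.
have hg : (M%:E <= gv (fun m => (p + p')@_m) m)%E.
  rewrite /gauss_val shift_le [X in v X]mcoeffD.
  by apply: v_ge_add; [apply: gauss_box_ge h|apply: gauss_box_ge h'].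
have [e|/h [h1 h2 _] //] := eqVneq p@_m 0.
by move: hm; rewrite mcoeffD e add0r => /h' [].
Qed.

Lemma gauss_boxW a b M a' b' M' p : (a' <= a)%N -> (b <= b')%N -> M' <= M ->
  gauss_box a b M p -> gauss_box a' b' M' p.
Proof.
move=> ha hb hM h m /h [h1 h2 h3]; split.
- exact: leq_trans h1.
- exact: leq_trans hb.
- by apply: le_trans h3; rewrite lee_fin.
Qed.

Lemma gauss_boxZ a b M c p : vge v 0 c -> gauss_box a b M p -> gauss_box a b M (c *: p).
Proof.
move=> hc h m hm; have : p@_m != 0.
  by apply: contraNneq hm => e; rewrite mcoeffZ e mulr0.
move=> /h [h1 h2 _]; split=> //; rewrite /gauss_val shift_le [X in v X]mcoeffZ.
rewrite vM -[X in (X <= _)%E]add0e; apply: leeD => //; exact: gauss_box_ge h.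
Qed.

Lemma gauss_boxU i : gauss_box 1 1 (r i) 'X_i.
Proof.
move=> m hm; have -> : m = U_(i)%MM.
  by move: hm; rewrite mcoeffX; case: (U_(i)%MM =P m) => [<- //|_]; rewrite eqxx.
rewrite mdeg1; split=> //; rewrite /gauss_val mcoeffX eqxx v1 add0e.
rewrite (bigD1 i) //= mnm1E eqxx mulr1n big1 ?addr0 // => j /negPf ji.
by rewrite mnm1E eq_sym ji.
Qed.

Variables (h : n.-tuple {mpoly C[n]}) (L : nat).
Hypothesis hh : forall i, gauss_box 1 L (r i) (tnth h i).

Lemma gauss_box_monomial (m : 'X_{1..n}) :
  gauss_box (mdeg m) (L * mdeg m) (\sum_(i < n) r i *+ m i)
    (\prod_(i < n) tnth h i ^+ m i).
Proof.
rewrite mdegE big_distrr /=.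
elim: (index_enum _) => [|i s IH]; first by rewrite !big_nil; apply: gauss_box1.
rewrite !big_cons; apply: gauss_boxM => //; rewrite -[m i in X in gauss_box X _]mul1n.
exact: gauss_boxX.
Qed.

Lemma comp_coef0 (p : {mpoly C[n]}) m :
  (forall k, (mdeg k <= mdeg m)%N -> p@_k = 0) -> (p \mPo h)@_m = 0.
Proof.
move=> hp; rewrite comp_mpolyE raddf_sum big1 // => k _ /=; rewrite mcoeffZ.
have [le|lt] := leqP (mdeg k) (mdeg m); first by rewrite hp ?mul0r.
have [->|/gauss_box_monomial [le _ _]] := eqVneq ((\prod_(i < n) tnth h i ^+ k i)@_m) 0.
  by rewrite mulr0.
by move: lt; rewrite ltnNge le.
Qed.

Lemma comp_coef_ge (p : {mpoly C[n]}) (M : R) m :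
  (forall k, (mdeg m <= L * mdeg k)%N -> (M%:E <= gv (fun m => p@_m) k)%E) ->
  (M%:E <= gv (fun m => (p \mPo h)@_m) m)%E.
Proof.
move=> hp; rewrite /gauss_val shift_le comp_mpolyE [X in v X]raddf_sum.
apply: v_ge_sum => k _; rewrite [X in v X]mcoeffZ.
have [->|/gauss_box_monomial [_ le g]] := eqVneq ((\prod_(i < n) tnth h i ^+ k i)@_m) 0.
  by rewrite mulr0 v0 leey.
rewrite -shift_le vM; apply: le_trans (hp k le) _.
rewrite -addeA; apply: leeD2l; exact: g.
Qed.

(** Substituting polynomials without constant term in a power series: every
    coefficient of the result only involves finitely many of those of the
    series. *)
Lemma analytic_comp (f : affd -> C) (gm : affd -> affd) :
  (forall P i, tnth (val (gm P)) i = (tnth h i).@[tnth (val P)]) ->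
  analytic f -> analytic (fun P => f (gm P)).
Proof.
move=> hgm [c [rc hc]].
pose d m := (trunc c (mdeg m).+1 \mPo h)@_m.
have dE N m : (mdeg m < N)%N -> (trunc c N \mPo h)@_m = d m.
  move=> lt; apply/eqP; rewrite -subr_eq0 /d -mcoeffB -raddfB; apply/eqP.
  apply: comp_coef0 => k le; rewrite mcoeffB !trunc_coef ltnS le.
  by rewrite (leq_ltn_trans le lt) subrr.
have low M N m : (forall k, (N <= mdeg k)%N -> (M%:E <= gv c k)%E) ->
    (L * N < mdeg m)%N -> forall N', (M%:E <= gv (fun m => (trunc c N' \mPo h)@_m) m)%E.
  move=> hN lt N'; apply: comp_coef_ge => k le; rewrite /gauss_val trunc_coef.
  case: ifP => _; last by rewrite v0 addye // leey.
  by apply: hN; rewrite leqNgt; apply: contraL (leq_trans lt le) => kN;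
     rewrite -leqNgt leq_mul2l (ltnW kN) orbT.
exists d; split.
  move=> M; have [N hN] := rc M; exists (L * N).+1 => m lt.
  exact: (low M N m hN lt).
move=> P; apply: (v_cvg_near (hc (gm P))) => M.
have [N0 hN0] := rc M; exists (L * N0).+1 => N lt; rewrite subr0.
have -> : partial_sum c N (val (gm P)) = (trunc c N \mPo h).@[tnth (val P)].
  rewrite -truncE comp_mpoly_meval; apply: meval_eq => i; exact: hgm.
rewrite -truncE -raddfB /= mevalE; apply: v_ge_sum => m _.
have -> : \prod_i tnth (val P) i ^+ m i = monomial m (val P) by [].
rewrite vM; apply: le_trans (leeD2l _ (v_monomial m P)).
rewrite mcoeffB trunc_coef; case: ltnP => [mN|Nm].
  by rewrite dE // subrr v0 addye // leey.
by rewrite sub0r vN; apply: low hN0 _ _; apply: leq_trans lt Nm.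
Qed.

End Comp.
End Analytic.

Section QuotMorph.
Variables (S : comPzRingType) (T : pzRingType) (I : ideal S) (f : {rmorphism S -> T}).
Hypothesis fI : forall x, I x -> f x = 0.

(** The universal property of the quotient. *)
Lemma quot_lift : exists g : {rmorphism quot I -> T}, forall x, g (qpi I x) = f x.
Proof.
pose g (a : quot I) := f (repr a).
have gE x : g (qpi I x) = f x.
  by apply/eqP; rewrite -subr_eq0 -rmorphB; apply/eqP/fI/qpi_eq/qreprK.
have ga : zmod_morphism g.
  move=> a b; case: (qpiP a) (qpiP b) => x -> [y ->].
  by rewrite -rmorphB !gE rmorphB.
have gm : monoid_morphism g.
  split; first by rewrite -(rmorph1 (qpi I)) gE rmorph1.
  move=> a b; case: (qpiP a) (qpiP b) => x -> [y ->].
  by rewrite -rmorphM !gE rmorphM.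
pose G : {rmorphism quot I -> T} := HB.pack g
  (GRing.isZmodMorphism.Build _ _ g ga) (GRing.isMonoidMorphism.Build _ _ g gm).
by exists G.
Qed.

End QuotMorph.

Lemma gen_kills (S : comPzRingType) (T : pzRingType) (f : {rmorphism S -> T})
    (s : seq S) (a : S) :
  (forall b, b \in s -> f b = 0) -> ideal_gen s a -> f a = 0.
Proof.
move=> h [c ->]; rewrite rmorph_sum big1 // => i _.
by rewrite rmorphM (h _ (mem_nth 0 (ltn_ord i))) mulr0.
Qed.

Lemma gen_mem (S : comPzRingType) (s : seq S) (a : S) : a \in s -> ideal_gen s a.
Proof.
move=> h; have lt : (index a s < size s)%N by rewrite index_mem.
exists (fun i => if i == Ordinal lt then 1 else 0).
rewrite (bigD1 (Ordinal lt)) //= eqxx mul1r nth_index // big1 ?addr0 // => i /negPf ->.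
by rewrite mul0r.
Qed.

Lemma mpoly_lift (S : comNzRingType) (B : comPzRingType) (n : nat)
    (f : {rmorphism S -> B}) (h : 'I_n -> B) : (1 : B) != 0 ->
  exists g : {rmorphism {mpoly S[n]} -> B},
    (forall c, g c%:MP = f c) /\ (forall i, g 'X_i = h i).
Proof.
move=> n1.
(* Evaluation of polynomials takes values in nonzero rings. *)
pose B' : comNzRingType := HB.pack (GRing.ComPzRing.sort B) (GRing.PzSemiRing_isNonZero.Build B n1).
pose f' : {rmorphism S -> B'} := f.
pose g : {rmorphism {mpoly S[n]} -> B'} := mmap f' h.
exists g; split=> [c|i]; first exact: (mmapC (h : 'I_n -> B') f' c).
exact: (etrans (mmapX (h : 'I_n -> B') f' U_(i)) (mmap1U (h : 'I_n -> B') i)).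
Qed.

(** * Normal forms modulo the equations of the reduction *)

Notation tri a b c := (tnth [tuple a; b; c]).

Lemma tri_map (T T' : Type) (f : T -> T') a b c i :
  f (tri a b c i) = tri (f a) (f b) (f c) i.
Proof.
rewrite (tnth_nth a) (tnth_nth (f a)).
by case: i => [[|[|[|//]]] lt].
Qed.

Definition mnm3 (i j l : nat) : 'X_{1..3} := [multinom tri i j l k | k < 3].

Lemma mnm3E (m : 'X_{1..3}) : m = mnm3 (m 0) (m 1) (m 2).
Proof.
apply/mnmP => k; rewrite mnmE.
by case: k => [[|[|[|//]]] lt]; congr (m _); apply: val_inj.
Qed.

Lemma mmap1_tri (B : comNzRingType) (x y z : B) (m : 'X_{1..3}) :
  mmap1 (tri x y z) m = x ^+ m 0 * y ^+ m 1 * z ^+ m 2.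
Proof.
rewrite /mmap1 !big_ord_recl big_ord0 mulr1 mulrA.
by congr (x ^+ m _ * y ^+ m _ * z ^+ m _); apply: val_inj.
Qed.

Section IdealCongruence.
Variables (B : comNzRingType) (I : ideal B).

Lemma icongM (x x' y y' : B) : I (x - x') -> I (y - y') -> I (x * y - x' * y').
Proof.
move=> h h'; have -> : x * y - x' * y' = x * (y - y') + y' * (x - x') by ring.
by apply: idealD; apply: idealMl.
Qed.

Lemma icongX (x x' : B) n : I (x - x') -> I (x ^+ n - x' ^+ n).
Proof.
move=> h; elim: n => [|n IH]; first by rewrite !expr0 subrr; apply: ideal0.
by rewrite !exprS; apply: icongM.
Qed.

Lemma icong_alt n (x x' y y' : B) :
  I (x - x') -> I (y - y') -> I (alt n x y - alt n x' y').
Proof.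
move=> h h'; rewrite (_ : _ - _ = (x ^+ n * y - x' ^+ n * y')
  + - 1 * (x * y ^+ n - x' * y' ^+ n)); last by rewrite /alt; ring.
by apply: idealD; last apply: idealMl; apply: icongM => //; apply: icongX.
Qed.

End IdealCongruence.

Section NormalForm.
Variable q : nat.

(** Exponents of the monomials that are irreducible for the rewriting rules
    x^q y -> x y^q + 1 and z^q -> (polynomial in x and y). *)
Definition normal_mnm (m : 'X_{1..3}) : bool :=
  (m 2%R < q)%N && ((m 0%R < q)%N || (m 1%R == 0)%N).

Definition normal (S : nzRingType) (P : {mpoly S[3]}) : Prop :=
  {in msupp P, forall m, normal_mnm m}.

Lemma normalD (S : nzRingType) (P Q : {mpoly S[3]}) :
  normal P -> normal Q -> normal (P + Q).
Proof.
move=> hP hQ m /msuppD_le; rewrite mem_cat => /orP []; [exact: hP|exact: hQ].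
Qed.

Lemma normalZ (S : nzRingType) c (P : {mpoly S[3]}) : normal P -> normal (c *: P).
Proof. by move=> hP m /msuppZ_le; apply: hP. Qed.

Hypothesis q1 : (1 < q)%N.
Variables (S B : comNzRingType) (phi : {rmorphism S -> B}) (I : ideal B).
Variables (x y z : B).
Let ev := mmap phi (tri x y z).
Hypothesis relD : I (alt q x y - 1).
Hypothesis relZ : I (z ^+ q - (alt (q ^ 3) x y - x ^+ (q ^ 3 - q))).

(** Normal forms are taken modulo an arbitrary ideal containing the two relations,
    to serve both for the relations themselves and for the functions on the
    affinoid that are small. *)
Definition has_nf (b : B) : Prop := exists2 P, normal P & I (b - ev P).

Lemma nf_congr b b' : I (b - b') -> has_nf b' -> has_nf b.
Proof.
move=> h [P nP hP]; exists P => //.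
by rewrite -[b](subrK b') -addrA; apply: idealD.
Qed.

Lemma nfD b b' : has_nf b -> has_nf b' -> has_nf (b + b').
Proof.
move=> [P nP hP] [Q nQ hQ]; exists (P + Q); first exact: normalD.
by rewrite /ev rmorphD opprD addrACA; apply: idealD.
Qed.

Lemma nfZ c b : has_nf b -> has_nf (phi c * b).
Proof.
move=> [P nP hP]; exists (c *: P); first exact: normalZ.
by rewrite /ev mmapZ -mulrBr; apply: idealMl.
Qed.

Lemma nf0 : has_nf 0.
Proof.
exists 0; first by move=> m; rewrite msupp0.
by rewrite /ev rmorph0 subr0; apply: ideal0.
Qed.

Lemma nfB b b' : has_nf b -> has_nf b' -> has_nf (b - b').
Proof.
by move=> hb /(nfZ (-1)); rewrite rmorphN1 mulN1r; apply: nfD.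
Qed.

(** The rewriting terminates: the rule for z lowers the exponent of z and the other
    rule lowers that of x. *)
Lemma nf_mon i j l : has_nf (x ^+ i * y ^+ j * z ^+ l).
Proof.
elim/ltn_ind: l i j => l IHl i j; have [lq|ql] := ltnP l q; last first.
  rewrite -(subnK ql) exprD mulrA.
  apply: (@nf_congr _ (x ^+ i * y ^+ j * z ^+ (l - q) *
                       (alt (q ^ 3) x y - x ^+ (q ^ 3 - q)))).
    by rewrite -mulrBr; apply: idealMl.
  have lt : (l - q < l)%N by lia.
  set M := z ^+ (l - q).
  rewrite (_ : _ * _ = x ^+ (i + q ^ 3) * y ^+ (j + 1) * M
    - x ^+ (i + 1) * y ^+ (j + q ^ 3) * M - x ^+ (i + (q ^ 3 - q)) * y ^+ j * M).
    by apply: nfB; first apply: nfB; apply: IHl.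
  by rewrite /alt !exprD !expr1; ring.
elim/ltn_ind: i j => i IHi j.
have [nm|] := boolP ((i < q)%N || (j == 0)%N).
  exists 'X_[mnm3 i j l].
    by move=> m; rewrite msuppX inE => /eqP ->; rewrite /normal_mnm !mnmE lq.
  by rewrite /ev mmapX mmap1_tri !mnmE subrr; apply: ideal0.
rewrite negb_or -leqNgt -lt0n => /andP [qi j0].
rewrite -(subnK qi) -(subnK j0) !exprD.
set M := x ^+ (i - q) * y ^+ (j - 1).
apply: (@nf_congr _ (M * z ^+ l + x ^+ (i - q + 1) * y ^+ (j - 1 + q) * z ^+ l)).
  rewrite (_ : _ - _ = M * z ^+ l * (alt q x y - 1)); first exact: idealMl.
  by rewrite /M /alt !exprD !expr1; ring.
by apply: nfD; apply: IHi; lia.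
Qed.

Lemma nf_ev P : has_nf (ev P).
Proof.
rewrite /ev /mmap; elim/big_rec: _ => [|m b _ IH]; first exact: nf0.
by apply: nfD => //; apply: nfZ; rewrite mmap1_tri; apply: nf_mon.
Qed.

Lemma nfM b b' : has_nf b -> has_nf b' -> has_nf (b * b').
Proof.
move=> [P nP hP] [Q nQ hQ]; apply: (@nf_congr _ (ev (P * Q))); last exact: nf_ev.
rewrite /ev rmorphM -[b * b'](subrK (b * ev Q)) -addrA -mulrBr -mulrBl.
by apply: idealD; [apply: idealMl|rewrite mulrC; apply: idealMl].
Qed.

Lemma nf_cst c : has_nf (phi c).
Proof. by rewrite /ev -(mmapC (tri x y z)); apply: nf_ev. Qed.

Lemma nf1 : has_nf 1.
Proof. by rewrite -(rmorph1 phi); apply: nf_cst. Qed.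

Lemma nfX b n : has_nf b -> has_nf (b ^+ n).
Proof.
move=> h; elim: n => [|n IH]; first by rewrite expr0; apply: nf1.
by rewrite exprS; apply: nfM.
Qed.

Lemma nf_x : has_nf x.
Proof. by have := nf_mon 1 0 0; rewrite !expr0 expr1 !mulr1. Qed.
Lemma nf_y : has_nf y.
Proof. by have := nf_mon 0 1 0; rewrite !expr0 expr1 mulr1 mul1r. Qed.
Lemma nf_z : has_nf z.
Proof. by have := nf_mon 0 0 1; rewrite !expr0 expr1 !mul1r. Qed.

Lemma nf_alt n b b' : has_nf b -> has_nf b' -> has_nf (alt n b b').
Proof. by move=> h h'; apply: nfB; apply: nfM => //; apply: nfX. Qed.

Lemma nf_mpoly n (h : 'I_n -> B) (P : {mpoly S[n]}) :
  (forall i, has_nf (h i)) -> has_nf (mmap phi h P).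
Proof.
move=> hh; rewrite /mmap; elim/big_rec: _ => [|m b _ IH]; first exact: nf0.
apply: nfD => //; apply: nfZ; rewrite /mmap1.
by elim/big_rec: _ => [|i c _ IHc]; [apply: nf1|apply: nfM => //; apply: nfX].
Qed.

End NormalForm.

(** * Valuations on the affinoid *)

Lemma sqn_sub1 n : (n ^ 2 - 1 = (n - 1) * (n + 1))%N.
Proof. by rewrite -[1%N in LHS](exp1n 2) subn_sqr. Qed.

(* Identities and inequalities between polynomials in q > 1: writing q - 1 as
   a variable removes the truncated subtractions. *)
Ltac qnia h := have := h; rewrite ?sqn_sub1;
  let m := fresh "m" in
  match type of h with is_true (1 < ?q)%N => case: (q) => [|[|m]] // _ end;
  rewrite !(subn1, expnS, expn0) /=; nia.

Section Geometry.
Variables (R : realType) (F : fieldType) (C : closedFieldType).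
Variables (vF : valuation R F) (v : valuation R C) (iota : vembedding vF v).
Variables (p q : nat) (pi : vring vF).
Hypothesis hF : local_field p q pi.
Variables (pi2 alpha gamma1 : C).
Hypothesis hpi2 : LT2_generator iota q pi pi2.
Hypothesis halpha : alpha ^+ (q * (q + 1)) = pi2.
Hypothesis hgamma1 : gamma1 ^+ q = alpha ^+ ((q - 1) * (q ^ 2 - 1)).

Local Notation w := (iota (val pi)).
Local Notation q1 := (q_gt1 hF).

Lemma q0 : (0 < q)%N. Proof. exact: ltnW q1. Qed.

Lemma pcharC : p \in [pchar C].
Proof. by rewrite (fmorph_pchar iota) (pcharF hF). Qed.

Lemma frobC (x y : C) : (x + y) ^+ q = x ^+ q + y ^+ q.
Proof. exact: (pcharF_frob hF) pcharC. Qed.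

(** The valuation of alpha: the valuations of pi and pi_2 are integral multiples
    of it. *)
Definition unitv : R := (q ^ 2 * (q ^ 2 - 1))%N%:R^-1.
Local Notation A := unitv.

Lemma A_gt0 : 0 < A.
Proof. by rewrite invr_gt0 ltr0n; have := q1; nia. Qed.

Lemma A_pi : A *+ (q ^ 2 * (q ^ 2 - 1)) = 1.
Proof. by rewrite -mulr_natr mulVf // pnatr_eq0 -lt0n; have := q1; nia. Qed.

Lemma A_le m n : (m <= n)%N -> A *+ m <= A *+ n.
Proof. by move=> h; rewrite ler_wpMn2l // ltW // A_gt0. Qed.

Lemma A_le1 n : (0 < n)%N -> A <= A *+ n.
Proof. by move=> h; rewrite -[X in X <= _]mulr1n; apply: A_le. Qed.

Lemma radiusE : Y22_radius R q = A *+ (q ^ 3 * (q - 1)).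
Proof.
rewrite /Y22_radius -[RHS]mulr_natr /A; have q2 := q1.
apply: (@mulfI _ (q ^ 2 * (q ^ 2 - 1))%N%:R); first by rewrite pnatr_eq0 -lt0n; nia.
rewrite [RHS]mulrA divff ?mul1r; last by rewrite pnatr_eq0 -lt0n; nia.
apply: (@mulIf _ q.+1%:R); first by rewrite pnatr_eq0.
rewrite mulrA mulfVK ?pnatr_eq0 // -!natrM; congr (_%:R).
qnia q2.
Qed.

Lemma v_w : v w = 1%:E. Proof. by rewrite vembP (v_pi hF). Qed.

Local Notation t := (pi_LT iota q pi pi2).

Lemma t_exp : t ^+ q.-1 = w.
Proof.
have [h t0] := hpi2; apply: (@mulIf _ t); first exact/eqP.
rewrite -exprSr prednK ?q0 //; apply/eqP.
by rewrite -subr_eq0 -oppr_eq0 opprB; apply/eqP.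
Qed.

Lemma v_t : v t = (A *+ (q ^ 2 * (q + 1)))%:E.
Proof.
apply: (@v_exp_inv _ _ _ _ q.-1); first by have := q1; case: (q) => [|[]].
rewrite t_exp v_w -A_pi -mulrnA; congr (_ *+ _)%:E.
have q2 := q1; qnia q2.
Qed.

Let aux2 (s Q T : R) : 2 <= Q -> (Q - 1) * T = 1 -> T < s * Q -> 1 + s <= T ->
  False.
Proof.
move=> q2 e h h'; have : (1 + s) * Q <= T * Q by rewrite ler_wpM2r //; lra.
by rewrite mulrDl mul1r; lra.
Qed.

(** The valuation 1/(q-1) of t = pi pi_2 - pi_2^q is too small to come from the term
    pi pi_2, hence v(t) = q v(pi_2). *)
Lemma v_pi2 : v pi2 = (A *+ (q * (q + 1)))%:E.
Proof.
have [s hs] : exists s : R, v pi2 = s%:E.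
  apply: v_fin; apply/eqP => e; case: hpi2 => _; apply.
  by rewrite /pi_LT e mulr0 frob0 ?subrr //; apply: frobC.
have ht := v_t; have vq := v_exp q hs; have vw := v_mul v_w hs.
have A0 := A_gt0; have q2 : 2 <= q%:R :> R by rewrite ler_nat q1.
pose Q : R := q%:R.
have Ap : A * (Q ^+ 2 * (Q ^+ 2 - 1)) = 1.
  by rewrite -[RHS]A_pi -[RHS]mulr_natr natrM natrB ?expn_gt0 ?q0 // natrX.
have at_ : A *+ (q ^ 2 * (q + 1)) = A * (Q ^+ 2 * (Q + 1)).
  by rewrite -[LHS]mulr_natr natrM natrD natrX.
have a2 : A *+ (q * (q + 1)) = A * (Q * (Q + 1)).
  by rewrite -[LHS]mulr_natr natrM natrD.
have sq : s *+ q = s * Q by rewrite -[LHS]mulr_natr.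
rewrite at_ in ht; rewrite sq in vq; rewrite a2 hs; congr (_%:E).
rewrite -/Q in q2.
have eA : (Q - 1) * (A * (Q ^+ 2 * (Q + 1))) = 1 by rewrite -[RHS]Ap; ring.
case: (ltgtP (s * Q) (A * (Q ^+ 2 * (Q + 1)))) => h.
- have : v t = (s * Q)%:E.
    rewrite /pi_LT addrC; apply: (@v_dom _ _ _ _ _ _ (1 + s)).
    + by rewrite vN.
    + nra.
    + by rewrite vw.
  by rewrite ht => -[e]; rewrite e ltxx in h.
- have : vge v (Num.min (s * Q) (1 + s)) t.
    rewrite /pi_LT; apply: v_ge_sub; rewrite ?vq ?vw lee_fin ge_min lexx ?orbT //.
  rewrite ht lee_fin ge_min => /orP [h'|h'].
    by move: (lt_le_trans h h'); rewrite ltxx.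
  by exfalso; apply: (aux2 q2 eA h h').
- apply: (@mulIf _ Q); first by rewrite gt_eqF // (lt_le_trans _ q2).
  by rewrite h; ring.
Qed.

Lemma v_alpha : v alpha = A%:E.
Proof.
apply: (@v_exp_inv _ _ _ _ (q * (q + 1))); first by have := q1; nia.
by rewrite halpha v_pi2.
Qed.

Lemma alpha0 : alpha != 0. Proof. exact: v_neq0 v_alpha. Qed.

Lemma v_alphaX n : v (alpha ^+ n) = (A *+ n)%:E.
Proof. exact: v_exp v_alpha. Qed.

Lemma v_gamma1 : vge v A gamma1 /\ gamma1 != 0.
Proof.
have q2 := q1; have e : v (gamma1 ^+ q) = (A *+ ((q - 1) * (q ^ 2 - 1)))%:E.
  by rewrite hgamma1 v_alphaX.
split; last by apply: contraTneq (v_neq0 e) => ->; rewrite frob0 ?eqxx //; apply: frobC.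
apply: (vge_exp_inv q0); rewrite e lee_fin; apply: A_le.
by qnia q2.
Qed.

(** The unit parts of pi and of D_q(X_1, Y_1) = -[pi]_LT(pi_2), which powers of
    alpha complement. *)
Definition pi_unit : C := w / alpha ^+ (q ^ 2 * (q ^ 2 - 1)).
Definition det_unit : C := - t / alpha ^+ (q ^ 2 * (q + 1)).

Lemma pi_unitE : w = pi_unit * alpha ^+ (q ^ 2 * (q ^ 2 - 1)).
Proof. by rewrite divfK // expf_neq0 // alpha0. Qed.
Lemma det_unitE : - t = det_unit * alpha ^+ (q ^ 2 * (q + 1)).
Proof. by rewrite divfK // expf_neq0 // alpha0. Qed.

Lemma v_pi_unit : v pi_unit = 0%:E.
Proof. by rewrite (v_div v_w (v_alphaX _)) A_pi subrr. Qed.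

Lemma det_unit_near1 : vge v A (det_unit - 1).
Proof.
have -> : det_unit - 1 = - w / pi2 ^+ q.-1.
  have p0 : pi2 != 0 by apply: v_neq0 v_pi2.
  have ep : pi2 ^+ q = pi2 * pi2 ^+ q.-1 by rewrite -exprS prednK ?q0.
  rewrite /det_unit (_ : (q ^ 2 * (q + 1))%N = (q * (q + 1) * q)%N); last by lia.
  rewrite exprM halpha ep /pi_LT ep; field.
  by rewrite p0 expf_neq0.
rewrite mulNr vN (v_div v_w (v_exp _ v_pi2)) lee_fin -mulrnA -A_pi -mulrnBr; last first.
  by have q2 := q1; qnia q2.
apply: A_le1; have q2 := q1; qnia q2.
Qed.

Lemma v_det_unit : v det_unit = 0%:E.
Proof. exact: v_unit_near A_gt0 det_unit_near1. Qed.

(** ** Bounds and relations on the affinoid *)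

Local Notation lt := (Defs.pi_mul iota q pi).

(** The points of the affinoid; v(u) > 0 follows from the bound on v(u), which is
    written in terms of the valuation A of alpha. *)
Definition onY (u X Y : C) : Prop :=
  [/\ vge v (A *+ (q ^ 3 * (q - 1))) u, lt u (lt u X) = 0, lt u (lt u Y) = 0
    & mu2 iota q pi u X Y = pi2].

Let aux_u (a Q s : R) : 2 <= Q -> s < a * Q ^+ 2 ->
  s * Q ^+ 2 < a * (Q ^+ 3 * (Q - 1)) + s * Q.
Proof.
move=> q2 h; rewrite -subr_gt0.
have -> : a * (Q ^+ 3 * (Q - 1)) + s * Q - s * Q ^+ 2
  = (Q * (Q - 1)) * (a * Q ^+ 2 - s) by ring.
by rewrite !mulr_gt0 ?subr_gt0 //; lra.
Qed.

Let aux_w (a Q s : R) : 2 <= Q -> s < a * Q ^+ 2 -> a * (Q ^+ 2 * (Q ^+ 2 - 1)) = 1 ->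
  s * Q ^+ 2 < 1 + s.
Proof.
move=> q2 h e; rewrite -[1]e -subr_gt0.
have -> : a * (Q ^+ 2 * (Q ^+ 2 - 1)) + s - s * Q ^+ 2
  = (Q - 1) * (Q + 1) * (a * Q ^+ 2 - s) by ring.
by rewrite !mulr_gt0 ?subr_gt0 //; lra.
Qed.

(** Newton polygon: where v(u) is this large, the leading term of [pi]_u
    dominates at every X of valuation below that of the nonzero
    torsion points of level one. *)
Lemma root_bound u X s0 : vge v (A *+ (q ^ 3 * (q - 1))) u ->
  s0 <= A *+ (q ^ 2) -> vge v (s0 *+ (q ^ 2)) (lt u X) -> vge v s0 X.
Proof.
move=> hu hs0 h; have [->|] := eqVneq X 0; first by rewrite v0 leey.
move=> /(v_fin v) [s hs]; rewrite hs lee_fin leNgt; apply/negP => lts.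
have q2 : 2 <= q%:R :> R by rewrite ler_nat q1.
have s2 : s < A * q%:R ^+ 2.
  by apply: lt_le_trans lts _; rewrite -natrX mulr_natr.
have Ap : A * (q%:R ^+ 2 * (q%:R ^+ 2 - 1)) = 1.
  by rewrite -[RHS]A_pi -[RHS]mulr_natr natrM natrB ?expn_gt0 ?q0 // natrX.
have E : v (X ^+ (q ^ 2)) = (s * q%:R ^+ 2)%:E.
  by rewrite (v_exp _ hs) -natrX mulr_natr.
have : v (lt u X) = (s * q%:R ^+ 2)%:E.
  rewrite /Defs.pi_mul -addrA.
  apply: (@v_dom _ _ _ _ _ _ (Num.min (A * (q%:R ^+ 3 * (q%:R - 1)) + s * q%:R) (1 + s))) => //.
    by rewrite lt_min aux_u // (aux_w q2 s2).
  apply: v_ge_add; last by rewrite (v_mul v_w hs) lee_fin ge_min lexx orbT.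
  apply: (@le_trans _ _ (A * (q%:R ^+ 3 * (q%:R - 1)) + s * q%:R)%:E).
    by rewrite lee_fin ge_min lexx.
  apply: vge_mul; last by rewrite (v_exp _ hs) -[s *+ q]mulr_natr.
  by move: hu; rewrite -[A *+ _]mulr_natr natrM natrX natrB ?q0.
move=> e; move: h; rewrite e lee_fin -natrX mulr_natr lerMn2r.
by rewrite expn_eq0 eqn0Ngt q0 /= leNgt lts.
Qed.

Lemma onY_X1 u X : vge v (A *+ (q ^ 3 * (q - 1))) u -> lt u (lt u X) = 0 ->
  vge v (A *+ (q ^ 2)) (lt u X).
Proof. by move=> hu h; apply: root_bound hu (lexx _) _; rewrite h v0 leey. Qed.

Lemma onY_X u X : vge v (A *+ (q ^ 3 * (q - 1))) u -> lt u (lt u X) = 0 -> vge v A X.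
Proof.
move=> hu h; apply: root_bound hu _ (onY_X1 hu h).
by apply: A_le1; rewrite expn_gt0 q0.
Qed.

Lemma ltE u X : X ^+ (q ^ 2) + u * X ^+ q + w * X = lt u X. Proof. by []. Qed.

Lemma onY_alt u X Y : onY u X Y -> alt q (lt u X) (lt u Y) = - t.
Proof.
case=> hu hX hY hm.
have := mu_form_frob frobC (ltE u X) (ltE u Y) hX hY.
rewrite (_ : mu_form _ _ _ _ _ = pi2) // /pi_LT => ->.
by rewrite opprB addrK.
Qed.

(** The coefficients that appear when [pi]_u and mu_2 = pi_2 are written in the
    coordinates x, y, Z and u / alpha^(q^3 (q-1)), one factor alpha being
    taken out of each: the remaining exponents are nonnegative, so that the
    coefficients are integral. *)
Definition level1_cu : C := alpha ^+ (q ^ 3 * (q - 1) + q - q ^ 2 - 1).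
Definition level1_cx : C := pi_unit * alpha ^+ (q ^ 2 * (q ^ 2 - 1) + 1 - q ^ 2 - 1).
Definition Zrel_c1 : C := pi_unit * alpha ^+ (q * (q - 1) * (q ^ 2 - 1) - 1).
Definition Zrel_c2 : C := alpha ^+ (q ^ 2 * (q - 1) * (q ^ 2 - 1) - 1).
Definition Zrel_c3 : C := pi_unit ^+ q * alpha ^+ (q * (q ^ 2 - 1) * (q ^ 2 - 1) - 1).

Section Coord.
Variables (u X Y : C).
Hypothesis hY : onY u X Y.
Let x := X / alpha.
Let y := Y / alpha.
Let om := u / alpha ^+ (q ^ 3 * (q - 1)).
Let Z := (alt q x y - 1) / gamma1.
Let x1 := x ^+ (q ^ 2) + alpha * (level1_cu * om * x ^+ q + level1_cx * x).
Let y1 := y ^+ (q ^ 2) + alpha * (level1_cu * om * y ^+ q + level1_cx * y).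

Let XE : X = alpha * x. Proof. by rewrite mulrC divfK // alpha0. Qed.
Let YE : Y = alpha * y. Proof. by rewrite mulrC divfK // alpha0. Qed.
Let uE : u = om * alpha ^+ (q ^ 3 * (q - 1)).
Proof. by rewrite divfK // expf_neq0 // alpha0. Qed.

Lemma level1E s : lt u (alpha * s) = alpha ^+ (q ^ 2) *
  (s ^+ (q ^ 2) + alpha * (level1_cu * om * s ^+ q + level1_cx * s)).
Proof.
have q2 := q1.
rewrite /Defs.pi_mul pi_unitE {1}uE !exprMn /level1_cu /level1_cx.
have E1 : alpha ^+ (q ^ 3 * (q - 1)) * alpha ^+ q = alpha ^+ (q ^ 2) * alpha *
    alpha ^+ (q ^ 3 * (q - 1) + q - q ^ 2 - 1).
  by rewrite -exprSr -!exprD; congr (_ ^+ _); qnia q2.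
have E2 : alpha ^+ (q ^ 2 * (q ^ 2 - 1)) * alpha = alpha ^+ (q ^ 2) * alpha *
    alpha ^+ (q ^ 2 * (q ^ 2 - 1) + 1 - q ^ 2 - 1).
  by rewrite -!exprSr -!exprD; congr (_ ^+ _); qnia q2.
have -> : om * alpha ^+ (q ^ 3 * (q - 1)) * (alpha ^+ q * s ^+ q) =
  om * s ^+ q * (alpha ^+ (q ^ 3 * (q - 1)) * alpha ^+ q) by ring.
have -> : pi_unit * alpha ^+ (q ^ 2 * (q ^ 2 - 1)) * (alpha * s) =
  pi_unit * s * (alpha ^+ (q ^ 2 * (q ^ 2 - 1)) * alpha) by ring.
rewrite E1 E2; ring.
Qed.

Lemma x1E : lt u X = alpha ^+ (q ^ 2) * x1.
Proof. by rewrite {1}XE level1E. Qed.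
Lemma y1E : lt u Y = alpha ^+ (q ^ 2) * y1.
Proof. by rewrite {1}YE level1E. Qed.

(** The coordinate om is redundant: it is the value of D_(q^2) at the normalized
    level one points, up to a unit. *)
Lemma om_rel : om * det_unit = - alt (q ^ 2) x1 y1.
Proof.
have q2 := q1; have [hu hX hY' hm] := hY.
have := alt_u (w := w) hX hY'; rewrite (onY_alt hY) x1E y1E det_unitE.
rewrite /alt !exprMn -!exprM.
have E1 : alpha ^+ (q ^ 3 * (q - 1)) * alpha ^+ (q ^ 2 * (q + 1)) =
   alpha ^+ (q ^ 2 * q ^ 2) * alpha ^+ (q ^ 2).
  by rewrite -!exprD; congr (_ ^+ _); qnia q2.
have n0 : alpha ^+ (q ^ 2 * q ^ 2) * alpha ^+ (q ^ 2) != 0.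
  by rewrite mulf_neq0 // expf_neq0 // alpha0.
move=> h; apply: (mulIf n0); rewrite -{1}E1.
transitivity (u * (det_unit * alpha ^+ (q ^ 2 * (q + 1)))); last by rewrite h; ring.
by rewrite uE; ring.
Qed.

(** The q-th power of Z = (D_q(x, y) - 1) / gamma1 is read off mu_2 = pi_2:
    the normalizations alpha^(q (q+1)) = pi_2 and
    gamma1^q = alpha^((q-1) (q^2-1)) make the leading terms match. *)
Lemma Z_rel : Z ^+ q = alt (q ^ 3) x y +
  alpha * (Zrel_c1 * alt q x y + Zrel_c2 * om ^+ q * alt (q ^ 2) x y + Zrel_c3 * alt q x y).
Proof.
have q2 := q1; have [_ _ _ hm] := hY.
have := mu_formE frobC (ltE u X) (ltE u Y).
rewrite (_ : mu_form _ _ _ _ _ = pi2) // => h0.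
have a0 n : alpha ^+ n != 0 by rewrite expf_neq0 // alpha0.
have g0 : gamma1 ^+ q != 0 by rewrite hgamma1.
rewrite exprMn exprVn frobB ?expr1n; last exact: frobC.
apply: (mulIf g0); rewrite divfK // hgamma1.
set a := alpha ^+ (q * (q + 1)).
set b := alpha ^+ ((q - 1) * (q ^ 2 - 1)).
have S1 n : alt n X Y = alpha ^+ n.+1 * alt n x y.
  by rewrite /alt {1 2}XE {1 2}YE !exprMn exprS; ring.
have E3 : alpha ^+ (q ^ 3).+1 = a * b by rewrite -exprD; congr (_ ^+ _); qnia q2.
have Ee1 : w * alpha ^+ q.+1 = a * b * (alpha * Zrel_c1).
  rewrite pi_unitE /Zrel_c1 /a /b -[LHS]mulrA.
  have -> : alpha ^+ (q ^ 2 * (q ^ 2 - 1)) * alpha ^+ q.+1 = alpha ^+ (q * (q + 1)) *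
    alpha ^+ ((q - 1) * (q ^ 2 - 1)) * alpha * alpha ^+ (q * (q - 1) * (q ^ 2 - 1) - 1).
    by rewrite -!exprD -exprSr -exprD; congr (_ ^+ _); qnia q2.
  ring.
have Ee2 : u ^+ q * alpha ^+ (q ^ 2).+1 = a * b * (alpha * (Zrel_c2 * om ^+ q)).
  rewrite uE exprMn -exprM /Zrel_c2 /a /b -[LHS]mulrA.
  have -> : alpha ^+ (q ^ 3 * (q - 1) * q) * alpha ^+ (q ^ 2).+1 = alpha ^+ (q * (q + 1)) *
    alpha ^+ ((q - 1) * (q ^ 2 - 1)) * alpha *
    alpha ^+ (q ^ 2 * (q - 1) * (q ^ 2 - 1) - 1).
    by rewrite -!exprD -exprSr -exprD; congr (_ ^+ _); qnia q2.
  ring.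
have Ee3 : w ^+ q * alpha ^+ q.+1 = a * b * (alpha * Zrel_c3).
  rewrite pi_unitE exprMn -exprM /Zrel_c3 /a /b -[LHS]mulrA.
  have -> : alpha ^+ (q ^ 2 * (q ^ 2 - 1) * q) * alpha ^+ q.+1 = alpha ^+ (q * (q + 1)) *
    alpha ^+ ((q - 1) * (q ^ 2 - 1)) * alpha *
    alpha ^+ (q * (q ^ 2 - 1) * (q ^ 2 - 1) - 1).
    by rewrite -!exprD -exprSr -exprD; congr (_ ^+ _); qnia q2.
  ring.
have S1q : alt q X Y ^+ q = a * alt q x y ^+ q.
  by rewrite S1 exprMn -exprM /a; congr (alpha ^+ _ * _); lia.
apply: (mulfI (a0 (q * (q + 1)))); rewrite -/a mulrBr mulr1 {2}/a halpha h0 S1q.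
rewrite !S1 E3 !mulrA Ee1 Ee2 Ee3; ring.
Qed.

Lemma D_rel : alt q x y - 1 = gamma1 * Z.
Proof. by rewrite [RHS]mulrC /Z divfK //; case: v_gamma1. Qed.

Lemma x_int : vge v 0 x /\ vge v 0 y.
Proof.
have [hu hX hY' _] := hY.
by split; apply: (vge_div v_alpha); rewrite add0r; apply: onY_X hu _.
Qed.

Lemma om_int : vge v 0 om.
Proof. by have [hu _ _ _] := hY; apply: (vge_div (v_alphaX _)); rewrite add0r. Qed.

End Coord.

Lemma coef_int : [/\ vge v 0 level1_cu, vge v 0 level1_cx, vge v 0 Zrel_c1, vge v 0 Zrel_c2 & vge v 0 Zrel_c3].
Proof.
have h n : vge v 0 (alpha ^+ n) by rewrite v_alphaX lee_fin mulrn_wge0 // ltW // A_gt0.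
have hr : vge v 0 pi_unit by rewrite v_pi_unit.
split; [exact: h|exact: vge0_mul|exact: vge0_mul|exact: h|].
by apply: vge0_mul => //; apply: vge0_exp.
Qed.

Lemma alt_int n x y : vge v 0 x -> vge v 0 y -> vge v 0 (alt n x y).
Proof. by move=> hx hy; apply: v_ge_sub; apply: vge0_mul => //; apply: vge0_exp. Qed.

Lemma Z_int u X Y : onY u X Y ->
  vge v 0 ((alt q (X / alpha) (Y / alpha) - 1) / gamma1).
Proof.
move=> hY; have [hx hy] := x_int hY; have ho := om_int hY.
have [h1 h2 h3 h4 h5] := coef_int.
apply: (vge_exp_inv q0); rewrite (Z_rel hY) mul0rn.
have ha n := alt_int n hx hy.
apply: v_ge_add => //; apply: vge0_mul; first by rewrite v_alpha lee_fin ltW // A_gt0.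
by apply: v_ge_add; first apply: v_ge_add; apply: vge0_mul => //; apply: vge0_mul => //; apply: vge0_exp.
Qed.

Lemma lt_lin u l m X Y : l ^+ q = l -> m ^+ q = m ->
  lt u (l * X + m * Y) = l * lt u X + m * lt u Y.
Proof.
move=> hl hm; rewrite /Defs.pi_mul (frobD2 frobC) frobC !exprMn !expq2 hl hl hm hm.
ring.
Qed.

(** ** Points of the affinoid with prescribed reduction *)

Lemma alt_scale n c x y : alt n (c * x) (c * y) = c ^+ n.+1 * alt n x y :> C.
Proof. by rewrite /alt !exprMn exprS; ring. Qed.

(** How well a lifted point approximates its model: a (q+1)-st root and a
    q^2-th root are taken of an error of valuation A. *)
Definition epsv : R := A / q.+1%:R / (q ^ 2)%:R.

Lemma epsv_gt0 : 0 < epsv.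
Proof. by rewrite !divr_gt0 ?A_gt0 ?ltr0n // expn_gt0 q0. Qed.

Lemma lt_root u X1 : exists X, lt u X = X1.
Proof.
pose P : {poly C} := 'X^(q ^ 2) + (u *: 'X^q + w *: 'X - X1%:P).
have sP : size P = (q ^ 2).+1.
  rewrite size_polyDl size_polyXn // ltnS.
  have q2 := q1; have l1 : (q.+1 <= q ^ 2)%N by qnia q2.
  apply: leq_trans l1; apply: leq_trans (size_polyD _ _) _.
  rewrite geq_max size_polyN (leq_trans (size_polyC_leq1 _)) // andbT.
  apply: leq_trans (size_polyD _ _) _; rewrite geq_max.
  rewrite (leq_trans (size_scale_leq _ _)) ?size_polyXn //.
  by apply: leq_trans (size_scale_leq _ _) _; rewrite size_polyX ltnS q0.
have /closed_rootP [X /rootP hX] : size P != 1%N.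
  by rewrite sP eqSS -lt0n expn_gt0 q0.
exists X; apply/eqP; rewrite -subr_eq0 -hX /P.
by rewrite !(hornerD, hornerN, hornerZ, hornerXn, hornerX, hornerC) !addrA.
Qed.

(** Given (a, b) with a^q b - a b^q = 1, the level one points are taken
    proportional to a^(q^3) and b^(q^3); their determinant fixes u, and
    mu_2 is corrected by a translation by a point of level one. *)
Lemma point_lift a b : vge v 0 a -> vge v 0 b -> alt q a b = 1 ->
  exists u X Y, [/\ onY u X Y, vge v epsv (X / alpha - a ^+ q)
    & vge v epsv (Y / alpha - b ^+ q)].
Proof.
move=> ha hb hab.
have [kappa hk kn] : exists2 k, k ^+ q.+1 = det_unit & vge v (A / q.+1%:R) (1 - k).
  have hz : vge v (A / q.+1%:R *+ q.+1) ('X^(q.+1) - det_unit%:P).[1].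
    rewrite -mulr_natr divfK ?pnatr_eq0 // !hornerE expr1n -opprB vN.
    exact: det_unit_near1.
  have [k hk kn] := root_near (monicXnsubC _ (ltn0Sn q)) (size_XnsubC _ (ltn0Sn q)) hz (ltn0Sn q).
  by exists k => //; apply/eqP; rewrite -subr_eq0 -hk !hornerE.
pose s1 := kappa * a ^+ (q ^ 3); pose s2 := kappa * b ^+ (q ^ 3).
pose X1 := alpha ^+ (q ^ 2) * s1; pose Y1 := alpha ^+ (q ^ 2) * s2.
have D3 n : alt n (a ^+ (q ^ 3)) (b ^+ (q ^ 3)) = alt n a b ^+ (q ^ 3).
  by rewrite !expq3 !(frob_alt frobC).
have D1 : alt q X1 Y1 = - t.
  by rewrite !alt_scale D3 hab expr1n mulr1 hk -exprM det_unitE mulrC addn1.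
have vk : vge v 0 kappa.
  have -> : kappa = 1 - (1 - kappa) by ring.
  apply: v_ge_sub; rewrite ?v1 //; apply: vge_trans kn.
  by rewrite ltW // divr_gt0 ?A_gt0 ?ltr0n.
have t0 : - t != 0 by rewrite oppr_eq0; apply: v_neq0 v_t.
have tq : (- t) ^+ q = w * - t.
  by rewrite (frobN frobC) mulrN -t_exp -exprSr prednK ?q0.
pose u := - alt (q ^ 2) X1 Y1 / - t.
have hTu : alt (q ^ 2) X1 Y1 = - (u * - t) by rewrite /u divfK // opprK.
have lX1 : lt u X1 = 0.
  have := moore_relation frobC X1 Y1; rewrite D1 tq hTu => h.
  apply: (mulIf t0); rewrite mul0r -[RHS]h /Defs.pi_mul; ring.
have lY1 : lt u Y1 = 0.
  have := moore_relation' frobC X1 Y1; rewrite D1 tq hTu => h.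
  apply: (mulIf t0); rewrite mul0r -[RHS]h /Defs.pi_mul; ring.
have vu : vge v (A *+ (q ^ 3 * (q - 1))) u.
  apply: (@vge_div _ _ _ _ _ _ (A *+ (q ^ 2 * (q + 1)))); first by rewrite vN v_t.
  rewrite vN -mulrnDr !alt_scale D3 -exprM.
  rewrite (_ : (_ + _)%N = (q ^ 2 * (q ^ 2).+1)%N); last by have q2 := q1; qnia q2.
  rewrite -[A *+ _]addr0; apply: vge_mul; first by rewrite v_alphaX.
  apply: vge0_mul; first exact: vge0_exp.
  by apply: vge0_exp; apply: alt_int.
have [X hX] := lt_root u X1; have [Y hY] := lt_root u Y1.
pose m := mu_form q X X1 Y Y1.
have hm : m ^+ q = - t + w * m.
  rewrite -D1; apply: (mu_form_frob frobC (u := u)) => //.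
have hp : pi2 ^+ q = - t + w * pi2 by rewrite /pi_LT; ring.
have w0 : w != 0 by apply: v_neq0 v_w.
(* Both m and pi2 are roots of T^q - w T = - t, so m - pi2 is in the kernel of
   [pi]_LT, that is, a multiple of - t by an element fixed by the q-power map. *)
pose l := (m - pi2) / - t.
have hl : l ^+ q = l.
  rewrite /l exprMn exprVn (frobB frobC) hm hp tq.
  by rewrite [- (- _ + _)]opprD addrACA subrr add0r -mulrBr -mulf_div divff // mul1r.
pose X' := X + l * X1.
have f1 : (1 : C) ^+ q = 1 by rewrite expr1n.
have f0 : (0 : C) ^+ q = 0 by rewrite (frob0 frobC).
have hX' : lt u X' = X1.
  by rewrite /X' -[X]mul1r lt_lin // hX lX1 mulr0 addr0 mul1r.
have hYm : mu2 iota q pi u X' Y = pi2.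
  have -> : mu2 iota q pi u X' Y = mu_form q X' X1 Y Y1 by rewrite -hX' -hY.
  have := mu_form_act frobC X Y X1 Y1 f1 hl f0 f0 f0 f0 f1 f0.
  rewrite D1 -/m !mul0r !mul1r !mulr1 !addr0 !add0r !subr0 -/X' => ->.
  by rewrite /l divfK //; ring.
have hon : onY u X' Y by split; rewrite // ?hX' ?hY.
have fB2 (c d : C) : (c - d) ^+ (q ^ 2) = c ^+ (q ^ 2) - d ^+ (q ^ 2).
  by rewrite !expq2 !(frobB frobC).
exists u, X', Y; split=> //.
all: have [hx hy] := x_int hon; have ho := om_int hon; have [i1 i2 _ _ _] := coef_int.
all: apply: (@vge_exp_inv _ _ _ _ _ (q ^ 2)); rewrite ?expn_gt0 ?q0 //.
all: rewrite /epsv -[_ / _%:R *+ _]mulr_natr divfK ?pnatr_eq0 -?lt0n ?expn_gt0 ?q0 //.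
all: rewrite fB2 -exprM -expnS.
- have := x1E u X'; rewrite hX' {1}/X1; move/(mulfI (expf_neq0 _ alpha0)) => e.
  rewrite (_ : _ - _ = - ((1 - kappa) * a ^+ (q ^ 3)) -
    alpha * (level1_cu * (u / alpha ^+ (q ^ 3 * (q - 1))) * (X' / alpha) ^+ q + level1_cx * (X' / alpha))).
    apply: v_ge_sub; first by rewrite vN; apply: vge_mulr => //; apply: vge0_exp.
    apply: vge_mulr; first by rewrite v_alpha lee_fin ler_pdivrMr ?ltr0n // ler_pMr ?A_gt0 // ler1n.
    by apply: v_ge_add; [apply: vge0_mul; [apply: vge0_mul|apply: vge0_exp]|apply: vge0_mul].
  move: e; rewrite /s1 => e; rewrite mulrBl e; ring.
- have := y1E u Y; rewrite hY {1}/Y1; move/(mulfI (expf_neq0 _ alpha0)) => e.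
  rewrite (_ : _ - _ = - ((1 - kappa) * b ^+ (q ^ 3)) -
    alpha * (level1_cu * (u / alpha ^+ (q ^ 3 * (q - 1))) * (Y / alpha) ^+ q + level1_cx * (Y / alpha))).
    apply: v_ge_sub; first by rewrite vN; apply: vge_mulr => //; apply: vge0_exp.
    apply: vge_mulr; first by rewrite v_alpha lee_fin ler_pdivrMr ?ltr0n // ler_pMr ?A_gt0 // ler1n.
    by apply: v_ge_add; [apply: vge0_mul; [apply: vge0_mul|apply: vge0_exp]|apply: vge0_mul].
  move: e; rewrite /s2 => e; rewrite mulrBl e; ring.
Qed.

End Geometry.

(** * Independence of the normal monomials near a cusp *)

Lemma rmorph_mmap (n : nat) (S : nzRingType) (B B' : comNzRingType) (psi : {rmorphism B -> B'})
    (phi : {rmorphism S -> B}) (phi' : S -> B') (h : 'I_n -> B) (h' : 'I_n -> B')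
    (P : {mpoly S[n]}) :
  (forall c, psi (phi c) = phi' c) -> (forall i, psi (h i) = h' i) ->
  psi (mmap phi h P) = mmap phi' h' P.
Proof.
move=> h1 h2; rewrite /mmap rmorph_sum; apply: eq_bigr => m _.
rewrite rmorphM h1 /mmap1 rmorph_prod; congr (_ * _); apply: eq_bigr => i _.
by rewrite rmorphXn h2.
Qed.

Lemma exists_min (R : realType) (T : eqType) (s : seq T) (f : T -> R) x0 :
  x0 \in s -> exists2 x, x \in s & forall y, y \in s -> f x <= f y.
Proof.
elim: s x0 => [//|a s IH] x0 _; case: s IH => [_|b s IH].
  by exists a; rewrite ?mem_head // => y; rewrite inE => /eqP ->.
have [x xs hx] := IH b (mem_head _ _).
have [le|lt] := leP (f a) (f x).
  exists a; first by rewrite mem_head.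
  move=> y; rewrite inE => /orP [/eqP -> //|/hx]; exact: le_trans.
exists x; first by rewrite inE xs orbT.
by move=> y; rewrite inE => /orP [/eqP ->|/hx //]; apply: ltW.
Qed.

Section Cusp.
Variables (R : realType) (C : closedFieldType) (v : valuation R C) (q : nat).
Hypothesis q1 : (1 < q)%N.
Hypothesis frobC : forall x y : C, (x + y) ^+ q = x ^+ q + y ^+ q.
Hypothesis q_eq0 : (q%:R : C) = 0.
Variables (alpha : C) (A : R).
Hypotheses (A0 : 0 < A) (va : v alpha = A%:E).

Let q0 : (0 < q)%N := ltnW q1.

(** The value of z = Z - x^(q^2-1) at (x, y) = (a^q, b^q).  Taking q-th powers for x
    and y makes Z, whose q-th power is D_(q^3)(x, y), a polynomial in a and b. *)
Definition z_frob (a b : C) : C := alt (q ^ 3) a b - a ^+ (q ^ 3 - q).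

(** The order of the pole of z at the cusp where a has a simple pole, prime to q. *)
Definition z_pole : nat := (q * (q ^ 2 - q - 1) + 1)%N.

Let z_poleE : (q ^ 3 + 1 = z_pole + q + q ^ 2)%N.
Proof. by rewrite /z_pole; have := q1; case: (q) => [|[|m]] // _; rewrite !expnS expn0; nia. Qed.

Lemma closed_root_Xn (c : C) n : (0 < n)%N -> exists x, x ^+ n = c.
Proof.
move=> n0; have /closed_rootP [x /rootP hx] : size ('X^n - c%:P) != 1%N.
  by rewrite size_XnsubC // eqSS -lt0n.
exists x; apply/eqP; rewrite -subr_eq0 -hx.
by rewrite !(hornerD, hornerN, hornerXn, hornerC).
Qed.

(** Points of a^q b - a b^q = 1 close to the cusp b / a = 0.  There b is close to
    a^(-q); with b = 1 / (a^q g) the equation becomes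
    g^q - g^(q-1) + a^(1-q^2) = 0, which has a root g close to 1. *)
Lemma cusp_point n (d := A / n.+1%:R) :
  exists a b : C, [/\ alt q a b = 1, v a = (- d)%:E, v b = (d * q%:R)%:E
    & v (z_frob a b) = (- (d * z_pole%:R))%:E].
Proof.
have d0 : 0 < d by rewrite divr_gt0 ?ltr0n.
have [a' ha'] := closed_root_Xn alpha (ltn0Sn n).
have va' : v a' = d%:E.
  by apply: (@v_exp_inv _ _ _ _ n.+1) => //; rewrite ha' va -mulr_natr divfK ?pnatr_eq0.
pose a := a'^-1; have vaa : v a = (- d)%:E := v_inv va'.
have aX k : v (a ^+ k) = (- (d * k%:R))%:E.
  by rewrite (v_exp _ vaa) mulNrn mulr_natr.
have an0 : a != 0 := v_neq0 vaa.
pose th := (a ^+ (q ^ 2 - 1))^-1.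
have vth : v th = (d * (q ^ 2 - 1)%N%:R)%:E by rewrite (v_inv (aX _)) opprK.
pose P : {poly C} := 'X^q + (- 'X^(q.-1) + th%:P).
have sl : (size (- 'X^(q.-1) + th%:P)%R <= q)%N.
  apply: leq_trans (size_polyD _ _) _; rewrite geq_max size_polyN size_polyXn prednK // leqnn.
  by apply: leq_trans (size_polyC_leq1 _) q0.
have sP : size P = q.+1 by rewrite size_polyDl size_polyXn.
have mP : P \is monic by rewrite monicE lead_coefDl ?size_polyXn ?lead_coefXn.
have d' : 0 < d * (q ^ 2 - 1)%N%:R / q%:R.
  have q21 : (0 < q ^ 2 - 1)%N by rewrite subn_gt0 -[X in (X < _)%N](exp1n 2) ltn_exp2r.
  by apply: divr_gt0; [apply: mulr_gt0; rewrite ?ltr0n|rewrite ltr0n].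
have [g hg gn] : exists2 g, P.[g] = 0 & vge v (d * (q ^ 2 - 1)%N%:R / q%:R) (1 - g).
  apply: (root_near mP sP) => //; rewrite -[_ *+ q]mulr_natr divfK ?pnatr_eq0 -?lt0n //.
  by rewrite !(hornerD, hornerN, hornerXn, hornerC) !expr1n addrA subrr add0r vth.
have vg : v g = 0%:E by apply: (v_unit_near d'); rewrite -opprB vN.
have gn0 := v_neq0 vg.
have {}hg : th = g ^+ q.-1 - g ^+ q.
  move: hg; rewrite !(hornerD, hornerN, hornerXn, hornerC) => hg.
  by apply/eqP; rewrite -subr_eq0 -hg; apply/eqP; ring.
pose b := (a ^+ q * g)^-1.
have ab : a ^+ q * b = g^-1 by rewrite /b invfM mulrA divff ?mul1r // expf_neq0.
have vb : v b = (d * q%:R)%:E.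
  by rewrite (v_inv (v_mul (aX q) vg)) addr0 opprK.
have hab : alt q a b = 1.
  have abq : a * b ^+ q = th / g ^+ q.
    rewrite /b /th exprVn exprMn -exprM invfM.
    rewrite mulrA; congr (_ / _).
    apply: (mulIf (expf_neq0 (q * q) an0)); rewrite divfK ?expf_neq0 //.
    have -> : a ^+ (q * q) = a ^+ (q ^ 2 - 1) * a.
      by rewrite -exprSr; congr (_ ^+ _); nia.
    by rewrite mulrA mulVf ?mul1r // expf_neq0.
  have gq : g ^+ q = g * g ^+ q.-1 by rewrite -exprS prednK.
  rewrite /alt ab abq hg gq; field.
  by rewrite gn0 expf_neq0.
exists a, b; split=> //.
have -> : z_frob a b = a ^+ (q ^ 3 - q) * a * b ^+ q - a * b ^+ (q ^ 3).
  have e : a ^+ q * b = 1 + a * b ^+ q by rewrite -hab /alt; ring.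
  rewrite /z_frob /alt.
  have -> : a ^+ (q ^ 3) = a ^+ (q ^ 3 - q) * a ^+ q.
    by rewrite -exprD subnK // -{1}(expn1 q) leq_exp2l.
  rewrite -[_ * a ^+ q * b]mulrA e; ring.
have bX k : v (b ^+ k) = (d * q%:R * k%:R)%:E.
  by rewrite (v_exp _ vb); congr (_%:E); apply: esym (mulr_natr _ _).
have vaS : v (a ^+ (q ^ 3 - q) * a * b ^+ q) = (- (d * z_pole%:R))%:E.
  rewrite -exprSr (v_mul (aX _) (bX q)); congr (_%:E).
  have -> : (q ^ 3 - q).+1 = (z_pole + q * q)%N by have := z_poleE; nia.
  by rewrite natrD natrM; ring.
apply: (v_dom vaS (s := 0)); last first.
  rewrite vN (v_mul vaa (bX _)) lee_fin -{1}[d]mulr1 -mulNr.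
  rewrite (_ : - d * 1 + _ = d * (q * q ^ 3 - 1)%N%:R).
    by rewrite mulr_ge0 ?ler0n // ltW.
  rewrite natrB ?natrM; first ring.
  by rewrite muln_gt0 expn_gt0 q0.
by rewrite oppr_lt0 mulr_gt0 // ltr0n /z_pole addn1.
Qed.

Local Notation V := (vring v).

Section Curve.

(** Integral polynomials in two variables, seen as polynomials in b whose
    coefficients are polynomials in a. *)
Definition ev_a (a : C) : {rmorphism {poly V} -> C} :=
  horner_eval a \o map_poly (val : V -> C).
Definition ev_ab (a b : C) : {rmorphism {poly {poly V}} -> C} :=
  horner_eval b \o map_poly (ev_a a).

Lemma ev_aC a c : ev_a a c%:P = val c.
Proof.
have -> : ev_a a c%:P = (map_poly (val : V -> C) c%:P).[a] by [].
by rewrite map_polyC hornerC.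
Qed.
Lemma ev_aX a : ev_a a 'X = a.
Proof.
have -> : ev_a a 'X = (map_poly (val : V -> C) 'X).[a] by [].
by rewrite map_polyX hornerX.
Qed.
Lemma ev_abE a b s : ev_ab a b s = (map_poly (ev_a a) s).[b]. Proof. by []. Qed.
Lemma ev_abC a b s : ev_ab a b s%:P = ev_a a s.
Proof. by rewrite ev_abE map_polyC hornerC. Qed.
Lemma ev_abX a b : ev_ab a b 'X = b.
Proof. by rewrite ev_abE map_polyX hornerX. Qed.

Definition curve_poly : {poly {poly V}} := 'X *: 'X^q + (1 - ('X^q) *: 'X).

Lemma size_curve_poly : size curve_poly = q.+1 /\ lead_coef curve_poly = 'X.
Proof.
have s1 : size ('X *: 'X^q : {poly {poly V}}) = q.+1.
  rewrite -mul_polyC size_Mmonic ?monicXn ?size_polyXn ?size_polyC ?polyX_eq0 //.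
  by rewrite polyC_eq0 polyX_eq0.
have s2 : (size (1 - ('X^q) *: 'X : {poly {poly V}})%R < q.+1)%N.
  rewrite ltnS; apply: leq_trans (size_polyD _ _) _; rewrite geq_max size_poly1.
  by rewrite q0 size_polyN (leq_trans (size_scale_leq _ _)) // size_polyX.
split; first by rewrite size_polyDl s1.
rewrite lead_coefDl ?s1 // -mul_polyC lead_coef_Mmonic ?monicXn //.
exact: lead_coefC.
Qed.

(** Pseudo-division by a b^q - a^q b + 1, whose leading coefficient as a
    polynomial in b is a. *)
Lemma curve_red (P : {poly {poly V}}) : exists N (r : {poly {poly V}}),
  (size r <= q)%N /\
  forall a b, alt q a b = 1 -> a ^+ N * ev_ab a b P = ev_ab a b r.
Proof.
have [sH lH] := size_curve_poly.
have cH : GRing.comm curve_poly (lead_coef curve_poly)%:P by apply: mulrC.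
have := Pdiv.RingComRreg.rdivp_eq cH P.
set N := Pdiv.CommonRing.rscalp _ _; set r := Pdiv.CommonRing.rmodp _ _ => E.
exists N, r; split.
  rewrite -ltnS -sH /r; apply: Pdiv.Ring.ltn_rmodpN0.
  by rewrite -size_poly_eq0 sH.
move=> a b hab; have H0 : ev_ab a b curve_poly = 0.
  rewrite /curve_poly -!mul_polyC rmorphD rmorphB !rmorphM !rmorphXn !ev_abC ?rmorphXn !ev_aX !ev_abX rmorph1.
  by rewrite -hab /alt; ring.
have := congr1 (ev_ab a b) E; rewrite rmorphD !rmorphM H0 mulr0 add0r => <-.
by rewrite lH ev_abC rmorphXn ev_aX mulrC.
Qed.

Lemma v_eq_exp (x : C) n : (1 < n)%N -> x != 0 -> x ^+ n = x -> v x = 0%:E.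
Proof.
move=> n1 /(v_fin v) [s hs] /(congr1 v); rewrite (v_exp _ hs) hs => -[/eqP].
case: n n1 => [|[|n]] // _; rewrite mulrS -subr_eq0 addrAC subrr add0r.
by rewrite mulrn_eq0 /= => /eqP ->.
Qed.

Lemma frob_iter m (x y : C) : (x - y) ^+ (q ^ m) = x ^+ (q ^ m) - y ^+ (q ^ m).
Proof.
elim: m => [|m IH]; first by rewrite !expr1.
by rewrite !expnSr !exprM IH (frobB frobC).
Qed.

(** The finite fields inside C: the roots of X^(q^m) - X differ by units, because
    their differences satisfy this equation as well. *)
Lemma unit_nodes m : exists rs : seq C,
  [/\ uniq rs, (m <= size rs)%N, forall x, x \in rs -> v x = 0%:E
    & {in rs &, forall x y, x != y -> v (x - y) = 0%:E}].
Proof.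
pose n := (q ^ m.+1)%N.
have n1 : (m.+1 < n)%N by apply: ltn_expl.
have n2 : (1 < n)%N by apply: leq_ltn_trans n1.
pose P : {poly C} := 'X^n - 'X.
have sP : size P = n.+1 by rewrite size_polyDl size_polyXn // size_polyN size_polyX.
have dP : P^`() = (-1)%:P.
  rewrite derivB derivXn derivX /n expnS -mulr_natr natrM.
  rewrite -[q%:R](rmorph_nat (@polyC C)) q_eq0 !mul0r mulr0.
  by rewrite sub0r polyCN.
have P0 : P != 0 by rewrite -size_poly_eq0 sP.
have c0 : (-1 : C) != 0 by rewrite oppr_eq0 oner_eq0.
have [rs [urs srs hrs]] := simple_roots P0 c0 dP.
have hroot x : x \in rs -> x ^+ n = x.
  rewrite hrs !(hornerD, hornerN, hornerXn, hornerX) subr_eq0.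
  by move/eqP.
exists (rem 0 rs); split.
- exact: rem_uniq.
- have z0 : 0 \in rs.
    by rewrite hrs !(hornerD, hornerN, hornerXn, hornerX) expr0n eqn0Ngt (ltnW n2) subrr.
  by rewrite size_rem // srs sP /=; lia.
- move=> x; rewrite mem_rem_uniq // inE => /andP [x0 /hroot h].
  exact: v_eq_exp h.
- move=> x y /mem_rem /hroot hx /mem_rem /hroot hy xy.
  apply: (@v_eq_exp _ n) => //; first by rewrite subr_eq0.
  by rewrite /n frob_iter -/n hx hy.
Qed.

Lemma curve_b_int a b : v a = 0%:E -> alt q a b = 1 -> vge v 0 b.
Proof.
move=> ha hab; have [->|/(v_fin v) [s hs]] := eqVneq b 0; first by rewrite v0 leey.
rewrite hs lee_fin leNgt; apply/negP => s0.
have ha' : v (a ^+ q) = 0%:E by rewrite (v_exp _ ha) mul0rn.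
have : v (- alt q a b) = (s *+ q)%:E.
  rewrite /alt opprB; apply: (@v_dom _ _ _ _ _ _ s).
  - by rewrite (v_mul ha (v_exp _ hs)) add0r.
  - by case: (q) q1 => [|[|k]] // _; rewrite mulrS gtrDl pmulrn_llt0.
  - by rewrite vN (v_mul ha' hs) add0r.
rewrite hab vN1 => -[/eqP]; rewrite eq_sym mulrn_eq0 eqn0Ngt q0 /= => /eqP e.
by rewrite e ltxx in s0.
Qed.

(** For a unit a the equation has q solutions b, whose differences are units
    since they are roots of d^(q-1) = a^(q-1).  Interpolation in b, then in a,
    bounds the coefficients. *)
Lemma curve_small (r : {poly {poly V}}) (e : R) : (size r <= q)%N ->
  (forall a b, v a = 0%:E -> vge v 0 b -> alt q a b = 1 -> vge v e (ev_ab a b r)) ->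
  forall i j, vge v e (val (r`_i)`_j).
Proof.
move=> sr hr i j.
have [as_ [uas sas vas das]] := unit_nodes (size r`_i).
have -> : val (r`_i)`_j = (map_poly (val : V -> C) r`_i)`_j by rewrite coef_map.
apply: (small_coef (rs := as_)) => //.
- by move=> x hx; rewrite vas.
- by apply: leq_trans sas; rewrite /map_poly; apply: size_poly.
move=> a /vas ha.
have -> : (map_poly (val : V -> C) r`_i).[a] = (map_poly (ev_a a) r)`_i.
  by rewrite coef_map.
have an0 := v_neq0 ha.
pose P : {poly C} := a *: 'X^q + ((- a ^+ q) *: 'X + 1).
have sP : size P = q.+1.
  rewrite size_polyDl size_scale // ?size_polyXn // ltnS.
  apply: leq_trans (size_polyD _ _) _; rewrite geq_max size_poly1 q0 andbT.
  by apply: leq_trans (size_scale_leq _ _) _; rewrite size_polyX.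
have dP : P^`() = (- a ^+ q)%:P.
  have z : 'X^(q.-1) *+ q = 0 :> {poly C}.
    by rewrite -mulr_natr -(rmorph_nat (@polyC C)) q_eq0 mulr0.
  by rewrite !derivD !derivZ derivXn derivX derivC addr0 alg_polyC z scaler0 add0r.
have P0 : P != 0 by rewrite -size_poly_eq0 sP.
have c0 : - a ^+ q != 0 by rewrite oppr_eq0 expf_neq0.
have [bs [ubs sbs hbs]] := simple_roots P0 c0 dP.
have hb b : b \in bs -> alt q a b = 1.
  rewrite hbs !(hornerD, hornerZ, hornerXn, hornerX, hornerC) => /eqP h.
  apply/eqP; rewrite -subr_eq0 -oppr_eq0 -h /alt; apply/eqP; ring.
apply: (small_coef (rs := bs)) => //.
- by move=> b /hb; apply: curve_b_int.
- move=> b b' /hb h /hb h' bb'; have d0 : b - b' != 0 by rewrite subr_eq0.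
  apply: (@v_exp_inv _ _ _ _ q.-1); first by case: (q) q1 => [|[]].
  have -> : (b - b') ^+ q.-1 = a ^+ q.-1.
    apply: (mulIf d0); rewrite -exprSr prednK // (frobB frobC).
    apply: (mulfI an0); rewrite mulrA -exprS prednK //.
    apply/eqP; rewrite -subr_eq0; apply/eqP.
    transitivity (alt q a b' - alt q a b); first by rewrite /alt; ring.
    by rewrite h h' subrr.
  by rewrite (v_exp _ ha) !mul0rn.
- rewrite sbs sP; apply: leq_trans sr; exact: size_poly.
- by move=> b hb'; have := hr a b ha (curve_b_int ha (hb b hb')) (hb b hb').
Qed.

End Curve.

Lemma v_dom_lt (x y : C) (s : R) : v x = s%:E -> (s%:E < v y)%E -> v (x + y) = s%:E.
Proof.
move=> hx; case E : (v y) => [t||] //; last first.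
  by move/v_eqy: E => ->; rewrite addr0.
by rewrite lte_fin => st; apply: (v_dom hx st); rewrite E.
Qed.

Section Independence.
Variables (Q : {mpoly V[3]}) (e : R).
Hypotheses (nQ : normal q Q) (e0 : 0 < e).
Let f (a b : C) := mmap (val : V -> C) (tri (a ^+ q) (b ^+ q) (z_frob a b)) Q.
Hypothesis hf : forall a b, vge v 0 a -> vge v 0 b -> alt q a b = 1 -> vge v e (f a b).

(** The order of a normal monomial at the cusp, v(a) = -1 being the unit. *)
Let ordm (m : 'X_{1..3}) : R :=
  q%:R * q%:R * (m 1%R)%:R - q%:R * (m 0%R)%:R - z_pole%:R * (m 2%R)%:R.

(** Modulo q the orders determine l, as the pole order of z is 1 modulo q; then
   i and j follow from i < q or j = 0. *)
Let ordm_inj m m' : normal_mnm q m -> normal_mnm q m' -> ordm m = ordm m' -> m = m'.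
Proof.
rewrite /normal_mnm => /andP [l1 c] /andP [l1' c'] E.
have {E} : (q * q * m 1%R + q * m' 0%R + z_pole * m' 2%R =
        q * q * m' 1%R + q * m 0%R + z_pole * m 2%R)%N.
  apply/eqP; rewrite -(eqr_nat R) !natrD !natrM; apply/eqP.
  by move: E; rewrite /ordm => E; lra.
move=> E; rewrite (mnm3E m) (mnm3E m').
move: (m 0) (m 1) (m 2) (m' 0) (m' 1) (m' 2) l1 c l1' c' E => i j l i' j' l' l1 c l1' c' E.
have ell : l = l'.
  rewrite -(modn_small l1) -(modn_small l1').
  rewrite -(modnMDl (q * j' + i + (q ^ 2 - q - 1) * l) l q).
  rewrite -(modnMDl (q * j + i' + (q ^ 2 - q - 1) * l') l' q).
  congr (_ %% _)%N; transitivity (q * q * j' + q * i + z_pole * l)%N.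
    by rewrite /z_pole; set k := (_ - _ - _)%N; ring.
  by rewrite -E /z_pole; set k := (_ - _ - _)%N; ring.
rewrite ell in E *; have {E} E : (q * j + i' = q * j' + i)%N.
  apply/eqP; rewrite -(eqn_pmul2l q0); apply/eqP; lia.
have ei : i = i'.
  case/orP: c => [c|/eqP c]; case/orP: c' => [c'|/eqP c']; subst.
  - rewrite -(modn_small c) -(modn_small c') -(modnMDl j' i q) -(modnMDl j i' q).
    by congr (_ %% _)%N; lia.
  - by rewrite muln0 add0n in E; case: j E => [|j]; rewrite ?muln0 ?mulnS; lia.
  - by rewrite muln0 add0n in E; case: j' E => [|j']; rewrite ?muln0 ?mulnS; lia.
  - lia.
rewrite ei in E *; congr (mnm3 _ _ _); apply/eqP.
by rewrite -(eqn_pmul2l q0); apply/eqP; lia.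
Qed.

(** Suppose that Q has unit coefficients, and let m0 be the one among these normal
    monomials with the worst pole.  At a point with v(a) = -d, for d small
    enough, the term of m0 has a valuation different from all others, so that
    v(Q) = d * ordm m0.  But Q times a power of a is a polynomial of degree less
    than q in b with coefficients of valuation at least e, hence v(Q) >= e up to
    a multiple of d: this is absurd when d tends to 0. *)
Lemma normal_small m : (0 < v (val Q@_m))%E.
Proof.
rewrite ltNge; apply/negP => hm.
have unit_coef k : (v (val Q@_k) <= 0)%E -> v (val Q@_k) = 0%:E.
  by move=> h; apply/eqP; rewrite eq_le h vring_valP.
have supp k : v (val Q@_k) = 0%:E -> k \in msupp Q.
  by move=> h; rewrite mcoeff_msupp; apply: contraTneq (v_neq0 h) => ->; rewrite rmorph0 eqxx.
pose S := [seq k <- msupp Q | v (val Q@_k) == 0%:E].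
have mS : m \in S.
  by rewrite mem_filter; apply/andP; split; [apply/eqP/unit_coef|apply/supp/unit_coef].
have [m0 m0S hmin] := exists_min ordm mS.
have [e' e'0 he'] : exists2 e' : R, 0 < e' & forall k, v (val Q@_k) != 0%:E -> vge v e' (val Q@_k).
  have [e' e'0 he'] : exists2 e' : R, 0 < e' & forall k, k \in msupp Q ->
      v (val Q@_k) != 0%:E -> vge v e' (val Q@_k).
    elim: (msupp Q) => [|k s [e' e'0 he']]; first by exists 1.
    have [h|h] := eqVneq (v (val Q@_k)) 0%:E.
      by exists e' => // l; rewrite inE => /orP [/eqP ->|/he' //]; rewrite h eqxx.
    have [e'' e''0 he''] : exists2 e'' : R, 0 < e'' & vge v e'' (val Q@_k).
      have : (0%:E < v (val Q@_k))%E by rewrite lt_neqAle eq_sym h; apply: vring_valP.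
      case: (v _) => [x||] //; first by rewrite lte_fin => x0; exists x.
      by move=> _; exists 1; rewrite ?leey.
    exists (Num.min e' e''); first by rewrite lt_min e'0.
    move=> l; rewrite inE => /orP [/eqP -> _|/he' hl /hl].
      by apply: vge_trans he''; rewrite ge_min lexx orbT.
    by apply: vge_trans; rewrite ge_min lexx.
  exists e' => // k; have [/he' //|/memN_msupp_eq0 -> _] := boolP (k \in msupp Q).
  by rewrite rmorph0 v0 leey.
pose phi : {rmorphism V -> {poly {poly V}}} := @polyC {poly V} \o @polyC V.
pose zp : {poly {poly V}} := 'X%:P ^+ (q ^ 3) * 'X - 'X%:P * 'X ^+ (q ^ 3) - 'X%:P ^+ (q ^ 3 - q).
pose P := mmap phi (tri ('X%:P ^+ q) ('X ^+ q) zp) Q.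
have fP a b : f a b = ev_ab a b P.
  rewrite /f /P; apply/esym/rmorph_mmap => [c|].
    have -> : phi c = (c%:P)%:P by [].
    by rewrite ev_abC ev_aC.
  move=> i; rewrite (tri_map (ev_ab a b)) /zp !rmorphB !rmorphM !rmorphXn !ev_abC !ev_aX !ev_abX.
  by [].
have [N [r [sr hr]]] := curve_red P.
have coefr : forall i j, vge v e (val (r`_i)`_j).
  apply: curve_small => // a b ha hb hab; rewrite -hr // -fP.
  apply: vge_mull; first by rewrite (v_exp _ ha) mul0rn.
  by apply: hf => //; rewrite ha.
pose K := (\sum_(i < q) size (r`_i)%R)%N.
have [n hn] : exists n : nat, forall d, d = A / n.+1%:R ->
    [/\ d * (ordm m0 + K%:R) < e & forall k, k \in msupp Q -> d * (ordm m0 - ordm k) < e'].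
  pose B := `|ordm m0| + K%:R + \sum_(k <- msupp Q) `|ordm k|.
  have sB0 : 0 <= \sum_(k <- msupp Q) `|ordm k| by apply: sumr_ge0.
  have B0 : 0 <= B by rewrite !addr_ge0.
  pose mu := Num.min e e'; have mu0 : 0 < mu by rewrite lt_min e0.
  exists (Num.bound (A * B / mu)) => d ->; set n := Num.bound _.
  have hd : A / n.+1%:R * B < mu.
    rewrite mulrAC ltr_pdivrMr ?ltr0n // [mu * _]mulrC -ltr_pdivrMr //.
    have hb : A * B / mu < n%:R.
      by apply: archi_boundP; rewrite divr_ge0 ?mulr_ge0 // ltW.
    by apply: lt_trans hb _; rewrite ltr_nat.
  have d0 : 0 < A / n.+1%:R by rewrite divr_gt0 ?ltr0n.
  split.
    apply: le_lt_trans (_ : _ <= A / n.+1%:R * B) _; last first.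
      by apply: lt_le_trans hd _; rewrite ge_min lexx.
    rewrite ler_pM2l // /B; have := ler_norm (ordm m0); lra.
  move=> k km; apply: le_lt_trans (_ : _ <= A / n.+1%:R * B) _; last first.
    by apply: lt_le_trans hd _; rewrite ge_min lexx orbT.
  rewrite ler_pM2l // /B.
  have : `|ordm k| <= \sum_(k <- msupp Q) `|ordm k|.
    by rewrite (bigD1_seq k) ?msupp_uniq //= lerDl sumr_ge0.
  have := ler_norm (ordm m0); have := ler_norm (- ordm k); rewrite normrN.
  have : 0 <= K%:R :> R by []; lra.
have [a [b [hab va' vb vz]]] := cusp_point n.
have [] := hn _ erefl; set d := A / n.+1%:R in va' vb vz * => hd1 hd2.
have d0 : 0 < d by rewrite divr_gt0 ?ltr0n.
have vmon k : v (mmap1 (tri (a ^+ q) (b ^+ q) (z_frob a b)) k) = (d * ordm k)%:E.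
  rewrite mmap1_tri.
  rewrite (v_mul (v_mul (v_exp _ (v_exp _ va')) (v_exp _ (v_exp _ vb))) (v_exp _ vz)).
  congr (_%:E); rewrite /ordm -(mulr_natr (- d *+ q)) -(mulr_natr (- d) q).
  rewrite -(mulr_natr (d * q%:R *+ q)) -(mulr_natr (d * q%:R) q).
  by rewrite -(mulr_natr (- (d * z_pole%:R))); ring.
have vf : v (f a b) = (d * ordm m0)%:E.
  move: m0S; rewrite mem_filter => /andP [/eqP c0 m0s].
  rewrite /f /mmap (bigD1_seq m0) ?msupp_uniq //=.
  apply: v_dom_lt; first by rewrite (v_mul c0 (vmon _)) add0r.
  rewrite big_seq_cond; elim/big_ind: _ => [|x y hx hy|k /andP [ks km]].
  - by rewrite v0 ltry.
  - by apply: lt_le_trans (vD v x y); rewrite lt_min hx.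
  have [c|c] := eqVneq (v (val Q@_k)) 0%:E.
    rewrite (v_mul c (vmon _)) add0r lte_fin ltr_pM2l // lt_neqAle hmin ?andbT.
      by apply: contra km => /eqP/ordm_inj <-; rewrite ?nQ.
    by rewrite mem_filter c eqxx.
  apply: lt_le_trans (vge_mul (he' _ c) (_ : vge v (d * ordm k) _)); last by rewrite vmon.
  by rewrite lte_fin; have := hd2 k ks; rewrite mulrBr; lra.
have : vge v (e - d * K%:R) (a ^+ N * f a b).
  rewrite fP hr // ev_abE horner_coef; apply: v_ge_sum => i _.
  apply: vge_mulr; last by rewrite (v_exp _ vb) lee_fin mulrn_wge0 // mulr_ge0 // ltW.
  have -> : (map_poly (ev_a a) r)`_i = (map_poly (val : V -> C) r`_i).[a].
    by rewrite coef_map.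
  have iq : (i < q)%N by apply: leq_trans (ltn_ord i) _; apply: leq_trans sr; apply: size_poly.
  rewrite horner_coef; apply: v_ge_sum => j _; rewrite coef_map.
  have jK : (j <= K)%N.
    apply: ltnW; apply: leq_trans (ltn_ord j) _; apply: leq_trans (size_poly _ _) _.
    by rewrite /K (bigD1 (Ordinal iq)) //= leq_addr.
  apply: vge_mul; first exact: coefr.
  by rewrite (v_exp _ va') lee_fin mulNrn lerN2 -[d *+ _]mulr_natr ler_pM2l // ler_nat.
rewrite (v_mul (v_exp N va') vf) lee_fin mulNrn -[d *+ N]mulr_natr.
have : 0 <= d * N%:R by rewrite mulr_ge0 // ltW.
move: hd1; rewrite mulrDr; lra.
Qed.
End Independence.
End Cusp.

(** * Bounded functions and congruences *)

Section Affinoids.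
Variables (R : realType) (C : fieldType) (v : valuation R C) (n : nat).
Variables (r : 'I_n -> R) (X : set (n.-tuple C)).
Local Notation bf := (bounded_fun v r X).
Local Notation red := (qpi (topnil v r X)).

Definition evb_fun (P : affinoid v r X) (f : bf) : C := f P.

Lemma evb_zmod P : zmod_morphism (evb_fun P).
Proof. by move=> f g; rewrite /evb_fun -[bounded_val (f - g)]/(val (f - g)) rmorphB. Qed.
HB.instance Definition _ P := GRing.isZmodMorphism.Build bf C (evb_fun P) (evb_zmod P).
Lemma evb_monoid P : monoid_morphism (evb_fun P).
Proof.
split=> [|f g]; first by rewrite /evb_fun -[bounded_val 1]/(val (1 : bf)) rmorph1.
by rewrite /evb_fun -[bounded_val (f * g)]/(val (f * g)) rmorphM.
Qed.
HB.instance Definition _ P := GRing.isMonoidMorphism.Build bf C (evb_fun P) (evb_monoid P).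

Definition evb P : {rmorphism bf -> C} := evb_fun P.

Lemma evb_cst P c : evb P (bounded_cst r X c) = val c. Proof. by []. Qed.

Lemma red_eq (f g : bf) : red f = red g <->
  exists2 e : R, 0 < e & forall P, vge v e (evb P f - evb P g).
Proof.
split=> [/qpi_eq h|[e e0 h]].
  have {h} : topologically_nilpotent (val (f - g)) by [].
  move=> /topologically_nilpotentP [e e0 h].
  by exists e.
by apply/qpi_eq; apply/topologically_nilpotentP; exists e.
Qed.

Lemma red_eq_ext (f g : bf) : (forall P, evb P f = evb P g) -> f = g.
Proof. by move=> h; apply: val_inj; apply/funext => P; apply: h. Qed.

Lemma poly_bounded (p : {mpoly C[n]}) (f : affinoid v r X -> C) :
  (forall P, f P = p.@[tnth (val P)]) -> (forall P, vge v 0 (f P)) ->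
  exists F : bf, forall P, evb P F = f P.
Proof.
move=> hp hf; have h : f \in @bounded_pred _ _ v n r X.
  rewrite inE; split; last by apply/power_boundedP.
  by rewrite (_ : f = fun P => p.@[tnth (val P)]); [apply: analytic_poly|apply/funext].
by exists (BoundedFun h).
Qed.

End Affinoids.

Section ValCong.
Variables (R : realType) (C : fieldType) (v : valuation R C).
Variable e : R.

Lemma vcongM (x x' y y' : C) : vge v 0 x -> vge v 0 y' ->
  vge v e (x - x') -> vge v e (y - y') -> vge v e (x * y - x' * y').
Proof.
move=> hx hy h h'; have -> : x * y - x' * y' = x * (y - y') + (x - x') * y' by ring.
by apply: v_ge_add; [apply: vge_mull|apply: vge_mulr].
Qed.

Lemma vcongX (x x' : C) k : vge v 0 x -> vge v 0 x' ->
  vge v e (x - x') -> vge v e (x ^+ k - x' ^+ k).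
Proof.
move=> hx hx' h; elim: k => [|k IH]; first by rewrite !expr0 subrr v0 leey.
by rewrite !exprS; apply: vcongM => //; apply: vge0_exp.
Qed.

Lemma vcong_alt k (x x' y y' : C) : vge v 0 x -> vge v 0 x' -> vge v 0 y -> vge v 0 y' ->
  vge v e (x - x') -> vge v e (y - y') -> vge v e (alt k x y - alt k x' y').
Proof.
move=> hx hx' hy hy' h h'.
have -> : alt k x y - alt k x' y' =
  (x ^+ k * y - x' ^+ k * y') - (x * y ^+ k - x' * y' ^+ k) by rewrite /alt; ring.
by apply: v_ge_sub; apply: vcongM => //; try apply: vcongX => //; apply: vge0_exp.
Qed.

Lemma vcong_mmap n (h h' : 'I_n -> C) (Q : {mpoly (vring v)[n]}) :
  (forall i, vge v 0 (h i)) -> (forall i, vge v 0 (h' i)) ->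
  (forall i, vge v e (h i - h' i)) ->
  vge v e (mmap (val : vring v -> C) h Q - mmap (val : vring v -> C) h' Q).
Proof.
move=> hh hh' d; rewrite /mmap -sumrB; apply: v_ge_sum => m _.
rewrite -mulrBr; apply: vge_mull; first exact: vring_valP.
rewrite /mmap1; suff [] : [/\ vge v e (\prod_(i < n) h i ^+ m i - \prod_(i < n) h' i ^+ m i),
  vge v 0 (\prod_(i < n) h i ^+ m i) & vge v 0 (\prod_(i < n) h' i ^+ m i)] by [].
elim: (index_enum _) => [|i s [IH1 IH2 IH3]]; first by rewrite !big_nil subrr v0 v1 leey.
rewrite !big_cons; split; [|by apply: vge0_mul => //; apply: vge0_exp..].
by apply: vcongM => //; [apply: vge0_exp|apply: vcongX].
Qed.

Lemma mmap_int n (h : 'I_n -> C) (Q : {mpoly (vring v)[n]}) :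
  (forall i, vge v 0 (h i)) -> vge v 0 (mmap (val : vring v -> C) h Q).
Proof.
move=> hh; rewrite /mmap; apply: v_ge_sum => m _.
apply: vge0_mul; first exact: vring_valP.
rewrite /mmap1; elim/big_ind: _ => [|x y|i _]; first by rewrite v1.
- exact: vge0_mul.
- exact: vge0_exp.
Qed.

End ValCong.

(** * The coordinates of the reduction *)

Section Reduction.
Variables (R : realType) (F : fieldType) (C : closedFieldType).
Variables (vF : valuation R F) (v : valuation R C) (iota : vembedding vF v).
Variables (p q : nat) (pi : vring vF).
Hypothesis hF : local_field p q pi.
Variables (pi2 alpha gamma1 : C).
Hypothesis hpi2 : LT2_generator iota q pi pi2.
Hypothesis halpha : alpha ^+ (q * (q + 1)) = pi2.
Hypothesis hgamma1 : gamma1 ^+ q = alpha ^+ ((q - 1) * (q ^ 2 - 1)).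

Local Notation A := (unitv R q).
Local Notation V := (vring v).
Local Notation Y := (Y22 iota q pi pi2).
Local Notation bf := (Y22_bounded iota q pi pi2).
Local Notation cval := (val : V -> C).
Local Notation q1 := (q_gt1 hF).
Local Notation frob := (frobC iota hF).
Local Notation valpha := (v_alpha hF hpi2 halpha).
Local Notation valphaX := (v_alphaX hF hpi2 halpha).
Local Notation A0 := (A_gt0 hF).

Definition redY : {rmorphism bf -> Y22_reduction iota q pi pi2} :=
  qpi (Y22_topnil iota q pi pi2).
Local Notation red := redY.

Lemma redP (f g : bf) : red f = red g <->
  exists2 e : R, 0 < e & forall P, vge v e (evb P f - evb P g).
Proof. exact: red_eq. Qed.

Definition x_at (P : Y) : C := tnth (val P) 1 / alpha.
Definition y_at (P : Y) : C := tnth (val P) 2 / alpha.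
Definition Z_at (P : Y) : C := (alt q (x_at P) (y_at P) - 1) / gamma1.
Definition om_at (P : Y) : C := tnth (val P) 0 / alpha ^+ (q ^ 3 * (q - 1)).
Definition z_at (P : Y) : C := Z_at P - x_at P ^+ (q ^ 2 - 1).

Lemma pointP (P : Y) :
  onY iota q pi pi2 (tnth (val P) 0) (tnth (val P) 1) (tnth (val P) 2).
Proof.
have := valP P; rewrite inE => -[_ [[_ h1 h2 h3] h4]].
by split=> //; move: h4; rewrite (radiusE hF).
Qed.

Lemma point_of u X' Y' : onY iota q pi pi2 u X' Y' ->
  exists P : Y, val P = [tuple u; X'; Y'].
Proof.
move=> h; have [hu hX hY hm] := h.
have hin : [tuple u; X'; Y'] \in
    (polydisc v (Y22_radii R q) `&` Y22_set iota q pi pi2)%classic.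
  rewrite inE; split.
    have hX0 := onY_X hF hu hX; have hY0 := onY_X hF hu hY.
    case=> [[|[|[|//]]] lt]; rewrite /Y22_radii !(tnth_nth 0) /=.
    - by rewrite (radiusE hF).
    - by apply: vge_trans hX0; apply: ltW A0.
    - by apply: vge_trans hY0; apply: ltW A0.
  split; last by rewrite (radiusE hF).
  split=> //; apply: (@lt_le_trans _ _ (A *+ (q ^ 3 * (q - 1)))%:E) hu.
  by rewrite lte_fin pmulrn_lgt0 ?A0 // muln_gt0 expn_gt0 subn_gt0 q1 (q0 hF).
by exists (SigSub hin).
Qed.

Lemma coord_int P : [/\ vge v 0 (x_at P), vge v 0 (y_at P), vge v 0 (Z_at P) & vge v 0 (om_at P)].
Proof.
have hP := pointP P; have [h1 h2] := x_int hF hpi2 halpha hP.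
split=> //; first exact: (Z_int hF hpi2 halpha hgamma1 hP).
exact: (om_int hF hpi2 halpha hP).
Qed.

Lemma z_at_int P : vge v 0 (z_at P).
Proof.
by have [h1 h2 h3 h4] := coord_int P; apply: v_ge_sub => //; apply: vge0_exp.
Qed.

Definition pX : {mpoly C[3]} := alpha^-1 *: 'X_1.
Definition pY : {mpoly C[3]} := alpha^-1 *: 'X_2.

Lemma x_at_poly P : x_at P = pX.@[tnth (val P)].
Proof. by rewrite mevalZ mevalXU mulrC. Qed.
Lemma y_at_poly P : y_at P = pY.@[tnth (val P)].
Proof. by rewrite mevalZ mevalXU mulrC. Qed.
Lemma Z_at_poly P : Z_at P = (gamma1^-1 *: (alt q pX pY - 1)).@[tnth (val P)].
Proof.
rewrite mevalZ rmorphB rmorph1 /alt rmorphB !rmorphM !rmorphXn /= -x_at_poly -y_at_poly.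
by rewrite mulrC.
Qed.

Lemma coord_fun : exists x y Z : bf, [/\ forall P, evb P x = x_at P,
  forall P, evb P y = y_at P & forall P, evb P Z = Z_at P].
Proof.
have i1 P : vge v 0 (x_at P) by have [] := coord_int P.
have i2 P : vge v 0 (y_at P) by have [] := coord_int P.
have i3 P : vge v 0 (Z_at P) by have [] := coord_int P.
have [x hx] := poly_bounded x_at_poly i1.
have [y hy] := poly_bounded y_at_poly i2.
have [Z hZ] := poly_bounded Z_at_poly i3.
by exists x, y, Z.
Qed.

Lemma D_small P : vge v A (alt q (x_at P) (y_at P) - 1).
Proof.
rewrite (D_rel hF hpi2 halpha hgamma1); have [g _] := v_gamma1 hF hpi2 halpha hgamma1.
by apply: vge_mulr => //; have [] := coord_int P.
Qed.

Lemma Z_small P : vge v A (Z_at P ^+ q - alt (q ^ 3) (x_at P) (y_at P)).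
Proof.
have [hx hy _ ho] := coord_int P.
have [h1 h2 h3 h4 h5] := coef_int hF hpi2 halpha.
rewrite (Z_rel hF hpi2 halpha hgamma1 (pointP P)) addrC addKr.
apply: vge_mulr; first by rewrite valpha.
have ha n := alt_int n hx hy.
apply: v_ge_add; last exact: vge0_mul.
apply: v_ge_add; first exact: vge0_mul.
by apply: vge0_mul => //; apply: vge0_mul => //; apply: vge0_exp.
Qed.

(** ** The algebra generated by the coordinates *)

(** The triple (x, y, z) is used for normal forms, the quadruple (x, y, Z, om) for
    everything that polynomial functions can reach. *)
Definition ev3 (P : Y) : {rmorphism {mpoly V[3]} -> C} :=
  mmap cval (tri (x_at P) (y_at P) (z_at P)).
Definition ev4 (P : Y) : {rmorphism {mpoly V[4]} -> C} :=
  mmap cval (tnth [tuple x_at P; y_at P; Z_at P; om_at P]).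

Lemma ev4C P c : ev4 P c%:MP = val c. Proof. exact: (mmapC _ cval). Qed.
Lemma ev4X P i : ev4 P 'X_i = tnth [tuple x_at P; y_at P; Z_at P; om_at P] i.
Proof. exact: (etrans (mmapX _ cval _) (mmap1U _ _)). Qed.

Lemma ev4X0 P : ev4 P 'X_0 = x_at P. Proof. by rewrite ev4X. Qed.
Lemma ev4X1 P : ev4 P 'X_1 = y_at P. Proof. by rewrite ev4X. Qed.
Lemma ev4X2 P : ev4 P 'X_2 = Z_at P. Proof. by rewrite ev4X. Qed.
Lemma ev4X3 P : ev4 P 'X_3 = om_at P. Proof. by rewrite ev4X. Qed.
Definition ev4E := (ev4C, ev4X0, ev4X1, ev4X2, ev4X3).

Lemma ev4_int P Q : vge v 0 (ev4 P Q).
Proof.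
have [h1 h2 h3 h4] := coord_int P; apply: mmap_int.
by case=> [[|[|[|[|//]]]] lt]; rewrite !(tnth_nth 0).
Qed.

Definition small_mem (Phi : {mpoly V[4]}) : Prop :=
  exists Psi : {mpoly V[4]}, forall P, ev4 P Phi = alpha * ev4 P Psi.

Lemma small0 : small_mem 0.
Proof. by exists 0 => P; rewrite !rmorph0 mulr0. Qed.
Lemma smallD f g : small_mem f -> small_mem g -> small_mem (f + g).
Proof.
by move=> [s hs] [s' hs']; exists (s + s') => P; rewrite !rmorphD hs hs' mulrDr.
Qed.
Lemma smallMl f g : small_mem g -> small_mem (f * g).
Proof.
by move=> [s hs]; exists (f * s) => P; rewrite !rmorphM hs mulrCA.
Qed.
(** Divisibility by alpha inside the algebra generated by the coordinates, rather
    than smallness of the values: the quotient is again in this algebra, so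
    that reduction to normal form can be iterated. *)
Definition small : ideal {mpoly V[4]} := @Ideal {mpoly V[4]} small_mem small0 smallD smallMl.

Lemma pcharV : p \in [pchar V].
Proof.
have pp := pcharf_prime (pcharC iota hF); rewrite inE pp; apply/eqP/val_inj.
by rewrite rmorph_nat (pcharf0 (pcharC iota hF)).
Qed.

Lemma pchar_mpoly (S : nzRingType) n : p \in [pchar S] -> p \in [pchar {mpoly S[n]}].
Proof.
move=> hp; rewrite inE (pcharf_prime hp) /=.
by rewrite -(rmorph_nat (@mpolyC n S)) (pcharf0 hp) raddf0.
Qed.

Lemma ring_of (c : C) : vge v 0 c -> exists d : V, val d = c.
Proof. by move=> h; exists (VRing (h : c \in vring_pred v)). Qed.

Local Notation B4 := {mpoly V[4]}.
Definition zX4 : B4 := 'X_2 - 'X_0 ^+ (q ^ 2 - 1).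

Lemma ev4_zX P : ev4 P zX4 = z_at P.
Proof. by rewrite rmorphB rmorphXn !ev4E. Qed.

Lemma ev4_alt P n f g : ev4 P (alt n f g) = alt n (ev4 P f) (ev4 P g).
Proof. by rewrite /alt rmorphB !rmorphM !rmorphXn. Qed.

Lemma small_relD : small (alt q 'X_0 'X_1 - 1).
Proof.
have [hg _] := v_gamma1 hF hpi2 halpha hgamma1.
have [g hg'] : exists d : V, val d = gamma1 / alpha.
  by apply: ring_of; apply: (vge_div valpha); rewrite add0r.
exists (g%:MP * 'X_2) => P.
rewrite /alt rmorphB rmorph1 rmorphB !rmorphM !rmorphXn !ev4E hg'.
have -> : x_at P ^+ q * y_at P - x_at P * y_at P ^+ q - 1 = gamma1 * Z_at P.
  exact: (D_rel hF hpi2 halpha hgamma1).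
by rewrite mulrA [alpha * _]mulrC divfK // (alpha0 hF hpi2 halpha).
Qed.

Lemma small_relZ :
  small (zX4 ^+ q - (alt (q ^ 3) 'X_0 'X_1 - 'X_0 ^+ (q ^ 3 - q))).
Proof.
have [i1 i2 i3 i4 i5] := coef_int hF hpi2 halpha.
have [d3 h3] := ring_of i3; have [d4 h4] := ring_of i4; have [d5 h5] := ring_of i5.
exists (d3%:MP * alt q 'X_0 'X_1 + d4%:MP * 'X_3 ^+ q * alt (q ^ 2) 'X_0 'X_1
  + d5%:MP * alt q 'X_0 'X_1) => P.
rewrite rmorphB rmorphXn ev4_zX rmorphB ev4_alt rmorphXn.
rewrite [ev4 P (_ + _ + _)]rmorphD [ev4 P (_ + _)]rmorphD !rmorphM rmorphXn.
rewrite !ev4_alt !ev4E h3 h4 h5.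
rewrite /z_at (frobB frob) -exprM.
have -> : ((q ^ 2 - 1) * q = q ^ 3 - q)%N by rewrite mulnBl mul1n -expnSr.
rewrite opprB addrA subrK.
have := Z_rel hF hpi2 halpha hgamma1 (pointP P).
by rewrite -/(x_at P) -/(y_at P) -/(Z_at P) -/(om_at P) => ->; rewrite addrC addKr.
Qed.

Local Notation hasnf := (has_nf q (@mpolyC 4 V) small 'X_0 'X_1 zX4).

(** Modulo alpha the normalized level one points are the q^2-th powers of x and y,
    so that om is a polynomial in them by om_rel. *)
Lemma nf_om : hasnf 'X_3.
Proof.
have [i1 i2 _ _ _] := coef_int hF hpi2 halpha.
have [d1 h1] := ring_of i1; have [d2 h2] := ring_of i2.
have [al hal] : exists d : V, val d = alpha.
  by apply: ring_of; rewrite valpha lee_fin ltW // A0.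
have vd := v_det_unit hF hpi2 halpha.
have [e he] : exists d : V, val d = - (det_unit iota q pi pi2 alpha)^-1.
  by apply: ring_of; rewrite vN (v_inv vd) oppr0.
pose s (t : B4) : B4 := d1%:MP * 'X_3 * t ^+ q + d2%:MP * t.
pose lv (t : B4) : B4 := t ^+ (q ^ 2) + al%:MP * s t.
have lvE t : small (lv t - t ^+ (q ^ 2)).
  by rewrite /lv addrC addKr; exists (s t) => P; rewrite rmorphM ev4C hal.
apply: (@nf_congr _ _ _ _ _ _ _ _ _ (e%:MP * alt (q ^ 2) ('X_0 ^+ (q ^ 2)) ('X_1 ^+ (q ^ 2)))).
  rewrite -['X_3](subrK (e%:MP * alt (q ^ 2) (lv 'X_0) (lv 'X_1))) -addrA.
  apply: idealD; last by rewrite -mulrBr; apply: idealMl; apply: icong_alt.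
    exists 0 => P; rewrite rmorph0 mulr0.
    have evl t' : ev4 P (lv t') = ev4 P t' ^+ (q ^ 2) + alpha *
        (level1_cu q alpha * om_at P * ev4 P t' ^+ q + level1_cx iota q pi alpha * ev4 P t').
      rewrite rmorphD rmorphXn rmorphM [ev4 P (s _)]rmorphD !rmorphM rmorphXn.
      by rewrite !ev4E h1 h2 hal.
    rewrite [ev4 P (_ - _)]rmorphB [ev4 P (_ * _)]rmorphM ev4_alt.
    rewrite (evl 'X_0) (evl 'X_1) !ev4E he.
    have := om_rel hF hpi2 halpha (pointP P).
    rewrite -/(x_at P) -/(y_at P) -/(om_at P) => h.
    by rewrite mulNr opprK -{1}[om_at P](mulfK (v_neq0 vd)) h mulNr [X in _ + X]mulrC addNr.
apply: nfZ; apply: (nf_alt q1 small_relD small_relZ); apply: (nfX q1 small_relD small_relZ).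
  exact: (nf_x q1 _ small_relD small_relZ).
exact: (nf_y q1 _ small_relD small_relZ).
Qed.

Lemma ord4P (i : 'I_4) : [\/ i = 0, i = 1, i = 2 | i = 3].
Proof.
by case: i => [[|[|[|[|//]]]] lt];
  [constructor 1|constructor 2|constructor 3|constructor 4]; apply: val_inj.
Qed.

Lemma mmap_id (S : comNzRingType) n (P : {mpoly S[n]}) :
  mmap (@mpolyC n S) (fun i => 'X_i) P = P.
Proof.
rewrite [RHS]mpolyE /mmap; apply: eq_bigr => m _.
by rewrite mmap1_id mul_mpolyC.
Qed.

(** Rewriting to normal form leaves a remainder that is alpha times an element of the
    same algebra, which can be rewritten in turn. *)
Lemma normal_approx (Phi : B4) K : exists (Q : {mpoly V[3]}) (Psi : B4),
  normal q Q /\ forall P, ev4 P Phi = ev3 P Q + alpha ^+ K * ev4 P Psi.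
Proof.
have step f : exists (Q : {mpoly V[3]}) (Psi : B4),
  normal q Q /\ forall P, ev4 P f = ev3 P Q + alpha * ev4 P Psi.
  have : hasnf f.
    rewrite -[f]mmap_id; apply: (nf_mpoly q1 small_relD small_relZ).
    move=> i; case: (ord4P i) => ->.
    - exact: (nf_x q1 _ small_relD small_relZ).
    - exact: (nf_y q1 _ small_relD small_relZ).
    - rewrite -['X_2](subrK ('X_0 ^+ (q ^ 2 - 1))).
      apply: nfD; first exact: (nf_z q1 _ small_relD small_relZ).
      by apply: (nfX q1 small_relD small_relZ); apply: (nf_x q1 _ small_relD small_relZ).
    - exact: nf_om.
  move=> [Q nQ [Psi hPsi]]; exists Q, Psi; split=> // P.
  have := hPsi P; rewrite rmorphB => /eqP; rewrite subr_eq addrC => /eqP ->.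
  congr (_ + _); apply: rmorph_mmap => [c|i]; first exact: ev4C.
  by rewrite (tri_map (ev4 P)) ev4_zX !ev4E.
have [al hal] : exists d : V, val d = alpha.
  by apply: ring_of; rewrite valpha lee_fin ltW // A0.
elim: K => [|K [Q [Psi [nQ hQ]]]].
  exists 0, Phi; split; first by move=> m; rewrite msupp0.
  by move=> P; rewrite rmorph0 add0r expr0 mul1r.
have [Q' [Psi' [nQ' hQ']]] := step Psi.
exists (Q + al ^+ K *: Q'), Psi'; split.
  by apply: normalD => //; apply: normalZ.
move=> P; rewrite hQ hQ' rmorphD -mul_mpolyC rmorphM.
have -> : ev3 P (al ^+ K)%:MP = alpha ^+ K.
  by rewrite -hal -rmorphXn; apply: (mmapC _ cval).
by rewrite mulrDr addrA mulrA -exprSr.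
Qed.

(** ** Linear independence of the normal monomials *)

(** One more q-th root is taken, to compare the values of z. *)
Definition eps3 : R := epsv R q / q%:R.
Lemma eps3_gt0 : 0 < eps3.
Proof. by rewrite divr_gt0 ?epsv_gt0 ?ltr0n ?(q0 hF) //; apply: (epsv_gt0 hF). Qed.

Lemma q_eq0C : q%:R = 0 :> C.
Proof.
have [_ [n qE]] := residue_facts hF.
have := q1; case: n qE => [->//|n ->] _.
by rewrite expnS natrM (pcharf0 (pcharC iota hF)) mul0r.
Qed.

(** The values of integral polynomials at the lifted points are close to those at the
    points (a^q, b^q) of the model curve. *)
Lemma point_ev3 a b : vge v 0 a -> vge v 0 b -> alt q a b = 1 -> exists P : Y,
  forall Q, vge v eps3 (ev3 P Q - mmap cval (tri (a ^+ q) (b ^+ q) (z_frob q a b)) Q).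
Proof.
move=> ha hb hab.
have [u [X' [Y' [hY hx hy]]]] := point_lift hF hpi2 halpha ha hb hab.
have [P EP] := point_of hY; exists P => Q.
have hxP : vge v (epsv R q) (x_at P - a ^+ q) by rewrite /x_at EP.
have hyP : vge v (epsv R q) (y_at P - b ^+ q) by rewrite /y_at EP.
have [ix iy iz io] := coord_int P.
have iaq : vge v 0 (a ^+ q) by apply: vge0_exp.
have ibq : vge v 0 (b ^+ q) by apply: vge0_exp.
have e3 : eps3 <= epsv R q.
  by rewrite /eps3 ler_pdivrMr ?ltr0n ?(q0 hF) // ler_pMr ?(epsv_gt0 hF) // ler1n (q0 hF).
have eA : epsv R q <= A.
  have l k : (0 < k)%N -> forall x : R, 0 <= x -> x / k%:R <= x.
    by move=> k0 x x0; rewrite ler_pdivrMr ?ltr0n // ler_peMr // ler1n.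
  rewrite /epsv; apply: le_trans (l _ _ _ _) (l _ _ _ _); rewrite ?expn_gt0 ?(q0 hF) //.
    by rewrite divr_ge0 // ltW // A0.
  by rewrite ltW // A0.
have hz : vge v eps3 (z_at P - z_frob q a b).
  rewrite /z_at /z_frob.
  have -> : a ^+ (q ^ 3 - q) = (a ^+ q) ^+ (q ^ 2 - 1).
    by rewrite -exprM; congr (_ ^+ _); rewrite mulnBr muln1 -expnS.
  have -> : Z_at P - x_at P ^+ (q ^ 2 - 1) - (alt (q ^ 3) a b - (a ^+ q) ^+ (q ^ 2 - 1)) =
    (Z_at P - alt (q ^ 3) a b) - (x_at P ^+ (q ^ 2 - 1) - (a ^+ q) ^+ (q ^ 2 - 1)) by ring.
  apply: v_ge_sub; last by apply: vge_trans e3 _; apply: vcongX.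
  apply: (@vge_exp_inv _ _ _ _ _ q); first exact: (q0 hF).
  have -> : eps3 *+ q = epsv R q.
    by rewrite -[LHS]mulr_natr divfK // pnatr_eq0 -lt0n (q0 hF).
  rewrite (frobB frob) (frob_alt frob).
  rewrite -[Z_at P ^+ q](subrK (alt (q ^ 3) (x_at P) (y_at P))) -addrA.
  apply: v_ge_add; first by apply: vge_trans eA _; apply: Z_small.
  by apply: vcong_alt.
apply: vcong_mmap.
- by case=> [[|[|[|//]]] lt]; rewrite !(tnth_nth 0) //=; apply: z_at_int.
- case=> [[|[|[|//]]] lt]; rewrite !(tnth_nth 0) //=.
  by apply: v_ge_sub; [apply: alt_int|apply: vge0_exp].
- by case=> [[|[|[|//]]] lt]; rewrite !(tnth_nth 0) //=; apply: vge_trans e3 _.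
Qed.

Lemma normal_indep_pos Q e : normal q Q -> 0 < e -> (forall P, vge v e (ev3 P Q)) ->
  forall m, (0 < v (val Q@_m))%E.
Proof.
move=> nQ e0 h; have e0' : 0 < Num.min e eps3 by rewrite lt_min e0 eps3_gt0.
apply: (normal_small q1 frob q_eq0C A0 valpha nQ e0') => a b ha hb hab.
have [P hP] := point_ev3 ha hb hab.
rewrite -[X in v X](subKr (ev3 P Q)); apply: v_ge_sub.
  by apply: vge_trans (h P); rewrite ge_min lexx.
by apply: vge_trans (hP Q); rewrite ge_min lexx orbT.
Qed.

Lemma mcoeff_sum_seq (S : nzRingType) n (s : seq 'X_{1..n}) (g : 'X_{1..n} -> S) m :
  uniq s -> (\sum_(k <- s) g k *: 'X_[k])@_m = if m \in s then g m else 0.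
Proof.
move=> us; rewrite raddf_sum /=; case: ifP => hm.
  rewrite (bigD1_seq m) //= mcoeffZ mcoeffX eqxx mulr1 big1 ?addr0 // => k /negPf km.
  by rewrite mcoeffZ mcoeffX km mulr0.
rewrite big_seq_cond big1 // => k /andP [ks _]; rewrite mcoeffZ mcoeffX.
by case: eqP ks => [->|_ _]; rewrite ?hm // mulr0.
Qed.

Lemma ev3_sum P (s : seq 'X_{1..3}) (g : 'X_{1..3} -> V) :
  ev3 P (\sum_(k <- s) g k *: 'X_[k]) =
  \sum_(k <- s) val (g k) * mmap1 (tri (x_at P) (y_at P) (z_at P)) k.
Proof.
rewrite rmorph_sum; apply: eq_bigr => k _; rewrite /ev3 /=.
by rewrite (mmapZ _ cval) (mmapX _ cval).
Qed.

Lemma divide_coef (Q : {mpoly V[3]}) (c : C) : normal q Q -> c != 0 ->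
  (forall m, vge v 0 (val Q@_m / c)) ->
  exists Q' : {mpoly V[3]}, [/\ normal q Q', forall m, val Q'@_m = val Q@_m / c
    & forall P, ev3 P Q = c * ev3 P Q'].
Proof.
move=> nQ c0 h; have /choice [g hg] : forall m, exists d : V, val d = val Q@_m / c.
  by move=> m; apply: ring_of.
exists (\sum_(k <- msupp Q) g k *: 'X_[k]); split.
- move=> m; rewrite mcoeff_msupp mcoeff_sum_seq ?msupp_uniq //.
  by case: ifP => [/nQ //|_]; rewrite eqxx.
- move=> m; rewrite mcoeff_sum_seq ?msupp_uniq //; case: ifP => [_|/negbT hm]; first exact: hg.
  by rewrite (memN_msupp_eq0 hm) !rmorph0 mul0r.
move=> P; rewrite ev3_sum mulr_sumr; apply: eq_bigr => k _.
by rewrite hg mulrA [c * _]mulrC divfK.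
Qed.

(** Dividing by the coefficient of least valuation reduces to normal_indep_pos, for
    this coefficient becomes 1. *)
Lemma normal_indep Q n : normal q Q -> (forall P, vge v (A *+ n) (ev3 P Q)) ->
  forall m, vge v (A *+ n) (val Q@_m).
Proof.
move=> nQ h m; rewrite leNgt; apply/negP => lt.
pose fv k := fine (v (val Q@_k)).
have fin k : k \in msupp Q -> v (val Q@_k) = (fv k)%:E.
  rewrite mcoeff_msupp => k0; have k0' : val Q@_k != 0 by [].
  by rewrite /fv; have [r ->] := v_fin v k0'.
have ms : m \in msupp Q.
  rewrite -[_ \in _]negbK; apply/negP => /memN_msupp_eq0 e.
  by move: lt; rewrite e rmorph0 v0 ltNge leey.
have [m0 m0s hmin] := exists_min fv ms.
have c0 : val Q@_m0 != 0 by apply: v_neq0 (fin _ m0s).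
have [Q' [nQ' cQ' eQ']] : exists Q' : {mpoly V[3]}, [/\ normal q Q',
    forall m, val Q'@_m = val Q@_m / val Q@_m0 & forall P, ev3 P Q = val Q@_m0 * ev3 P Q'].
  apply: divide_coef => // k; apply: (vge_div (fin _ m0s)); rewrite add0r.
  have [/[dup] ks /hmin|/memN_msupp_eq0 ->] := boolP (k \in msupp Q).
    by rewrite (fin _ ks) lee_fin.
  by rewrite rmorph0 v0 leey.
have mu0 : 0 < A *+ n - fv m0.
  rewrite subr_gt0; apply: le_lt_trans (hmin m ms) _.
  by move: lt; rewrite (fin _ ms) lte_fin.
suff hP P : vge v (A *+ n - fv m0) (ev3 P Q').
  by have := normal_indep_pos nQ' mu0 hP m0; rewrite cQ' divff // v1 ltxx.
have := h P; rewrite eQ' => hh.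
rewrite -[ev3 P Q'](mulKf c0) mulrC; apply: (vge_div (fin _ m0s)).
by rewrite subrK.
Qed.

(** ** Bounded functions modulo topologically nilpotent ones *)

(** Constants are scaled in this sense, hence so are all polynomial functions. *)
Definition scaled (g : Y -> C) : Prop :=
  exists n (Phi : {mpoly V[4]}), forall P, alpha ^+ n * g P = ev4 P Phi.

Let al_ex : exists d : V, val d = alpha.
Proof. by apply: ring_of; rewrite valpha lee_fin ltW // A0. Qed.

Lemma scaledD f g : scaled f -> scaled g -> scaled (fun P => f P + g P).
Proof.
have [al hal] := al_ex; move=> [n [s hs]] [n' [s' hs']].
exists (n + n')%N, ((al ^+ n')%:MP * s + (al ^+ n)%:MP * s') => P.
rewrite rmorphD !rmorphM -hs -hs' !ev4C !rmorphXn /= hal exprD; ring.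
Qed.

Lemma scaledM f g : scaled f -> scaled g -> scaled (fun P => f P * g P).
Proof.
move=> [n [s hs]] [n' [s' hs']]; exists (n + n')%N, (s * s') => P.
rewrite rmorphM -hs -hs' exprD; ring.
Qed.

Lemma scaledC c : scaled (fun=> c).
Proof.
have [->|/(v_fin v) [r hr]] := eqVneq c 0.
  by exists 0%N, 0 => P; rewrite rmorph0 mulr0.
pose n := Num.bound (`|r| / A).
have hn : `|r| < A *+ n.
  rewrite -[A *+ n]mulr_natl -ltr_pdivrMr ?A0 //.
  by apply: archi_boundP; rewrite divr_ge0 // ltW // A0.
have [d hd] : exists d : V, val d = alpha ^+ n * c.
  apply: ring_of; rewrite (v_mul (valphaX n) hr) lee_fin.
  by have := ler_norm (- r); rewrite normrN; lra.
by exists n, d%:MP => P; rewrite ev4C hd.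
Qed.

Lemma scaled_ext f g : (forall P, f P = g P) -> scaled f -> scaled g.
Proof. by move=> h [n [s hs]]; exists n, s => P; rewrite -h. Qed.

Lemma scaled_ev4 s : scaled (fun P => ev4 P s).
Proof. by exists 0%N, s => P; rewrite expr0 mul1r. Qed.

Lemma scaled_coord (i : 'I_3) : scaled (fun P => tnth (val P) i).
Proof.
have an := alpha0 hF hpi2 halpha.
have S : [\/ i = 0, i = 1 | i = 2].
  by case: i => [[|[|[|//]]] lt]; [constructor 1|constructor 2|constructor 3];
    apply: val_inj.
case: S => ->.
- apply: (@scaled_ext (fun P => alpha ^+ (q ^ 3 * (q - 1)) * ev4 P 'X_3)).
    by move=> P; rewrite ev4X3 /om_at mulrC divfK // expf_neq0.
  by apply: scaledM; [apply: scaledC|apply: scaled_ev4].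
- apply: (@scaled_ext (fun P => alpha * ev4 P 'X_0)).
    by move=> P; rewrite ev4X0 /x_at mulrC divfK.
  by apply: scaledM; [apply: scaledC|apply: scaled_ev4].
- apply: (@scaled_ext (fun P => alpha * ev4 P 'X_1)).
    by move=> P; rewrite ev4X1 /y_at mulrC divfK.
  by apply: scaledM; [apply: scaledC|apply: scaled_ev4].
Qed.

Lemma scaledX f n : scaled f -> scaled (fun P => f P ^+ n).
Proof.
move=> h; elim: n => [|n IH]; first by apply: scaled_ext (scaledC 1) => P; rewrite expr0.
by apply: scaled_ext (scaledM h IH) => P; rewrite exprS.
Qed.

Lemma scaled_poly (s : {mpoly C[3]}) : scaled (fun P => s.@[tnth (val P)]).
Proof.
apply: (@scaled_ext (fun P => \sum_(m <- msupp s) s@_m * \prod_i tnth (val P) i ^+ m i)).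
  by move=> P; rewrite mevalE.
elim: (msupp s) => [|m l IH].
  by apply: scaled_ext (scaledC 0) => P; rewrite big_nil.
apply: (@scaled_ext (fun P => s@_m * \prod_i tnth (val P) i ^+ m i +
    \sum_(k <- l) s@_k * \prod_i tnth (val P) i ^+ k i)).
  by move=> P; rewrite big_cons.
apply: scaledD => //; apply: scaledM; first exact: scaledC.
elim: (index_enum _) => [|i e IHe].
  by apply: scaled_ext (scaledC 1) => P; rewrite big_nil.
apply: (@scaled_ext (fun P => tnth (val P) i ^+ m i * \prod_(j <- e) tnth (val P) j ^+ m j)).
  by move=> P; rewrite big_cons.
by apply: scaledM => //; apply: scaledX; apply: scaled_coord.
Qed.

(** A bounded function is close to a polynomial with possibly large
    coefficients; the independence of the normal monomials shows that
    they are integral once the polynomial is in normal form. *)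
Lemma bounded_approx (f : bf) : exists2 Q : {mpoly V[3]}, normal q Q &
  forall P, vge v A (evb P f - ev3 P Q).
Proof.
have af : analytic (val f) by have := valP f; rewrite inE => -[].
have [s hs] := analytic_approx A af.
have [n [Phi hPhi]] := scaled_poly s.
have [Q0 [Psi [nQ0 hQ0]]] := normal_approx Phi n.+1.
have anz := expf_neq0 n (alpha0 hF hpi2 halpha).
have sint (P : Y) : vge v 0 (s.@[tnth (val P)]).
  rewrite -[s.@[_]](subKr (evb P f)); apply: v_ge_sub; first exact: bounded_ge0.
  by apply: vge_trans (hs P); apply: ltW A0.
have hc m : vge v (A *+ n) (val Q0@_m).
  apply: normal_indep nQ0 _ m => P.
  have -> : ev3 P Q0 = alpha ^+ n * s.@[tnth (val P)] - alpha ^+ n.+1 * ev4 P Psi.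
    by rewrite hPhi hQ0 addrK.
  apply: v_ge_sub; first by apply: vge_mulr => //; rewrite valphaX.
  rewrite exprS -mulrA; apply: vge_mull; first by rewrite valpha lee_fin ltW // A0.
  by apply: vge_mulr; [rewrite valphaX|apply: ev4_int].
have hc' m : vge v 0 (val Q0@_m / alpha ^+ n).
  by apply: (vge_div (valphaX n)); rewrite add0r.
have [Q [nQ _ hQ]] := divide_coef nQ0 anz hc'.
exists Q => // P.
have -> : evb P f - ev3 P Q = (evb P f - s.@[tnth (val P)]) + alpha * ev4 P Psi.
  apply: (mulfI anz); rewrite !mulrBr mulrDr mulrBr hPhi hQ0 hQ exprSr; ring.
apply: v_ge_add; first exact: hs.
by apply: vge_mulr; [rewrite valpha|apply: ev4_int].
Qed.

Lemma Y_inhabited : exists P : Y, True.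
Proof.
have q2 := q1.
pose s : {poly C} := 'X^q + (- 'X + 1).
have ss : size s = q.+1.
  rewrite size_polyDl size_polyXn // ltnS; apply: leq_trans (size_polyD _ _) _.
  by rewrite geq_max size_polyN size_polyX size_poly1 q1 (q0 hF).
have /closed_rootP [b /rootP hb] : size s != 1%N.
  by rewrite ss eqSS -lt0n (q0 hF).
have hab : alt q 1 b = 1.
  move: hb; rewrite !(hornerD, hornerN, hornerXn, hornerX, hornerC) => hb.
  rewrite /alt expr1n !mul1r; apply/eqP; rewrite -subr_eq0 -oppr_eq0 -hb.
  by apply/eqP; ring.
have ib := curve_b_int q1 (v1 v) hab.
have i1 : vge v 0 1 by rewrite v1.
by have [P _] := point_ev3 i1 ib hab; exists P.
Qed.

Lemma rmorph_relD (S T : comPzRingType) (f : {rmorphism S -> T}) a b n :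
  f (a ^+ n * b - a * b ^+ n - 1) = f a ^+ n * f b - f a * f b ^+ n - 1.
Proof. by rewrite !rmorphB !rmorphM !rmorphXn rmorph1. Qed.

Lemma rmorph_relZ (S T : comPzRingType) (f : {rmorphism S -> T}) z a b m n :
  f (z ^+ m - (a ^+ n * b - a * b ^+ n)) =
  f z ^+ m - (f a ^+ n * f b - f a * f b ^+ n).
Proof. by rewrite !rmorphB !rmorphM !rmorphXn. Qed.

Section Presentation.
Local Notation k := (residue v).
Local Notation redr := (Y22_reduction iota q pi pi2).
Local Notation cst := (reduction_cst (Y22_radii R q) (Y22_set iota q pi pi2)).
Variables x y Z : bf.
Hypotheses (hx : forall P, evb P x = x_at P) (hy : forall P, evb P y = y_at P)
  (hZ : forall P, evb P Z = Z_at P).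
Variable Psi : {rmorphism {mpoly k[3]} -> redr}.
Hypothesis PsiC : forall c : k, Psi c%:MP = cst c.
Hypothesis PsiX : forall i, Psi 'X_i = tri (red x) (red y) (red Z) i.
Local Notation J := (ideal_gen (reduction_eqns v q)).

Let Psi0 : Psi 'X_0 = red x. Proof. by rewrite PsiX. Qed.
Let Psi1 : Psi 'X_1 = red y. Proof. by rewrite PsiX. Qed.
Let Psi2 : Psi 'X_2 = red Z. Proof. by rewrite PsiX. Qed.

Lemma Psi_kills s : J s -> Psi s = 0.
Proof.
have red0 (f : bf) : (forall P, vge v A (evb P f)) -> red f = 0.
  move=> h; rewrite -(rmorph0 red); apply/redP.
  by exists A => [|P]; [apply: A0|rewrite rmorph0 subr0].
have r0 : red (x ^+ q * y - x * y ^+ q - 1) = 0.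
  apply: red0 => P; have := D_small P; rewrite /alt.
  by rewrite !rmorphB !rmorphM !rmorphXn rmorph1 hx hy.
have r1 : red (Z ^+ q - (x ^+ (q ^ 3) * y - x * y ^+ (q ^ 3))) = 0.
  apply: red0 => P; have := Z_small P; rewrite /alt.
  by rewrite !rmorphB !rmorphM !rmorphXn hx hy hZ.
apply: gen_kills => b; rewrite !inE => /orP [/eqP ->|/eqP ->].
  apply: etrans (rmorph_relD Psi _ _ _) _; rewrite Psi0 Psi1.
  exact: etrans (esym (rmorph_relD _ _ _ _)) r0.
apply: etrans (rmorph_relZ Psi _ _ _ _ _) _; rewrite Psi0 Psi1 Psi2.
exact: etrans (esym (rmorph_relZ _ _ _ _ _ _)) r1.
Qed.

Definition zX3 : {mpoly k[3]} := 'X_2 - 'X_0 ^+ (q ^ 2 - 1).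
Definition mres : {rmorphism V -> {mpoly k[3]}} := @mpolyC 3 k \o qpi (maxideal v).

(** Values of polynomials are compared with their images in the reduction by realizing
    them as bounded functions. *)
Lemma Psi_lift (Q : {mpoly V[3]}) : exists g : bf, (forall P, evb P g = ev3 P Q) /\
  red g = Psi (mmap mres (tri 'X_0 'X_1 zX3) Q).
Proof.
pose good (g : bf) (f : Y -> C) (s : {mpoly k[3]}) :=
  (forall P, evb P g = f P) /\ red g = Psi s.
have goodM g g' f f' s s' : good g f s -> good g' f' s' ->
    good (g * g') (fun P => f P * f' P) (s * s').
  move=> [h1 h2] [h1' h2']; split=> [P|]; first by rewrite rmorphM h1 h1'.
  by rewrite !rmorphM h2 h2'.
have goodX g f s n : good g f s -> good (g ^+ n) (fun P => f P ^+ n) (s ^+ n).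
  move=> [h1 h2]; split=> [P|]; first by rewrite rmorphXn h1.
  by rewrite !rmorphXn h2.
have gx : good x x_at 'X_0 by [].
have gy : good y y_at 'X_1 by [].
have gz : good (Z - x ^+ (q ^ 2 - 1)) z_at zX3.
  split=> [P|]; first by rewrite rmorphB rmorphXn hx hZ.
  by rewrite !rmorphB !rmorphXn Psi0 Psi2.
suff [g [h1 h2]] : exists g, good g (fun P => ev3 P Q) (mmap mres (tri 'X_0 'X_1 zX3) Q).
  by exists g.
have e3E P : ev3 P Q = mmap cval (tri (x_at P) (y_at P) (z_at P)) Q by [].
suff [g [h1 h2]] : exists g, good g
    (fun P => \sum_(m <- msupp Q) val Q@_m * mmap1 (tri (x_at P) (y_at P) (z_at P)) m)
    (\sum_(m <- msupp Q) mres Q@_m * mmap1 (tri 'X_0 'X_1 zX3) m).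
  by exists g; split=> // P; rewrite e3E h1.
elim: (msupp Q) => [|m s [g [h1 h2]]].
  exists 0; split=> [P|]; first by rewrite big_nil rmorph0.
  by rewrite big_nil !rmorph0.
have gc : good (bounded_cst _ _ Q@_m) (fun=> val Q@_m) (mres Q@_m).
  by split=> [P|]; [exact: evb_cst|rewrite PsiC reduction_cst_qpi].
have gm : exists g, good g (fun P => mmap1 (tri (x_at P) (y_at P) (z_at P)) m)
    (mmap1 (tri 'X_0 'X_1 zX3) m).
  have [i1 i2] := goodM _ _ _ _ _ _ (goodM _ _ _ _ _ _ (goodX _ _ _ (m 0) gx)
    (goodX _ _ _ (m 1) gy)) (goodX _ _ _ (m 2) gz).
  eexists; split=> [P|]; first by rewrite mmap1_tri -i1.
  by rewrite mmap1_tri -i2.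
have [g' h'] := gm; have [i1 i2] := goodM _ _ _ _ _ _ gc h'.
exists (bounded_cst (Y22_radii R q) (Y22_set iota q pi pi2) Q@_m * g' + g); split=> [P|].
  by rewrite big_cons rmorphD h1 i1.
by rewrite big_cons !rmorphD h2 i2.
Qed.

Lemma Psi_surj (f : bf) : exists s, Psi s = red f.
Proof.
have [Q _ hQ] := bounded_approx f; have [g [h1 h2]] := Psi_lift Q.
exists (mmap mres (tri 'X_0 'X_1 zX3) Q); rewrite -h2; apply/redP.
by exists A => [|P]; [apply: A0|rewrite h1 -opprB vN].
Qed.

Lemma pcharK : p \in [pchar k].
Proof.
rewrite inE (pcharf_prime pcharV) /= -(rmorph_nat (qpi (maxideal v))).
by rewrite (pcharf0 pcharV) rmorph0.
Qed.

(** Modulo the relations s is in normal form.  Lifting its coefficients to integers of C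
    gives a normal combination that is small on the affinoid, so its
    coefficients reduce to 0. *)
Lemma Psi_inj s : Psi s = 0 -> J s.
Proof.
move=> hs; pose B3 : comNzRingType := {mpoly k[3]}.
have frobB3 (f g : B3) : (f + g) ^+ q = f ^+ q + g ^+ q.
  by apply: (pcharF_frob hF); apply: pchar_mpoly; apply: pcharK.
have gen0 : J (alt q 'X_0 'X_1 - 1 : B3).
  by apply: gen_mem; rewrite inE eqxx.
have gen1 : J ('X_2 ^+ q - alt (q ^ 3) 'X_0 'X_1 : B3).
  by apply: gen_mem; rewrite !inE eqxx orbT.
have relZ : J (zX3 ^+ q - (alt (q ^ 3) 'X_0 'X_1 - 'X_0 ^+ (q ^ 3 - q)) : B3).
  rewrite /zX3 (frobB frobB3) -exprM.
  have -> : ((q ^ 2 - 1) * q = q ^ 3 - q)%N by rewrite mulnBl mul1n -expnSr.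
  by rewrite opprB addrA subrK.
have : has_nf q (@mpolyC 3 k) J 'X_0 'X_1 zX3 s.
  rewrite -[s]mmap_id; apply: (nf_mpoly q1 gen0 relZ) => i.
  have : [\/ i = 0, i = 1 | i = 2].
    by case: i => [[|[|[|//]]] lt]; [constructor 1|constructor 2|constructor 3];
      apply: val_inj.
  case=> ->.
  - exact: (nf_x q1 _ gen0 relZ).
  - exact: (nf_y q1 _ gen0 relZ).
  - rewrite -['X_2](subrK ('X_0 ^+ (q ^ 2 - 1))).
    apply: nfD; first exact: (nf_z q1 _ gen0 relZ).
    by apply: (nfX q1 gen0 relZ); apply: (nf_x q1 _ gen0 relZ).
move=> [N nN hN]; pose Q : {mpoly V[3]} := \sum_(m <- msupp N) repr N@_m *: 'X_[m].
have Qc m : m \in msupp N -> Q@_m = repr N@_m.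
  by move=> h; rewrite /Q mcoeff_sum_seq ?msupp_uniq // h.
have nQ : normal q Q.
  move=> m; rewrite mcoeff_msupp /Q mcoeff_sum_seq ?msupp_uniq //.
  by case: ifP => [/nN //|_]; rewrite eqxx.
have EN : mmap (@mpolyC 3 k) (tri 'X_0 'X_1 zX3) N = mmap mres (tri 'X_0 'X_1 zX3) Q.
  rewrite /Q raddf_sum [LHS]/mmap; apply: eq_bigr => m _.
  have E : mres (repr N@_m) = (N@_m)%:MP.
    have -> : mres (repr N@_m) = (qpi (maxideal v) (repr N@_m) : k)%:MP by [].
    by rewrite qreprK.
  apply: etrans (esym (mmapZ _ mres _ _)).
  by rewrite (mmapX _ mres) E.
have [g [h1 h2]] := Psi_lift Q.
have : red g = red 0.
  rewrite h2 -EN rmorph0; apply/eqP; rewrite -subr_eq0 subr0; apply/eqP.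
  have := Psi_kills hN; rewrite rmorphB hs sub0r => /eqP.
  by rewrite oppr_eq0 => /eqP.
move/redP => [e e0 he].
have pos : forall m, (0 < v (val Q@_m))%E.
  by apply: (normal_indep_pos nQ e0) => P; rewrite -h1; have := he P; rewrite rmorph0 subr0.
have N0 : N = 0.
  apply/eqP; rewrite -msupp_eq0; apply/eqP; case EN' : (msupp N) => [//|m l].
  have ms : m \in msupp N by rewrite EN' mem_head.
  have Q0 : qpi (maxideal v) Q@_m = qpi (maxideal v) 0.
    by apply/qpi_eq; rewrite subr0; apply: pos.
  have : N@_m = 0.
    apply: etrans (esym (qreprK N@_m)) _; rewrite -(Qc m ms).
    exact: etrans Q0 (rmorph0 (qpi (maxideal v))).
  by move/eqP; rewrite -[_ == 0]negbK -mcoeff_msupp ms.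
by move: hN; rewrite N0 rmorph0 subr0.
Qed.

End Presentation.

Lemma red_neq0 : (1 : Y22_reduction iota q pi pi2) != 0.
Proof.
have [P _] := Y_inhabited; apply/eqP.
rewrite -(rmorph1 red) -(rmorph0 red) => /redP [e e0 /(_ P)].
by rewrite rmorph1 rmorph0 subr0 v1 lee_fin leNgt e0.
Qed.

Lemma presentation (x y Z : bf) : (forall P, evb P x = x_at P) ->
  (forall P, evb P y = y_at P) -> (forall P, evb P Z = Z_at P) ->
  presents_reduction (red x) (red y) (red Z).
Proof.
move=> hx hy hZ.
pose cst : {rmorphism residue v -> Y22_reduction iota q pi pi2} :=
  reduction_cst (Y22_radii R q) (Y22_set iota q pi pi2).
have [Psi [PsiC PsiX]] := mpoly_lift cst (tri (red x) (red y) (red Z)) red_neq0.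
have [Phi hPhi] := quot_lift (Psi_kills hx hy hZ PsiX).
exists Phi; split; last by split; rewrite hPhi PsiX.
  have inj : injective Phi.
    move=> a b; case: (qpiP a) (qpiP b) => s -> [t ->]; rewrite !hPhi => e.
    apply/qpi_eq; apply: (Psi_inj hx hy hZ PsiC PsiX).
    by rewrite rmorphB e subrr.
  have surj (f : Y22_reduction iota q pi pi2) : exists a, Phi a = f.
    case: (qpiP f) => g ->; have [s <-] := Psi_surj hx hy hZ PsiC PsiX g.
    by exists (qpi _ s).
  have /choice [h hh] := surj.
  by exists h => // a; apply: inj; rewrite hh.
by move=> c; rewrite hPhi PsiC.
Qed.

(** ** The action on points, functions and coordinates *)

Section Action.
Variable g : 'M[OF_mod pi 2]_2.
Hypothesis hg : \det g = 1.
Local Notation w := (iota (val pi)).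
Local Notation lt := (Defs.pi_mul iota q pi).

Let dg0 i j : C := iota (val (digits q (g i j)).1).
Let dg1 i j : C := iota (val (digits q (g i j)).2).

Let fix0 i j : dg0 i j ^+ q = dg0 i j.
Proof.
have [h _ _] := digitsP hF (g i j).
by rewrite /dg0 -rmorphXn -(rmorphXn (val : vring vF -> F)) h.
Qed.
Let fix1 i j : dg1 i j ^+ q = dg1 i j.
Proof.
have [_ h _] := digitsP hF (g i j).
by rewrite /dg1 -rmorphXn -(rmorphXn (val : vring vF -> F)) h.
Qed.

Let int0 i j : vge v 0 (dg0 i j). Proof. exact: vemb_int. Qed.
Let int1 i j : vge v 0 (dg1 i j). Proof. exact: vemb_int. Qed.

Let det0 : dg0 0 0 * dg0 1 1 - dg0 0 1 * dg0 1 0 = 1.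
Proof.
have [h _] := digits_det hF hg.
have := congr1 (fun t => iota (val t)) h.
by rewrite !(rmorphB, rmorphM, rmorph1).
Qed.
Let det1 : dg0 0 0 * dg1 1 1 + dg1 0 0 * dg0 1 1 - dg0 0 1 * dg1 1 0 - dg1 0 1 * dg0 1 0 = 0.
Proof.
have [_ h] := digits_det hF hg.
have := congr1 (fun t => iota (val t)) h.
by rewrite !rmorph0 !(rmorphB, rmorphD, rmorphM) /= => ->.
Qed.

(** The second digits multiply level one points, which [pi]_u kills. *)
Lemma lt_comb u X1 Y1 i : lt u (lt u X1) = 0 -> lt u (lt u Y1) = 0 ->
  lt u (dg0 0 i * X1 + dg1 0 i * lt u X1 + (dg0 1 i * Y1 + dg1 1 i * lt u Y1)) =
  dg0 0 i * lt u X1 + dg0 1 i * lt u Y1.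
Proof.
move=> hX hY; have f1 : (1 : C) ^+ q = 1 by rewrite expr1n.
rewrite -[X in lt u (X + _)]mul1r -[X in lt u (_ + X)]mul1r.
rewrite (lt_lin iota hF) // !(lt_lin iota hF) // hX hY !mulr0 !addr0 !mul1r.
by [].
Qed.

(** mu_2 is multiplied by the first digit 1 of the determinant; the second digit,
    which would multiply D_q(X_1, Y_1), vanishes. *)
Lemma act_onY u X1 Y1 : onY iota q pi pi2 u X1 Y1 ->
  onY iota q pi pi2 u (formal_mul iota q u (g 0 0) X1 + formal_mul iota q u (g 1 0) Y1)
    (formal_mul iota q u (g 0 1) X1 + formal_mul iota q u (g 1 1) Y1).
Proof.
move=> [hu hX hY hm].
have cX := lt_comb 0 hX hY; have cY := lt_comb 1 hX hY.
have z (l m : C) : l ^+ q = l -> m ^+ q = m -> lt u (l * lt u X1 + m * lt u Y1) = 0.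
  by move=> hl hm'; rewrite (lt_lin iota hF) // hX hY !mulr0 addr0.
split=> //.
- by rewrite [X in lt u X]cX z.
- by rewrite [X in lt u X]cY z.
rewrite -[RHS]hm.
have := mu_form_act frob X1 Y1 (lt u X1) (lt u Y1) (fix0 0 0) (fix1 0 0) (fix0 0 1)
  (fix1 0 1) (fix0 1 0) (fix1 1 0) (fix0 1 1) (fix1 1 1).
by rewrite det0 det1 mul1r mul0r subr0 -cX -cY.
Qed.

Lemma act_ex : exists gY : Y -> Y, forall P, val (gY P) = right_act iota q g (val P).
Proof.
have /choice [gY h] : forall P : Y, exists P' : Y, val P' = right_act iota q g (val P).
  by move=> P; apply: point_of (act_onY (pointP P)).
by exists gY.
Qed.

Variable gY : Y -> Y.
Hypothesis hgY : forall P, val (gY P) = right_act iota q g (val P).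

Local Notation rad := (Y22_radii R q).

Definition lt_poly (i : 'I_3) : {mpoly C[3]} :=
  'X_i ^+ (q ^ 2) + 'X_0 * 'X_i ^+ q + w *: 'X_i.

Definition act_poly (i : 'I_2) : {mpoly C[3]} :=
  (dg0 0 i *: 'X_1 + dg1 0 i *: lt_poly 1) + (dg0 1 i *: 'X_2 + dg1 1 i *: lt_poly 2).

Let rad_ge0 i : 0 <= rad i.
Proof.
by case: i => [[|[|[|//]]] l]; rewrite /Y22_radii (tnth_nth 0) //= /Y22_radius divr_ge0.
Qed.

Let box := gauss_box v rad.
(** A bound for the degrees of the polynomials through which g acts. *)
Let deg := (q ^ 2 + q + 1)%N.

Lemma lt_box i : rad i = 0 -> box 1 deg 0 (lt_poly i).
Proof.
move=> ri; have q2 := q1; have bi := @gauss_boxU _ _ v _ rad i;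
  have b0 := @gauss_boxU _ _ v _ rad 0.
have qq : (0 < q ^ 2)%N by rewrite expn_gt0 (q0 hF).
apply: gauss_boxD; first apply: gauss_boxD.
- by apply: gauss_boxW (gauss_boxX (k := q ^ 2) bi); rewrite ?ri ?mul0rn ?mul1n /deg //; lia.
- apply: gauss_boxW (gauss_boxM b0 (gauss_boxX (k := q) bi)); rewrite ?mul1n /deg; try lia.
  by rewrite ri mul0rn addr0 rad_ge0.
- apply: gauss_boxZ; first exact: vemb_int.
  by apply: gauss_boxW bi; rewrite ?ri /deg //; lia.
Qed.

Lemma act_box i : box 1 deg 0 (act_poly i).
Proof.
have r1 : rad 1 = 0 by []; have r2 : rad 2 = 0 by [].
have b1 : box 1 deg 0 'X_1.
  by apply: gauss_boxW (@gauss_boxU _ _ v _ rad 1); rewrite ?r1 /deg //; lia.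
have b2 : box 1 deg 0 'X_2.
  by apply: gauss_boxW (@gauss_boxU _ _ v _ rad 2); rewrite ?r2 /deg //; lia.
by apply: gauss_boxD; apply: gauss_boxD; apply: gauss_boxZ => //; apply: lt_box.
Qed.

Definition act_polys : 3.-tuple {mpoly C[3]} := [tuple 'X_0; act_poly 0; act_poly 1].

Lemma act_polys_box i : box 1 deg (rad i) (tnth act_polys i).
Proof.
have b0 : box 1 deg (rad 0) 'X_0.
  by apply: gauss_boxW (@gauss_boxU _ _ v _ rad 0); rewrite /deg //; lia.
case: i => [[|[|[|//]]] l]; rewrite (tnth_nth 0) /=.
- by rewrite (_ : Ordinal l = 0) //; apply: val_inj.
- by rewrite (_ : Ordinal l = 1); [exact: act_box|apply: val_inj].
- by rewrite (_ : Ordinal l = 2); [exact: act_box|apply: val_inj].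
Qed.

Lemma act_polyE i (P : Y) : (act_poly i).@[tnth (val P)] =
  formal_mul iota q (tnth (val P) 0) (g 0 i) (tnth (val P) 1) +
  formal_mul iota q (tnth (val P) 0) (g 1 i) (tnth (val P) 2).
Proof.
by rewrite !(mevalD, mevalZ, mevalM, rmorphXn) /= !mevalXU.
Qed.

Lemma act_polys_ev (P : Y) i : tnth (val (gY P)) i = (tnth act_polys i).@[tnth (val P)].
Proof.
rewrite hgY; case: i => [[|[|[|//]]] l]; rewrite !(tnth_nth 0) /=.
- by rewrite mevalXU (tnth_nth 0).
- by rewrite act_polyE.
- by rewrite act_polyE.
Qed.

(** g acts through polynomials without constant term, so pulling back preserves
    analytic functions. *)
Lemma pull_ex : exists pull : bf -> bf, forall f P, evb P (pull f) = evb (gY P) f.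
Proof.
have /choice [h hh] : forall f : bf, exists F : bf, forall P, evb P F = evb (gY P) f.
  move=> f; have := valP f; rewrite inE => -[af /power_boundedP pf].
  have H : (fun P => f (gY P)) \in @bounded_pred _ _ v 3 rad (Y22_set iota q pi pi2).
    rewrite inE; split; last by apply/power_boundedP => P; apply: pf.
    exact: (@analytic_comp _ _ v 3 rad _ act_polys deg act_polys_box f gY act_polys_ev af).
  by exists (BoundedFun H).
by exists h.
Qed.

Lemma pull_rmorph : exists pull : {rmorphism bf -> bf}, forall f P, evb P (pull f) = evb (gY P) f.
Proof.
have [h hh] := pull_ex.
have hz : zmod_morphism h.
  by move=> f1 f2; apply: red_eq_ext => P; rewrite rmorphB !hh rmorphB.
have hm : monoid_morphism h.
  split; first by apply: red_eq_ext => P; rewrite hh !rmorph1.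
  by move=> f1 f2; apply: red_eq_ext => P; rewrite rmorphM !hh rmorphM.
pose H : {rmorphism bf -> bf} := HB.pack h
  (GRing.isZmodMorphism.Build _ _ h hz) (GRing.isMonoidMorphism.Build _ _ h hm).
by exists H.
Qed.

Lemma gbar_ex : exists (pull : bf -> bf)
    (gbar : {rmorphism Y22_reduction iota q pi pi2 -> Y22_reduction iota q pi pi2}),
  (forall f P, evb P (pull f) = evb (gY P) f) /\ forall f, gbar (red f) = red (pull f).
Proof.
have [pull hp] := pull_rmorph.
have kills (f : bf) : Y22_topnil iota q pi pi2 f -> red (pull f) = 0.
  move=> h; have : red f = red 0.
    have h' : Y22_topnil iota q pi pi2 (f - 0) by rewrite subr0.
    by move/qpi_eq: h'.
  move/redP => [e e0 he]; rewrite -(rmorph0 red); apply/redP.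
  by exists e => // P; have := he (gY P); rewrite !rmorph0 hp.
have [gbar hgbar] := @quot_lift _ _ (Y22_topnil iota q pi pi2) (redY \o pull) kills.
by exists pull, gbar.
Qed.

(** A class modulo pi and its first digit have the same image in the residue field. *)
Lemma scalarE i j : Y22_scalar iota q pi2 (bar (g i j)) =
  red (bounded_cst rad (Y22_set iota q pi pi2) (vemb_ring iota (digits q (g i j)).1)).
Proof.
rewrite /Y22_scalar; set d := digits q (g i j).
have -> : to_residue iota (bar (g i j)) = qpi (maxideal v) (vemb_ring iota d.1).
  apply/qpi_eq; suff h : vge v 1 (val (vemb_ring iota (repr (bar (g i j))) - vemb_ring iota d.1)).
    by apply: lt_le_trans h; rewrite lte_fin ltr01.
  rewrite rmorphB /= -rmorphB vembP -(rmorphB (val : vring vF -> F)).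
  have [_ _ ea] := digitsP hF (g i j).
  have e1 : vge vF 1 (val (repr (bar (g i j)) - repr (g i j))).
    apply/(pi_idealP hF 1); apply/qpi_eq; rewrite qreprK.
    by rewrite /bar /quot_map.
  have e2 : vge vF 2 (val (repr (g i j) - (d.1 + d.2 * pi))).
    by apply/(pi_idealP hF 2); apply/qpi_eq; rewrite qreprK ea.
  have e3 : vge vF 1 (val (d.2 * pi)).
    rewrite rmorphM; apply: vge_mull; first exact: vring_valP.
    by rewrite (v_pi hF).
  rewrite (_ : _ - d.1 = (repr (bar (g i j)) - repr (g i j)) +
    (repr (g i j) - (d.1 + d.2 * pi)) + d.2 * pi); last by ring.
  rewrite !rmorphD; apply: v_ge_add => //; apply: v_ge_add => //.
  by apply: vge_trans e2; rewrite ler1n.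
exact: reduction_cst_qpi.
Qed.

Let lin (i : 'I_2) (P : Y) : C := dg0 0 i * x_at P + dg0 1 i * y_at P.

Let lin_int i P : vge v 0 (lin i P).
Proof.
have [h1 h2 _ _] := coord_int P.
by apply: v_ge_add; apply: vge0_mul => //; apply: int0.
Qed.

(** Level one points have valuation at least q^2 A, which exceeds 2 A. *)
Lemma level1_small (P : Y) l m : vge v 0 l -> vge v 0 m ->
  vge v A ((l * lt (tnth (val P) 0) (tnth (val P) 1) +
            m * lt (tnth (val P) 0) (tnth (val P) 2)) / alpha).
Proof.
move=> hl hm; have [hu hX hY _] := pointP P.
have q2 : A + A <= A *+ (q ^ 2).
  rewrite -mulr2n; apply: (A_le hF); rewrite (_ : 2 = 2 ^ 1)%N //.
  by apply: leq_trans (_ : 2 ^ 2 <= _)%N; rewrite ?leq_exp2r ?q1.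
apply: (vge_div valpha).
by apply: v_ge_add; apply: vge_mull => //; apply: vge_trans q2 _; apply: (onY_X1 hF hu).
Qed.

Lemma act_x P : vge v A (x_at (gY P) - lin 0 P).
Proof.
have -> : x_at (gY P) - lin 0 P =
    (dg1 0 0 * lt (tnth (val P) 0) (tnth (val P) 1) +
     dg1 1 0 * lt (tnth (val P) 0) (tnth (val P) 2)) / alpha.
  have -> : x_at (gY P) =
      (formal_mul iota q (tnth (val P) 0) (g 0 0) (tnth (val P) 1) +
       formal_mul iota q (tnth (val P) 0) (g 1 0) (tnth (val P) 2)) / alpha.
    by rewrite /x_at hgY.
  rewrite /formal_mul -/(dg0 0 0) -/(dg1 0 0) -/(dg0 1 0) -/(dg1 1 0) /lin /x_at /y_at.
  move: (lt _ _) (lt _ _) (dg0 _ _) (dg0 _ _) (dg1 _ _) (dg1 _ _) => *; ring.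
exact: level1_small (int1 0 0) (int1 1 0).
Qed.

Lemma act_y P : vge v A (y_at (gY P) - lin 1 P).
Proof.
have -> : y_at (gY P) - lin 1 P =
    (dg1 0 1 * lt (tnth (val P) 0) (tnth (val P) 1) +
     dg1 1 1 * lt (tnth (val P) 0) (tnth (val P) 2)) / alpha.
  have -> : y_at (gY P) =
      (formal_mul iota q (tnth (val P) 0) (g 0 1) (tnth (val P) 1) +
       formal_mul iota q (tnth (val P) 0) (g 1 1) (tnth (val P) 2)) / alpha.
    by rewrite /y_at hgY.
  rewrite /formal_mul -/(dg0 0 1) -/(dg1 0 1) -/(dg0 1 1) -/(dg1 1 1) /lin /x_at /y_at.
  move: (lt _ _) (lt _ _) (dg0 _ _) (dg0 _ _) (dg1 _ _) (dg1 _ _) => *; ring.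
exact: level1_small (int1 0 1) (int1 1 1).
Qed.

(** On both sides of the linear action Z^q is close to D_(q^3)(x, y), which the
    determinant 1 preserves; Z is then preserved because the q-power map is
    additive. *)
Lemma act_Z P : vge v (A / q%:R) (Z_at (gY P) - Z_at P).
Proof.
apply: (@vge_exp_inv _ _ _ _ _ q); first exact: (q0 hF).
have -> : A / q%:R *+ q = A by rewrite -[LHS]mulr_natr divfK // pnatr_eq0 -lt0n (q0 hF).
have f3 i j : dg0 i j ^+ (q ^ 3) = dg0 i j by rewrite expq3 !fix0.
have E : alt (q ^ 3) (lin 0 P) (lin 1 P) = alt (q ^ 3) (x_at P) (y_at P).
  by rewrite (alt_lin _ _ (f3 0 0) (f3 0 1) (f3 1 0) (f3 1 1) (frobD3 frob)) det0 mul1r.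
have [x0 y0 _ _] := coord_int P; have [x0' y0' _ _] := coord_int (gY P).
rewrite (frobB frob).
have -> : Z_at (gY P) ^+ q - Z_at P ^+ q =
  (Z_at (gY P) ^+ q - alt (q ^ 3) (x_at (gY P)) (y_at (gY P))) +
  (alt (q ^ 3) (x_at (gY P)) (y_at (gY P)) - alt (q ^ 3) (lin 0 P) (lin 1 P)) -
  (Z_at P ^+ q - alt (q ^ 3) (x_at P) (y_at P)) by rewrite E; ring.
apply: v_ge_sub; last exact: Z_small.
apply: v_ge_add; first exact: Z_small.
by apply: vcong_alt; [|exact: lin_int| |exact: lin_int|apply: act_x|apply: act_y].
Qed.

End Action.

End Reduction.

(** * The action on the reduction *)

Theorem lemma4p12 (R : realType) (F : fieldType) (C : closedFieldType)
    (vF : valuation R F) (v : valuation R C) (iota : vembedding vF v)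
    (p q : nat) (pi : vring vF)
    (hF : local_field p q pi) (hC : completed_closure iota)
    (pi2 : C) (hpi2 : LT2_generator iota q pi pi2)
    (alpha gamma1 : C)
    (halpha : alpha ^+ (q * (q + 1)) = pi2)
    (hgamma1 : gamma1 ^+ q = alpha ^+ ((q - 1) * (q ^ 2 - 1)))
    (g : 'M[OF_mod pi 2]_2) (hg : \det g = 1) :
  let Y := Y22 iota q pi pi2 in
  let red := qpi (Y22_topnil iota q pi pi2) in
  let scalar := fun a : OF_mod pi 2 => Y22_scalar iota q pi2 (bar a) in
  exists x y Z : Y22_bounded iota q pi pi2,
    [/\ (forall P : Y, x P = tnth (val P) 1 / alpha),
        (forall P : Y, y P = tnth (val P) 2 / alpha)
      & (forall P : Y, x P ^+ q * y P - x P * y P ^+ q = 1 + gamma1 * Z P)]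
    /\ presents_reduction (red x) (red y) (red Z)
    /\ exists gY : Y -> Y,
        (forall P : Y, val (gY P) = right_act iota q g (val P))
        /\ exists gbar : {rmorphism Y22_reduction iota q pi pi2 ->
                                    Y22_reduction iota q pi pi2},
            (forall f : Y22_bounded iota q pi pi2,
               exists h : Y22_bounded iota q pi pi2,
                 (forall P : Y, h P = f (gY P)) /\ gbar (red f) = red h)
            /\ [/\ gbar (red x) =
                     scalar (g 0 0) * red x + scalar (g 1 0) * red y,
                   gbar (red y) =
                     scalar (g 0 1) * red x + scalar (g 1 1) * red y
                 & gbar (red Z) = red Z].
Proof.
move=> Y red scalar.
have [x [y [Z [hx hy hZ]]]] := coord_fun hF hpi2 halpha hgamma1.
have [gY hgY] := act_ex iota hF pi2 hg.
have [pull [gbar [hpull hgbar]]] := gbar_ex hF hgY.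
pose rd := @redY _ _ _ _ _ iota q pi pi2.
have lin_red (f : Y22_bounded iota q pi pi2) (i : 'I_2) :
    (forall P, vge v (unitv R q) (evb (gY P) f -
       (iota (val (digits q (g 0 i)).1) * x_at alpha P +
        iota (val (digits q (g 1 i)).1) * y_at alpha P))) ->
    rd (pull f) = scalar (g 0 i) * rd x + scalar (g 1 i) * rd y.
  move=> h; rewrite /scalar !(scalarE iota hF pi2) -2!(rmorphM rd) -(rmorphD rd).
  apply/redP; exists (unitv R q) => [|P]; first exact: (A_gt0 hF).
  by rewrite hpull rmorphD !rmorphM hx hy.
exists x, y, Z; split; last split.
- split=> [P|P|P]; [exact: hx|exact: hy|].
  have ex : x P = x_at alpha P := hx P; have ey : y P = y_at alpha P := hy P.
  have eZ : Z P = Z_at alpha gamma1 P := hZ P.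
  rewrite ex ey eZ -(D_rel hF hpi2 halpha hgamma1) -/(x_at alpha P) -/(y_at alpha P).
  by rewrite [RHS]addrC subrK.
- exact: (presentation hF hpi2 halpha hgamma1 hx hy hZ).
exists gY; split=> //; exists gbar; split.
  by move=> f; exists (pull f); split=> // P; apply: hpull.
split.
- rewrite (hgbar x); apply: lin_red => P; rewrite hx; exact: (act_x hF hpi2 halpha hgY P).
- rewrite (hgbar y); apply: lin_red => P; rewrite hy; exact: (act_y hF hpi2 halpha hgY P).
rewrite (hgbar Z); apply/redP; exists (unitv R q / q%:R) => [|P].
  by rewrite divr_gt0 ?(A_gt0 hF) // ltr0n (q0 hF).
rewrite hpull !hZ; exact: (act_Z hF hpi2 halpha hgamma1 hg hgY P).
Qed.
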